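(* Let $\Omega\subseteq\mathbb{R}^n$ be open, $u\in\mathcal{D}'(\Omega)$ and $f\in C^\infty(\Omega)$. Then (i) $\iota^{\mathrm{c}}u$ is moderate, (ii) $\sigma^{\mathrm{c}}f$ is moderate, (iii) $\iota^{\mathrm{c}}f-\sigma^{\mathrm{c}}f$ is negligible, and (iv) if $\iota^{\mathrm{c}}u$ is negligible then $u=0$.
   Context: Notation: $\mathbb{R}^+=[0,\infty)$. $K\Subset L$ means that $K$ is compact and contained in the interior of $L$. $\mathcal{U}_x(\Omega)$ is the set of open neighborhoods of $x$ in $\Omega$; $\mathcal{D}(\mathbb{R}^n)$ is the space of (complex-valued) test functions, $\mathcal{D}'(\Omega)$ the space of distributions (smooth functions are regarded as distributions via $\langle f,\varphi\rangle=\int f\varphi$). $U(\Omega)=\{(\varphi,x)\in\mathcal{D}(\mathbb{R}^n)\times\Omega : x+\operatorname{supp}\varphi\subseteq\Omega\}$. $\mathcal{B}^{\mathrm{c}}(\Omega)$ is the set of all maps $R:U(\Omega)\to\mathbb{C}$ such that $R(\varphi,\cdot)$ is smooth (on the open set of $x$ with $(\varphi,x)\in U(\Omega)$) for each fixed $\varphi$, with pointwise operations. $\iota^{\mathrm{c}}:\mathcal{D}'(\Omega)\to\mathcal{B}^{\mathrm{c}}(\Omega)$, $(\iota^{\mathrm{c}}u)(\varphi,x)=\langle u,\varphi(\cdot-x)\rangle$; $\sigma^{\mathrm{c}}:C^\infty(\Omega)\to\mathcal{B}^{\mathrm{c}}(\Omega)$, $(\sigma^{\mathrm{c}}f)(\varphi,x)=f(x)$.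 $\|g\|_{K,m}=\sup_{x\in K,|\alpha|\le m}|\partial^\alpha g(x)|$; $\|\varphi\|_c=\sup_{x\in\mathbb{R}^n,|\alpha|\le c}|\partial^\alpha\varphi(x)|$ for $\varphi\in\mathcal{D}(\mathbb{R}^n)$. For $\varphi\in\mathcal{D}(\mathbb{R}^n)$ let $\varphi^\star(x)(y)=\varphi(y-x)$, and let $\vec\delta(x)=\delta_x$; for $B$ a set of smooth functions, $\|\varphi^\star-\vec\delta\|_{K,c;B}=\sup_{x\in K,|\alpha|\le c,f\in B}\left|\int f(y)\,\partial_x^\alpha(\varphi(y-x))\,dy-\partial^\alpha f(x)\right|$. $\mathcal{P}_0=\mathbb{R}^+[y_0]$ (polynomials with coefficients in $\mathbb{R}^+$), $\mathcal{I}_0=\{\lambda\in\mathbb{R}^+[y_0,z_0] : \lambda(y_0,0)=0\}$. $R\in\mathcal{B}^{\mathrm{c}}(\Omega)$ is moderate if: $(\forall x\in\Omega)(\exists U\in\mathcal{U}_x(\Omega))(\forall K,L\Subset U: K\Subset L)(\forall m\in\mathbb{N}_0)(\exists c\in\mathbb{N}_0)(\exists\lambda\in\mathcal{P}_0)(\forall\varphi\in\mathcal{D}(\mathbb{R}^n): K+\operatorname{supp}\varphi\subseteq L)$: $\|R(\varphi,\cdot)\|_{K,m}\le\lambda(\|\varphi\|_c)$. $R$ is negligible if: $(\forall x\in\Omega)(\exists U\in\mathcal{U}_x(\Omega))(\forall K,L\Subset U: K\Subset L)(\forall m\in\mathbb{N}_0)(\exists c\in\mathbb{N}_0)(\exists\lambda\in\mathcal{I}_0)(\exists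 B\subseteq C^\infty(U)\text{ bounded})(\forall\varphi\in\mathcal{D}(\mathbb{R}^n): K+\operatorname{supp}\varphi\subseteq L)$: $\|R(\varphi,\cdot)\|_{K,m}\le\lambda(\|\varphi\|_c,\|\varphi^\star-\vec\delta\|_{K,c;B})$. *)

(* Defs.v *)
(* The complex numbers are R[i] for an arbitrary R : realType.
   A function defined on a subset of R^n is represented by a total function
   on 'rV[R]_n, and every notion below only looks at its values on that subset. *)
From HB Require Import structures.
From mathcomp Require Import all_boot all_order all_algebra.
From mathcomp Require Import complex.
From mathcomp Require Import all_classical all_reals all_analysis.

Set Implicit Arguments.
Unset Strict Implicit.
Unset Printing Implicit Defensive.
Import Order.TTheory GRing.Theory Num.Theory.
Import numFieldNormedType.Exports.

Local Open Scope classical_set_scope.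
Local Open Scope complex_scope.
Local Open Scope ring_scope.

Section LebesgueStep.
Variables (R : realType) (n : nat).
Let T := n.-tuple (measurableTypeR R).
Let T1 := n.+1.-tuple (measurableTypeR R).
Variable mu : {sigma_finite_measure set T -> \bar R}.

Definition tcons (p : measurableTypeR R * T) : T1 := [tuple of p.1 :: p.2].

Lemma measurable_tcons : measurable_fun [set: measurableTypeR R * T] tcons.
Proof. exact: (measurable_cons measurable_fst measurable_snd). Qed.

Let tuncons (t : T1) : measurableTypeR R * T := (thead t, [tuple of behead t]).

Let measurable_tuncons : measurable_fun [set: T1] tuncons.
Proof.
apply/measurable_fun_pairP; split; last exact: measurable_behead.
exact: (measurable_tnth ord0).
Qed.

Let tconsK : cancel tcons tuncons.
Proof. by case=> a t; congr pair; exact/val_inj. Qed.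

Definition lebesgue_step : set T1 -> \bar R :=
  pushforward (@lebesgue_measure R \x mu)%E tcons.

Let lebesgue_step0 : lebesgue_step set0 = 0%E.
Proof. by rewrite /lebesgue_step /pushforward preimage_set0 measure0. Qed.

Let lebesgue_step_ge0 A : (0 <= lebesgue_step A)%E.
Proof. by rewrite /lebesgue_step /pushforward; exact: measure_ge0. Qed.

Let lebesgue_step_sigma_additive : semi_sigma_additive lebesgue_step.
Proof. by apply: measure_semi_sigma_additive; exact: measurable_tcons. Qed.

HB.instance Definition _ := isMeasure.Build _ _ _ lebesgue_step
  lebesgue_step0 lebesgue_step_ge0 lebesgue_step_sigma_additive.

Let lebesgue_step_sigma_finite : sigma_finite [set: T1] lebesgue_step.
Proof.
have /sigma_finiteP[F [FT ndF Foo]] := sigma_finiteT (@lebesgue_measure R).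
have /sigma_finiteP[G [GT ndG Goo]] := sigma_finiteT mu.
exists (fun k => tuncons @^-1` (F k `*` G k)).
  rewrite -preimage_bigcup; apply/seteqP; split=> // t _ /=.
  have [i _ Fi] : (\bigcup_i F i) (thead t) by rewrite -FT.
  have [j _ Gj] : (\bigcup_j G j) [tuple of behead t] by rewrite -GT.
  exists (maxn i j) => //; split=> /=.
    by move: Fi; exact/subsetPset/ndF/leq_maxl.
  by move: Gj; exact/subsetPset/ndG/leq_maxr.
move=> k; have [mF Fk] := Foo k; have [mG Gk] := Goo k; split.
  rewrite -[X in measurable X]setTI; apply: measurable_tuncons => //.
  exact: measurableX.
rewrite /lebesgue_step /pushforward -comp_preimage.
rewrite (_ : _ \o _ = id); last exact/funext/tconsK.
by rewrite preimage_id product_measure1E// lte_mul_pinfty// ge0_fin_numE.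
Qed.

HB.instance Definition _ := Measure_isSigmaFinite.Build _ _ _ lebesgue_step
  lebesgue_step_sigma_finite.

End LebesgueStep.

(* n-dimensional Lebesgue measure on R^n = n.-tuple R: the point mass on R^0,
   and on R^n.+1 the product of lebesgue_measure with the measure on R^n. *)
Fixpoint lebesgue_tuple (R : realType) (n : nat) :
    {sigma_finite_measure set (n.-tuple (measurableTypeR R)) -> \bar R} :=
  match n with
  | 0%N => @dirac _ _ [tuple] R
  | n'.+1 => lebesgue_step (lebesgue_tuple R n')
  end.

Section Calculus.
Variables (R : realType) (n : nat).
Local Notation Rn := 'rV[R]_n.
Local Notation C := R[i].
Implicit Types (A K L U Om : set Rn) (g phi f : Rn -> C) (m c : nat).

(* As always for Rintegral, the value is only meaningful for integrable g; all
   the integrands below are continuous with compact support. *)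
Definition integralRn g : C :=
  let v (t : n.-tuple (measurableTypeR R)) : Rn := \row_i tnth t i in
  (\int[lebesgue_tuple R n]_t complex.Re (g (v t)))%R +i*
  (\int[lebesgue_tuple R n]_t complex.Im (g (v t)))%R.

Definition partial_word (s : seq 'I_n) (h : Rn -> R) : Rn -> R :=
  foldr (fun i k => 'D_('e_i) k) h s.

Definition multi_index := {ffun 'I_n -> nat}.

Definition mi_size (a : multi_index) : nat := (\sum_i a i)%N.

Definition partialR (a : multi_index) : (Rn -> R) -> Rn -> R :=
  partial_word (flatten [seq nseq (a i) i | i <- enum 'I_n]).

Definition partial (a : multi_index) g (x : Rn) : C :=
  partialR a (fun y => complex.Re (g y)) x +i*
  partialR a (fun y => complex.Im (g y)) x.

(* All iterated partial derivatives, taken in any order, exist and are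
   continuous at every point of A (A is open wherever this is used). *)
Definition smoothR A (h : Rn -> R) : Prop :=
  forall (s : seq 'I_n) (x : Rn), A x ->
    {for x, continuous (partial_word s h)} /\
    (forall i, derivable (partial_word s h) x 'e_i).

Definition smooth A g : Prop :=
  smoothR A (fun x => complex.Re (g x)) /\ smoothR A (fun x => complex.Im (g x)).

Definition supp g : set Rn := closure [set x | g x != 0].

(* D(Om); in particular D(R^n) is testfun setT. *)
Definition testfun Om : set (Rn -> C) :=
  [set phi | [/\ smooth setT phi, compact (supp phi) & supp phi `<=` Om]].

(* ||g||_{K,m}; and ||phi||_c is seminorm setT c phi.  The real sup is 0 on the
   empty set; the sets involved are bounded in all the uses below, since there
   either K is compact and g smooth around K, or g is a test function. *)
Definition seminorm K m g : R :=
  sup [set Normc.normc (partial a g x) | x in K & a in [set a | (mi_size a <= m)%N]].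

(* Continuity of u on D(Om) is given by the usual seminorm estimates. *)
Definition is_distribution Om (u : (Rn -> C) -> C) : Prop :=
  (forall (a : C) phi psi, testfun Om phi -> testfun Om psi ->
     u (fun y => a * phi y + psi y) = a * u phi + u psi) /\
  (forall K, compact K -> K `<=` Om ->
     exists (M : R) (m : nat), forall phi, testfun Om phi -> supp phi `<=` K ->
       Normc.normc (u phi) <= M * seminorm setT m phi).

(* It is only applied to test functions supported in the domain of f, so that
   the values of f outside its domain do not matter. *)
Definition dist_of_fun f (phi : Rn -> C) : C :=
  integralRn (fun y => f y * phi y).

(* The section at phi of U(Om). *)
Definition Udom Om phi : set Rn :=
  [set x | Om x /\ forall y, supp phi y -> Om (x + y)].

Implicit Types (r : (Rn -> C) -> Rn -> C).

(* B^c(Om): r stands for a map on U(Om); its values elsewhere are irrelevant. *)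
Definition Bc Om : set ((Rn -> C) -> Rn -> C) :=
  [set r | forall phi, testfun setT phi -> smooth (Udom Om phi) (r phi)].

Definition iota_c (u : (Rn -> C) -> C) : (Rn -> C) -> Rn -> C :=
  fun phi x => u (fun y => phi (y - x)).

Definition sigma_c f : (Rn -> C) -> Rn -> C := fun _ x => f x.

Definition compactly_inside K L : Prop := compact K /\ K `<=` L°.

Definition translates_in K phi L : Prop :=
  forall x y, K x -> supp phi y -> L (x + y).

Definition bounded_Cinfty U (B : set (Rn -> C)) : Prop :=
  (forall f, B f -> smooth U f) /\
  (forall K m, compact K -> K `<=` U ->
     exists M : R, forall f, B f -> seminorm K m f <= M).

(* ||phi^* - delta||_{K,c;B}. The supremum is over a bounded set when B is
   bounded in C^oo(U), K is compact and K + supp phi `<=` L with K, L compact in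
   U; it is 0 when the set is empty. *)
Definition delta_seminorm K c (B : set (Rn -> C)) phi : R :=
  sup [set t | exists x (a : multi_index) f,
    [/\ K x, (mi_size a <= c)%N, B f &
        t = Normc.normc
          (integralRn (fun y => f y * partial a (fun x' => phi (y - x')) x)
           - partial a f x)]].

(* R^+[y0] *)
Definition P0 : set {poly R} := [set l | forall i, 0 <= (l : {poly R})`_i].

(* A polynomial in R[y0, z0] is represented in {poly {poly R}}, with inner
   variable y0 and outer variable z0. *)
Definition I0 : set {poly {poly R}} :=
  [set l | (forall i j, 0 <= ((l : {poly {poly R}})`_i : {poly R})`_j) /\ l.[0] = 0].

Definition eval2 (l : {poly {poly R}}) (y z : R) : R := l.[z%:P].[y].

Definition c_moderate Om r : Prop :=
  Bc Om r /\
  forall x, Om x -> exists U, [/\ open U, U x, U `<=` Om &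
    forall K L, compactly_inside K U -> compactly_inside L U ->
      compactly_inside K L ->
    forall m, exists c l, P0 l /\
    forall phi, testfun setT phi -> translates_in K phi L ->
      seminorm K m (r phi) <= l.[seminorm setT c phi]].

Definition c_negligible Om r : Prop :=
  Bc Om r /\
  forall x, Om x -> exists U, [/\ open U, U x, U `<=` Om &
    forall K L, compactly_inside K U -> compactly_inside L U ->
      compactly_inside K L ->
    forall m, exists c l B, [/\ I0 l, bounded_Cinfty U B &
    forall phi, testfun setT phi -> translates_in K phi L ->
      seminorm K m (r phi) <=
      eval2 l (seminorm setT c phi) (delta_seminorm K c B phi)]].

End Calculus.

(* Main.v *)
(* Moderateness of the image of a distribution comes from its seminorm estimates,
   since derivatives in x fall on the translated test function; and the image of f
   minus f is the very quantity bounded by the seminorm of phi-star minus delta for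
   B = {f}, so that lambda = z0 works.

   For (iv), insert product mollifiers phi_e whose moments of order 1, ..., N - 1 vanish.
   Then ||phi_e||_c is at most a fixed negative power of e, whereas the seminorm of
   phi_e-star minus delta over any bounded B is O(e^N), by Taylor's formula in one
   variable at a time. As lambda(y, 0) = 0, for N large negligibility forces the
   regularizations x |-> u(phi_e(. - x)) to tend to 0 uniformly on the support of a
   test function psi. For even phi_e their integral against psi is u(psi * phi_e),
   which is seen by approximating psi * phi_e by finite sums of translates of phi_e,
   while psi * phi_e tends to psi; hence u(psi) = 0. *)
Require Import Defs.
From mathcomp Require Import all_boot all_order all_algebra.
From mathcomp Require Import complex.
From mathcomp Require Import all_classical all_reals all_analysis.
From mathcomp Require Import measurable_realfun ring lra.
Set Implicit Arguments.
Unset Strict Implicit.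
Unset Printing Implicit Defensive.
Import Order.TTheory GRing.Theory Num.Theory.
Import numFieldNormedType.Exports.
Local Open Scope classical_set_scope.
Local Open Scope complex_scope.
Local Open Scope ring_scope.

(** * Calculus on R^n *)

(** The order of choices makes (iv) possible. Near a point, negligibility fixes [c], lambda and [B]
    before any test function is chosen. As long as the second argument z is at most 1, lambda(y, z)
    is at most [A * Y ^+ p * z] for any [Y] above 1 and y, and kernels of width e allow [Y] of order
    [e^-1 ^+ (c + n)]; hence every N above [(c + n) * p] works at that point. One N must serve the
    whole support of psi, whence a finite cover. The value u(psi * phi) is never computed. It is
    enough to bound it by a constant independent of phi times the supremum of x |-> u(phi(. - x))
    over the support of psi. A Riemann sum gives this bound, provided that its nodes and weights
    serve all derivatives of phi at all points at once, since u is controlled by finitely many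
    derivatives on a compact set. Differentiation under u and under the integral rests on one
    criterion: a remainder bounded by a multiple of s^2 identifies the derivative at 0. *)

Section OneVariable.
Variable R : realType.

(** The two difference quotients are the same function, so one-variable calculus on a line gives
    statements about directional derivatives. *)
Lemma line_is_derive (V : normedModType R) (h : V -> R) (x v : V) (t : R) :
  derivable h (x + t *: v) v ->
  is_derive t 1 (fun s : R => h (x + s *: v)) ('D_v h (x + t *: v)).
Proof.
have E : (fun s : R => s^-1 *: (((fun s : R => h (x + s *: v)) \o shift t) (s *: 1)
            - h (x + t *: v)))
       = (fun s : R => s^-1 *: ((h \o shift (x + t *: v)) (s *: v) - h (x + t *: v))).
  apply/funext => s /=; congr (_ *: (h _ - _)).
  by rewrite scalerDl addrCA /GRing.scale /= mulr1.
move=> dh; apply: DeriveDef; first by rewrite /derivable E.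
by rewrite /derive E.
Qed.

(** The increment [t] may have either sign, so the intermediate point is located by its absolute
    value only. *)
Lemma MVT0 (f df : R -> R) (t : R) :
  (forall s : R, `|s| <= `|t| -> is_derive s 1 f (df s)) ->
  exists2 s, `|s| <= `|t| & f t - f 0 = df s * t.
Proof.
move=> dfP.
have cts a b : `|a| <= `|t| -> `|b| <= `|t| -> {within `[a, b], continuous f}.
  move=> at_ bt; apply: derivable_within_continuous => s; rewrite in_itv/= => /andP[as_ sb].
  by have [] := dfP s ltac:(move: at_ bt; rewrite !ler_norml; lra).
have [t0|t0] := leP 0 t.
  have [s|s|c] := @MVT_segment R f df 0 t t0.
  - rewrite in_itv/= => /andP[s0 st]; apply: dfP.
    by rewrite (ger0_norm t0) ger0_norm ltW.
  - by apply: cts; rewrite ?normr0.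
  - rewrite in_itv/= => /andP[c0 ct] ->; exists c; last by rewrite subr0.
    by rewrite !ger0_norm.
have [s|s|c] := @MVT_segment R f df t 0 (ltW t0).
- rewrite in_itv/= => /andP[s0 st]; apply: dfP.
  by rewrite !ltr0_norm// lerN2 ltW.
- by apply: cts; rewrite ?normr0.
- rewrite in_itv/= => /andP[c0 ct] E; exists c.
    by rewrite (ltr0_norm t0) ler0_norm// lerN2.
  by rewrite -opprB E; ring.
Qed.

(** The remainder after [N.+1] terms vanishes at 0, and its derivative is the remainder after [N]
    terms of the shifted chain. The mean value theorem turns each order into one factor [t];
    integrating instead would add a factor 1/N! to the constant. *)
Lemma taylor_bound (N : nat) (k : nat -> R -> R) (r C : R) :
  (forall j (s : R), (j < N)%N -> `|s| <= r -> is_derive s 1 (k j) (k j.+1 s)) ->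
  (forall s, `|s| <= r -> `|k N s| <= C) ->
  forall t, `|t| <= r ->
    `|k 0%N t - \sum_(j < N) k j 0 * t ^+ j / j`!%:R| <= C * `|t| ^+ N.
Proof.
elim: N k => [|N IH] k dk kC t tr.
  by rewrite big_ord0 subr0 expr0 mulr1; exact: kC.
pose e s := k 0%N s - \sum_(j < N.+1) k j 0 * s ^+ j / j`!%:R.
pose de s := k 1%N s - \sum_(j < N) k j.+1 0 * s ^+ j / j`!%:R.
have e0 : e 0 = 0.
  rewrite /e big_ord_recl /= expr0 fact0 mulr1 divr1 big1 ?addr0 ?subrr// => i _.
  by rewrite /bump leq0n expr0n/= mulr0 mul0r.
have deP (s : R) : `|s| <= `|t| -> is_derive s 1 e (de s).
  move=> st.
  have H : is_derive s 1 (fun s : R => \sum_(j < N.+1) k j 0 * s ^+ j / j`!%:R)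
     (\sum_(j < N) k j.+1 0 * s ^+ j / j`!%:R).
    have -> : (fun s : R => \sum_(j < N.+1) k j 0 * s ^+ j / j`!%:R) =
       \sum_(j < N.+1) (fun s : R => k j 0 * s ^+ j / j`!%:R).
      by apply/funext => y; rewrite fct_sumE.
    have -> : \sum_(j < N) k j.+1 0 * s ^+ j / j`!%:R =
        \sum_(j < N.+1) (k j 0 * (j%:R * s ^+ j.-1) / j`!%:R).
      rewrite big_ord_recl /= mul0r mulr0 mul0r add0r.
      apply: eq_bigr => i _; rewrite /bump leq0n add1n add0n factS natrM.
      have : i.+1%:R != 0 :> R by rewrite pnatr_eq0.
      have : i`!%:R != 0 :> R by rewrite pnatr_eq0 -lt0n fact_gt0.
      move: (i.+1%:R : R) (i`!%:R : R) => p q p0 q0; field.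
      by rewrite p0 q0.
    apply: is_derive_sum => j.
    have -> : (fun s : R => k j 0 * s ^+ j / j`!%:R) =
       (k j 0 / j`!%:R) *: (fun s : R => s ^+ j).
      by apply/funext => y; rewrite -[RHS]/(k j 0 / j`!%:R * y ^+ j); ring.
    have H0 : is_derive s 1 (fun s : R => s ^+ j) (j%:R * s ^+ j.-1).
      have := @is_deriveX R R id j s 1 1 (is_derive_id _ _).
      by rewrite exprfctE => H0; apply: (is_derive_eq H0); rewrite /GRing.scale /= mulr1.
    apply: (is_derive_eq (is_deriveZ _ H0)).
    by rewrite /GRing.scale /=; ring.
  have H1 : is_derive s 1 (k 0%N) (k 1%N s) by apply: dk => //; exact: le_trans tr.
  exact: is_deriveB.
have [s st] := MVT0 deP.
rewrite e0 subr0 /e => ->; rewrite normrM exprS mulrCA [leRHS]mulrC.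
apply: ler_wpM2r => //.
have C0 : 0 <= C by apply: le_trans (kC t tr).
apply: le_trans (_ : C * `|s| ^+ N <= _).
  apply: (IH (fun j => k j.+1)) => [j s' jN|s'|]; [exact: dk|exact: kC|].
  exact: le_trans tr.
by apply: ler_wpM2l => //; apply: lerXn2r; rewrite ?nnegrE.
Qed.

End OneVariable.

Section RowNorm.
Variables (R : realType) (n : nat).
Local Notation Rn := 'rV[R]_n.

Lemma rv_norm_le (x : Rn) (b : R) :
  0 <= b -> (forall i, `|x ord0 i| <= b) -> `|x| <= b.
Proof.
move=> b0 xb; rewrite {1}/Num.norm /= mx_normrE; apply: bigmax_le => //= -[i j] _ /=.
by rewrite ord1; exact: xb.
Qed.

Lemma rv_norm_ge (x : Rn) i : `|x ord0 i| <= `|x|.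
Proof.
rewrite [leRHS]/Num.norm /= mx_normrE.
by apply/bigmax_geP; right => /=; exists (ord0, i).
Qed.

Lemma norm_delta_le1 i : `|('e_i : Rn)| <= 1.
Proof.
apply: rv_norm_le => // j; rewrite mxE eqxx /=; case: eqP => _ /=.
  by rewrite normr1.
by rewrite normr0.
Qed.

End RowNorm.

Section LineDerivative.
Variables (R : realType) (V : normedModType R).

Lemma is_derive_line0 (h : V -> R) (x v : V) (d : R) :
  is_derive (0 : R) 1 (fun s : R => h (x + s *: v)) d -> is_derive x v h d.
Proof.
have E : (fun s : R => s^-1 *: (((fun s : R => h (x + s *: v)) \o shift 0) (s *: 1)
            - h (x + 0 *: v)))
       = (fun s : R => s^-1 *: ((h \o shift x) (s *: v) - h x)).
  apply/funext => s /=; rewrite scale0r !addr0; congr (_ *: (h _ - _)).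
  by rewrite addrC /GRing.scale /= mulr1.
case=> dh <-; apply: DeriveDef; first by move: dh; rewrite /derivable E.
by rewrite /derive E.
Qed.

Lemma is_derive_reflect (h : V -> R) (c x v : V) :
  derivable h (c - x) v ->
  is_derive x v (fun y => h (c - y)) (- 'D_v h (c - x)).
Proof.
move=> dh; apply: is_derive_line0.
have -> : (fun s : R => h (c - (x + s *: v))) =
          (fun s : R => h ((c - x) + s *: v)) \o (-%R).
  by apply/funext => s /=; rewrite opprD addrA scaleNr.
have H : is_derive (- (0 : R)) 1 (fun s : R => h ((c - x) + s *: v)) ('D_v h (c - x)).
  have := @line_is_derive R V h (c - x) v (- 0).
  by rewrite oppr0 scale0r addr0; exact.
apply: (is_derive_eq (is_derive1_comp H (is_deriveNid (0 : R) 1))).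
by rewrite mulrN1.
Qed.

Lemma derive_translate (h : V -> R) (c v : V) :
  'D_v (fun y => h (y + c)) = fun y => 'D_v h (y + c).
Proof.
apply/funext => y.
have E : (fun s : R => s^-1 *: (((fun y => h (y + c)) \o shift y) (s *: v) - h (y + c)))
       = (fun s : R => s^-1 *: ((h \o shift (y + c)) (s *: v) - h (y + c))).
  by apply/funext => s /=; rewrite addrA.
by rewrite /derive E.
Qed.

Lemma derivable_translate (h : V -> R) (c x v : V) :
  derivable h (x + c) v -> derivable (fun y => h (y + c)) x v.
Proof.
have E : (fun s : R => s^-1 *: (((fun y => h (y + c)) \o shift x) (s *: v) - h (x + c)))
       = (fun s : R => s^-1 *: ((h \o shift (x + c)) (s *: v) - h (x + c))).
  by apply/funext => s /=; rewrite addrA.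
by rewrite /derivable E.
Qed.

End LineDerivative.

(** * Iterated partial derivatives along words of coordinate directions *)

Section Words.
Variables (R : realType) (n : nat).
Local Notation Rn := 'rV[R]_n.
Local Notation pw := (@partial_word R n).
Implicit Types (A : set Rn) (h k : Rn -> R) (s t : seq 'I_n) (x y c : Rn).

Lemma partial_word_cat s t h : pw (s ++ t) h = pw s (pw t h).
Proof. by rewrite /partial_word foldr_cat. Qed.

Lemma smoothR_partial A h t : smoothR A h -> smoothR A (pw t h).
Proof. by move=> sh s x Ax; rewrite -partial_word_cat; exact: sh. Qed.

Lemma smoothR_sub A B h : B `<=` A -> smoothR A h -> smoothR B h.
Proof. by move=> BA sh s x Bx; apply: sh; exact: BA. Qed.

Lemma smoothR_is_derive A h s i x : smoothR A h -> A x ->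
  is_derive x 'e_i (pw s h) (pw (i :: s) h x).
Proof. by move=> sh Ax; apply: DeriveDef => //; have [_] := sh s x Ax; exact. Qed.

Lemma partial_word_eq_on A h k s x :
  open A -> (forall y, A y -> h y = k y) -> A x -> pw s h x = pw s k x.
Proof.
move=> oA hk; elim: s x => [|i s IH] x Ax /=; first exact: hk.
apply: near_eq_derive; near=> y; apply: IH.
by near: y; exact: (open_nbhs_nbhs (conj oA Ax)).
Unshelve. all: by end_near. Qed.

Lemma continuous_near_eq h k x : (\near x, h x = k x) ->
  {for x, continuous h} -> {for x, continuous k}.
Proof.
move=> hk; rewrite /prop_for /continuous_at -(nbhs_singleton hk) => ch.
exact: cvg_trans (near_eq_cvg hk) ch.
Qed.

Lemma smoothR_eq_on A h k :
  open A -> (forall y, A y -> h y = k y) -> smoothR A h -> smoothR A k.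
Proof.
move=> oA hk sh s x Ax; have [ch dh] := sh s x Ax.
have E : \near x, pw s h x = pw s k x.
  near=> y; apply: (partial_word_eq_on _ oA) => //.
  by near: y; exact: (open_nbhs_nbhs (conj oA Ax)).
split; first exact: continuous_near_eq E ch.
by move=> i; apply: near_eq_derivable E (dh i).
Unshelve. all: by end_near. Qed.

Lemma partial_word_lin A h k (a b : R) s x : open A -> smoothR A h ->
  smoothR A k -> A x ->
  pw s (fun y => a * h y + b * k y) x = a * pw s h x + b * pw s k x.
Proof.
move=> oA sh sk; elim: s x => //= i s IH x Ax.
have E : \near x, pw s (fun y => a * h y + b * k y) x
     = a * pw s h x + b * pw s k x.
  near=> y; apply: IH; near: y; exact: (open_nbhs_nbhs (conj oA Ax)).
rewrite (near_eq_derive _ E).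
have Hh := smoothR_is_derive s i sh Ax.
have Hk := smoothR_is_derive s i sk Ax.
have [_ <-] := is_deriveD (is_deriveZ a Hh) (is_deriveZ b Hk).
by [].
Unshelve. all: by end_near. Qed.

Lemma smoothR_lin A h k (a b : R) : open A -> smoothR A h -> smoothR A k ->
  smoothR A (fun y => a * h y + b * k y).
Proof.
move=> oA sh sk s x Ax.
have E : \near x, a * pw s h x + b * pw s k x
     = pw s (fun y => a * h y + b * k y) x.
  near=> y; apply/esym/(partial_word_lin _ _ _ oA) => //.
  near: y; exact: (open_nbhs_nbhs (conj oA Ax)).
have [ch dh] := sh s x Ax; have [ck dk] := sk s x Ax.
split.
  apply: continuous_near_eq E _.
  exact: (cvgD (cvgM (cvg_cst a) ch) (cvgM (cvg_cst b) ck)).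
move=> i; apply: near_eq_derivable E _.
have [D _] := is_deriveD (is_deriveZ a (smoothR_is_derive s i sh Ax))
   (is_deriveZ b (smoothR_is_derive s i sk Ax)).
exact: D.
Unshelve. all: by end_near. Qed.

Lemma smoothR_cst A (a : R) : smoothR A (fun=> a).
Proof.
suff E s : exists b, pw s (fun=> a) = fun=> b.
  move=> s x _; have [b ->] := E s; split; first exact: cst_continuous.
  by move=> i; exact: derivable_cst.
elim: s => [|i s [b E]]; first by exists a.
by exists 0; rewrite /= E; apply/funext => x; exact: derive_cst.
Qed.

Lemma partial_word_cst0 s x : pw s (fun=> 0) x = 0.
Proof.
elim: s x => //= i s IH x.
have -> : pw s (fun=> 0) = fun=> 0 by exact/funext.
exact: derive_cst.
Qed.

Lemma partial_word_translate s h c :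
  pw s (fun y => h (y + c)) = fun y => pw s h (y + c).
Proof. by elim: s => //= i s ->; exact: derive_translate. Qed.

Lemma smoothR_translate A h c : smoothR A h ->
  smoothR [set x | A (x + c)] (fun y => h (y + c)).
Proof.
move=> sh s x Ax; rewrite partial_word_translate; have [ch dh] := sh s _ Ax.
split; last by move=> i; apply: derivable_translate; exact: dh.
apply: (@continuous_comp _ _ _ (fun y => y + c) (pw s h)) => //.
exact: (cvgD cvg_id (cvg_cst _)).
Qed.

Lemma partial_word_reflect s h c x : smoothR setT h ->
  pw s (fun y => h (c - y)) x = (-1) ^+ size s * pw s h (c - x).
Proof.
move=> sh; elim: s x => [|i s IH] x /=; first by rewrite mul1r.
have -> : pw s (fun y => h (c - y)) = fun x => (-1) ^+ size s * pw s h (c - x).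
  exact/funext.
have [_ dh] := sh s (c - x) I.
have [_ ->] := is_deriveZ ((-1) ^+ size s) (is_derive_reflect (dh i)).
by rewrite exprS mulN1r mulNr /GRing.scale /= mulrN.
Qed.

Lemma smoothR_reflect h c : smoothR setT h -> smoothR setT (fun y => h (c - y)).
Proof.
move=> sh s x _.
have -> : pw s (fun y => h (c - y)) = fun x => (-1) ^+ size s * pw s h (c - x).
  by apply/funext => y; rewrite partial_word_reflect.
have [ch dh] := sh s (c - x) I.
split.
  suff ck : {for x, continuous (fun y => pw s h (c - y))}.
    pose a : R := (-1) ^+ size s; rewrite -/a.
    have H := cvgM (cvg_cst a) ck; exact: H.
  apply: (@continuous_comp _ _ _ (fun y => c - y) (pw s h)) => //.
  exact: (cvgB (cvg_cst _) cvg_id).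
move=> i.
by have [] := is_deriveZ ((-1) ^+ size s) (is_derive_reflect (dh i)).
Qed.

(** The mean value theorem is used twice: along ['e_i] for the difference [g] of two parallel lines,
    then along ['e_j] for the derivative just obtained. *)
Lemma mixed_difference A h i j x (t : R) : smoothR A h ->
  (forall s s' : R, `|s| <= `|t| -> `|s'| <= `|t| ->
     A (x + s *: 'e_i + s' *: 'e_j)) ->
  exists s s' : R, [/\ `|s| <= `|t|, `|s'| <= `|t| &
    h (x + t *: 'e_i + t *: 'e_j) - h (x + t *: 'e_i) - h (x + t *: 'e_j) + h x
    = pw [:: j; i] h (x + s *: 'e_i + s' *: 'e_j) * t * t].
Proof.
move=> sh At.
pose g (s : R) := h (x + t *: 'e_j + s *: 'e_i) - h (x + s *: 'e_i).
pose dg (s : R) := pw [:: i] h (x + t *: 'e_j + s *: 'e_i) - pw [:: i] h (x + s *: 'e_i).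
have dgP (s : R) : `|s| <= `|t| -> is_derive s 1 g (dg s).
  move=> st; apply: is_deriveB.
    apply: (@line_is_derive _ _ h (x + t *: 'e_j) 'e_i s).
    have [_] := sh [::] (x + t *: 'e_j + s *: 'e_i)
      ltac:(rewrite addrAC; exact: At); exact.
  apply: (@line_is_derive _ _ h x 'e_i s).
  have [_] := sh [::] (x + s *: 'e_i)
      ltac:(have := At s 0 st; rewrite scale0r addr0 normr0; exact); exact.
have [s st gE] := MVT0 dgP.
have dkP (s' : R) : `|s'| <= `|t| ->
    is_derive s' 1 (fun s' : R => pw [:: i] h (x + s *: 'e_i + s' *: 'e_j))
      (pw [:: j; i] h (x + s *: 'e_i + s' *: 'e_j)).
  move=> st'.
  apply: (@line_is_derive _ _ (pw [:: i] h) (x + s *: 'e_i) 'e_j s').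
  have [_] := sh [:: i] _ (At _ _ st st'); exact.
have [s' st' kE] := MVT0 dkP.
exists s, s'; split => //.
move: kE; rewrite scale0r addr0 => <-.
move: gE; rewrite /g /dg !scale0r !addr0 => E.
rewrite [x + s *: _ + _]addrAC -E [x + t *: 'e_j + _]addrAC; ring.
Qed.

Lemma dist_half_le (a b c e : R) :
  `|a - c| < e / 2 -> `|b - c| < e / 2 -> `|a - b| <= e.
Proof. by rewrite !ltr_norml ler_norml; lra. Qed.

(** The second difference is symmetric in [i] and [j], so [mixed_difference] expresses it through
    either mixed derivative at some nearby point. After division by [t * t], continuity of both
    derivatives at [x] concludes. *)
Lemma schwarz A h i j x : open A -> smoothR A h -> A x ->
  pw [:: i; j] h x = pw [:: j; i] h x.
Proof.
move=> oA sh Ax; apply/eqP; rewrite -subr_eq0 -normr_eq0 eq_le normr_ge0 andbT.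
apply/ler_addgt0Pl => e e0; rewrite addr0.
have [cij _] := sh [:: i; j] x Ax; have [cji _] := sh [:: j; i] x Ax.
have e20 : 0 < e / 2 by rewrite divr_gt0.
move: cij cji => /cvgrPdist_lt/(_ _ e20) cij /cvgrPdist_lt/(_ _ e20) cji.
have /(nbhs_ballP x) [d /= d0 dP] := @filterI _ _ (nbhs_filter x) _ _
  (open_nbhs_nbhs (conj oA Ax)) (@filterI _ _ (nbhs_filter x) _ _ cij cji).
have {d d0 dP} [d d0 dP] : exists2 d : R, 0 < d & forall y, ball x d y -> A y /\
    (`|pw [:: i; j] h x - pw [:: i; j] h y| < e / 2 /\
     `|pw [:: j; i] h x - pw [:: j; i] h y| < e / 2).
  by exists d.
(* Two displacements of length at most [t] stay within [d / 2] of [x]. *)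
pose t : R := d / 4; have t0 : 0 < t by rewrite /t; move: d0; lra.
have near_x a b (s s' : R) : `|s| <= `|t| -> `|s'| <= `|t| ->
    ball x d (x + s *: 'e_a + s' *: 'e_b).
  move=> st st'; rewrite -ball_normE /ball_ /=.
  rewrite -addrA opprD addrA subrr add0r normrN.
  have d1 : `|s *: ('e_a : Rn)| <= t.
    rewrite normrZ -[leRHS]mulr1 -(gtr0_norm t0).
    by apply: ler_pM => //; exact: norm_delta_le1.
  have d2 : `|s' *: ('e_b : Rn)| <= t.
    rewrite normrZ -[leRHS]mulr1 -(gtr0_norm t0).
    by apply: ler_pM => //; exact: norm_delta_le1.
  apply: le_lt_trans (ler_normD _ _) _; apply: le_lt_trans (lerD d1 d2) _.
  by rewrite /t; move: d0; lra.
have [s1 [s1' [h1 h1' E1]]] := mixed_difference sh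
  (fun (s s' : R) hs hs' => (dP _ (near_x i j s s' hs hs')).1).
have [s2 [s2' [h2 h2' E2]]] := mixed_difference sh
  (fun (s s' : R) hs hs' => (dP _ (near_x j i s s' hs hs')).1).
have [_ [_ H1]] := dP _ (near_x i j _ _ h1 h1').
have [_ [H2 _]] := dP _ (near_x j i _ _ h2 h2').
have E : pw [:: j; i] h (x + s1 *: 'e_i + s1' *: 'e_j)
       = pw [:: i; j] h (x + s2 *: 'e_j + s2' *: 'e_i).
  apply: (mulIf (lt0r_neq0 t0)); apply: (mulIf (lt0r_neq0 t0)).
  have Q : x + t *: 'e_j + t *: 'e_i = x + t *: 'e_i + t *: 'e_j by exact: addrAC.
  rewrite Q in E2; apply: etrans (esym E1) _; apply: etrans E2.
  by congr (_ + _); exact: addrAC.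
by rewrite E in H1; exact: dist_half_le H2 H1.
Qed.

(** The first letter of [s] is moved to its place in [t] by adjacent transpositions, each of which
    is [schwarz] for the derivative along the remaining word. Equality on the whole open set [A] is
    carried along, because the next derivative needs it near the point. *)
Lemma partial_word_perm A h s t x : open A -> smoothR A h -> A x ->
  perm_eq s t -> pw s h x = pw t h x.
Proof.
move=> oA sh; elim: s t x => [|i s IH] t x Ax.
  by move=> /perm_size/esym/size0nil ->.
move=> st; have it : i \in t by rewrite -(perm_mem st) mem_head.
case/splitPr: it st => t1 t2 st.
have {}st : perm_eq s (t1 ++ t2).
  by rewrite -(perm_cons i) (perm_trans st)// perm_catC /= perm_cons perm_catC.
have -> : pw (i :: s) h x = pw (i :: t1 ++ t2) h x.
  apply: near_eq_derive; near=> y; apply: IH => //.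
  by near: y; exact: (open_nbhs_nbhs (conj oA Ax)).
elim: t1 x Ax {st} => [//|j t1 IH1] x Ax.
have -> : pw ((j :: t1) ++ i :: t2) h x = pw (j :: i :: t1 ++ t2) h x.
  apply: near_eq_derive; near=> y; apply/esym/IH1.
  by near: y; exact: (open_nbhs_nbhs (conj oA Ax)).
rewrite cat_cons.
exact: (schwarz i j oA (smoothR_partial (t1 ++ t2) sh) Ax).
Unshelve. all: by end_near. Qed.

(** The point [z k] has its first [k] coordinates from [x] and the others from [y]. Passing from
    [z k] to [z k.+1] moves along one axis by at most [|x - y|] in the maximum norm, so the mean
    value theorem is applied [n] times. *)
Lemma lipschitz_of_partials h (C : R) :
  (forall x i, derivable h x 'e_i) -> (forall x i, `|'D_('e_i) h x| <= C) ->
  forall x y, `|h x - h y| <= n%:R * C * `|x - y|.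
Proof.
move=> dh hC x y.
pose z (k : nat) : Rn := \row_i (if (i < k)%N then x ord0 i else y ord0 i).
have zE : z n = x by apply/rowP => i; rewrite mxE ltn_ord.
suff H (k : nat) : (k <= n)%N -> `|h (z k) - h y| <= k%:R * C * `|x - y|.
  by have := H n (leqnn n); rewrite zE.
elim: k => [|k IH] kn.
  by rewrite (_ : z 0%N = y) ?subrr ?normr0 ?mul0r//; apply/rowP => i; rewrite mxE.
pose i := Ordinal kn; pose t := x ord0 i - y ord0 i.
have zS : z k.+1 = z k + t *: 'e_i.
  apply/rowP => j; rewrite !mxE eqxx /= -val_eqE /= ltnS leq_eqVlt /t.
  have [jk|//] := altP (j =P k :> nat); rewrite /= ?mulr0 ?addr0//.
  rewrite jk ltnn mulr1 (_ : j = i); last exact/val_inj.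
  by rewrite addrCA subrr addr0.
have dP (s : R) : `|s| <= `|t| -> is_derive s 1 (fun s : R => h (z k + s *: 'e_i))
    ('D_('e_i) h (z k + s *: 'e_i)).
  by move=> _; apply: (@line_is_derive _ _ h (z k) 'e_i s); exact: dh.
have [s _] := MVT0 dP; rewrite scale0r addr0 -zS => E.
have -> : h (z k.+1) - h y = (h (z k.+1) - h (z k)) + (h (z k) - h y) by ring.
rewrite E; apply: le_trans (ler_normD _ _) _.
rewrite -natr1 mulrDl mulrDl mul1r addrC; apply: lerD.
  by apply: IH; exact: ltnW.
rewrite normrM; apply: ler_pM => //.
by have := rv_norm_ge (x - y) i; rewrite !mxE.
Qed.

Lemma taylor_line A h i N x (r C : R) : smoothR A h ->
  (forall s : R, `|s| <= r -> A (x + s *: 'e_i)) ->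
  (forall s : R, `|s| <= r -> `|pw (nseq N i) h (x + s *: 'e_i)| <= C) ->
  forall t : R, `|t| <= r ->
  `|h (x + t *: 'e_i) - \sum_(j < N) pw (nseq j i) h x * t ^+ j / j`!%:R|
    <= C * `|t| ^+ N.
Proof.
move=> sh Ar hC t tr.
have := @taylor_bound R N (fun j (s : R) => pw (nseq j i) h (x + s *: 'e_i)) r C _ hC t tr.
rewrite /= scale0r addr0; apply => j s jN sr.
apply: (@line_is_derive _ _ (pw (nseq j i) h) x 'e_i s).
by have [_] := sh (nseq j i) _ (Ar s sr); exact.
Qed.

(** The case of order 2, in the form required by [is_derive_quadratic]. *)
Lemma taylor_line2 A h i x (t C : R) : smoothR A h ->
  (forall s : R, `|s| <= `|t| -> A (x + s *: 'e_i)) ->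
  (forall s : R, `|s| <= `|t| -> `|pw [:: i; i] h (x + s *: 'e_i)| <= C) ->
  `|h (x + t *: 'e_i) - (h x + t * pw [:: i] h x)| <= C * t ^+ 2.
Proof.
move=> sh At hC; have H := taylor_line (N := 2) sh At hC (lexx _).
rewrite -[t ^+ 2]real_normK ?num_real//; apply: le_trans H.
rewrite le_eqVlt; apply/orP; left; apply/eqP; congr (`|_ - _|).
rewrite !big_ord_recl big_ord0 /= fact0 expr0 mulr1 divr1 addr0.
by rewrite (_ : (bump 0 0)`! = 1%N)// divr1 expr1 [t * _]mulrC.
Qed.

End Words.

(** * Complex-valued functions and test functions *)

Section ComplexParts.
Variable R : realType.
Local Notation normc := Normc.normc.
Implicit Types z w : R[i].

Lemma cReD z w : complex.Re (z + w) = complex.Re z + complex.Re w.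
Proof. by case: z w => [? ?] [? ?]. Qed.
Lemma cImD z w : complex.Im (z + w) = complex.Im z + complex.Im w.
Proof. by case: z w => [? ?] [? ?]. Qed.
Lemma cReN z : complex.Re (- z) = - complex.Re z.
Proof. by case: z. Qed.
Lemma cImN z : complex.Im (- z) = - complex.Im z.
Proof. by case: z. Qed.
Lemma cReM z w :
  complex.Re (z * w) = complex.Re z * complex.Re w - complex.Im z * complex.Im w.
Proof. by case: z w => [? ?] [? ?]. Qed.
Lemma cImM z w :
  complex.Im (z * w) = complex.Re z * complex.Im w + complex.Im z * complex.Re w.
Proof. by case: z w => [? ?] [? ?]. Qed.

Lemma complex_ext z w :
  complex.Re z = complex.Re w -> complex.Im z = complex.Im w -> z = w.
Proof. by case: z w => [? ?] [? ?] /= -> ->. Qed.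

Lemma normc_ge0 z : 0 <= normc z.
Proof. by case: z => a b; exact: sqrtr_ge0. Qed.

Lemma normc_addle z w : normc (z + w) <= normc z + normc w.
Proof. exact: le_normcD. Qed.

Lemma normc_opp z : normc (- z) = normc z.
Proof. exact: normcN. Qed.

Lemma Re_le_normc z : `|complex.Re z| <= normc z.
Proof.
case: z => a b /=; rewrite -sqrtr_sqr; apply: ler_wsqrtr.
by rewrite lerDl sqr_ge0.
Qed.

Lemma Im_le_normc z : `|complex.Im z| <= normc z.
Proof.
case: z => a b /=; rewrite -sqrtr_sqr; apply: ler_wsqrtr.
by rewrite lerDr sqr_ge0.
Qed.

Lemma normc_le_parts z : normc z <= `|complex.Re z| + `|complex.Im z|.
Proof.
case: z => a b /=; rewrite -[leRHS]ger0_norm ?addr_ge0// -sqrtr_sqr.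
apply: ler_wsqrtr; rewrite sqrrD !real_normK ?num_real//.
by rewrite lerD2r lerDl mulrn_wge0// mulr_ge0.
Qed.

Lemma normc_real (a : R) : normc a%:C = `|a|.
Proof. by rewrite /normc /= expr0n/= addr0 sqrtr_sqr. Qed.

Lemma normc_sign k : normc ((-1) ^+ k : R[i]) = 1.
Proof.
elim: k => [|k IH]; first by rewrite expr0 Normc.normc1.
by rewrite exprS Normc.normcM IH mulr1 normc_opp Normc.normc1.
Qed.

Lemma Re_sign k z : complex.Re ((-1) ^+ k * z) = (-1) ^+ k * complex.Re z.
Proof.
by elim: k z => [|k IH] z; rewrite ?expr0 ?mul1r// !exprS !mulN1r !mulNr cReN IH.
Qed.

Lemma Im_sign k z : complex.Im ((-1) ^+ k * z) = (-1) ^+ k * complex.Im z.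
Proof.
by elim: k z => [|k IH] z; rewrite ?expr0 ?mul1r// !exprS !mulN1r !mulNr cImN IH.
Qed.

End ComplexParts.

Section ComplexWords.
Variables (R : realType) (n : nat).
Local Notation Rn := 'rV[R]_n.
Local Notation C := R[i].
Local Notation pw := (@partial_word R n).
Local Notation normc := Normc.normc.
Implicit Types (A K Om : set Rn) (f g phi psi : Rn -> C) (s t : seq 'I_n) (x y c : Rn).

(** Words replace multi-indices because concatenation of words is composition of derivatives and
    induction runs over a list. [perm_canonical_word] and Schwarz's theorem lead back to the
    multi-indices in the seminorms. *)
Definition cpartial s g : Rn -> C := fun x =>
  pw s (fun y => complex.Re (g y)) x +i* pw s (fun y => complex.Im (g y)) x.

Lemma cpartial_nil g : cpartial [::] g = g.
Proof. by apply/funext => x; rewrite /cpartial /=; case: (g x). Qed.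

Lemma cpartial_cat s t g : cpartial (s ++ t) g = cpartial s (cpartial t g).
Proof. by apply/funext => x; rewrite /cpartial !partial_word_cat. Qed.

Definition canonical_word (a : multi_index n) : seq 'I_n :=
  flatten [seq nseq (a i) i | i <- enum 'I_n].

Lemma partialE (a : multi_index n) g : partial a g = cpartial (canonical_word a) g.
Proof. by []. Qed.

Lemma count_canonical_word (a : multi_index n) i :
  count_mem i (canonical_word a) = a i.
Proof.
rewrite count_flatten -map_comp.
rewrite (eq_map (g := fun j => if j == i then a i else 0%N)); last first.
  by move=> j /=; rewrite count_nseq /= /eqP; case: eqP => [->|_]; rewrite ?mul1n ?mul0n.
rewrite sumnE big_map -big_mkcond big_enum_cond /= (bigD1 i)//= big1 ?addn0//.
by move=> j /andP[]; case: (j =P i).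
Qed.

Lemma size_canonical_word (a : multi_index n) : size (canonical_word a) = mi_size a.
Proof.
rewrite size_flatten /shape -map_comp /mi_size sumnE big_map big_enum /=.
by apply: eq_bigr => i _; rewrite size_nseq.
Qed.

Definition multi_index_of s : multi_index n := [ffun i => count_mem i s].

Lemma perm_canonical_word s : perm_eq s (canonical_word (multi_index_of s)).
Proof.
by rewrite /perm_eq; apply/allP => i _ /=; rewrite count_canonical_word ffunE.
Qed.

Lemma mi_size_of s : mi_size (multi_index_of s) = size s.
Proof. by rewrite -size_canonical_word -(perm_size (perm_canonical_word s)). Qed.

Lemma cpartial_perm A g s t x : open A -> smooth A g -> A x ->
  perm_eq s t -> cpartial s g x = cpartial t g x.
Proof.
move=> oA [sr si] Ax st; rewrite /cpartial.
by rewrite (partial_word_perm oA sr Ax st) (partial_word_perm oA si Ax st).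
Qed.

Lemma smooth_cpartial A g s : smooth A g -> smooth A (cpartial s g).
Proof. by move=> [sr si]; split; exact: smoothR_partial. Qed.

Lemma smooth_sub A B g : B `<=` A -> smooth A g -> smooth B g.
Proof. by move=> BA [sr si]; split; exact: smoothR_sub BA _. Qed.

Lemma smooth_eq_on A f g : open A -> (forall y, A y -> f y = g y) ->
  smooth A f -> smooth A g.
Proof.
by move=> oA fg [sr si]; split; [apply: smoothR_eq_on oA _ sr|apply: smoothR_eq_on oA _ si];
   move=> y Ay; rewrite fg.
Qed.

Lemma cpartial_eq_on A f g s x : open A -> (forall y, A y -> f y = g y) ->
  A x -> cpartial s f x = cpartial s g x.
Proof.
move=> oA fg Ax; rewrite /cpartial.
by congr (_ +i* _); apply: (partial_word_eq_on s oA _ Ax) => y Ay; rewrite fg.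
Qed.

Lemma smooth_lin A (a : C) f g : open A -> smooth A f -> smooth A g ->
  smooth A (fun y => a * f y + g y).
Proof.
move=> oA [fr fi] [gr gi]; split.
  apply: (smoothR_eq_on (h := fun y => 1 * (complex.Re a * complex.Re (f y) +
     (- complex.Im a) * complex.Im (f y)) + 1 * complex.Re (g y)) oA).
    by move=> y _; rewrite cReD cReM; ring.
  exact: (smoothR_lin 1 1 oA (smoothR_lin _ _ oA fr fi) gr).
apply: (smoothR_eq_on (h := fun y => 1 * (complex.Re a * complex.Im (f y) +
     complex.Im a * complex.Re (f y)) + 1 * complex.Im (g y)) oA).
  by move=> y _; rewrite cImD cImM; ring.
exact: (smoothR_lin 1 1 oA (smoothR_lin _ _ oA fi fr) gi).
Qed.

Lemma cpartial_lin A (a : C) f g s x : open A -> smooth A f -> smooth A g -> A x ->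
  cpartial s (fun y => a * f y + g y) x = a * cpartial s f x + cpartial s g x.
Proof.
move=> oA [fr fi] [gr gi] Ax; apply: complex_ext.
  rewrite /= cReD cReM /=.
  rewrite (_ : (fun y => _) = fun y => 1 * (complex.Re a * complex.Re (f y) +
     (- complex.Im a) * complex.Im (f y)) + 1 * complex.Re (g y)).
    rewrite (partial_word_lin 1 1 s oA (smoothR_lin _ _ oA fr fi) gr Ax).
    by rewrite (partial_word_lin _ _ s oA fr fi Ax); ring.
  by apply/funext => y; rewrite cReD cReM; ring.
rewrite /= cImD cImM /=.
rewrite (_ : (fun y => _) = fun y => 1 * (complex.Re a * complex.Im (f y) +
     complex.Im a * complex.Re (f y)) + 1 * complex.Im (g y)).
  rewrite (partial_word_lin 1 1 s oA (smoothR_lin _ _ oA fi fr) gi Ax).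
  by rewrite (partial_word_lin _ _ s oA fi fr Ax); ring.
by apply/funext => y; rewrite cImD cImM; ring.
Qed.

Lemma smooth_cst A (a : C) : smooth A (fun=> a).
Proof. by split; exact: smoothR_cst. Qed.

Lemma cpartial_cst0 s x : cpartial s (fun=> 0) x = 0.
Proof. by rewrite /cpartial /= partial_word_cst0. Qed.

Lemma cpartial_translate s g c :
  cpartial s (fun y => g (y - c)) = fun y => cpartial s g (y - c).
Proof.
apply/funext => y; rewrite /cpartial.
by rewrite (partial_word_translate s (fun y => complex.Re (g y)))
  (partial_word_translate s (fun y => complex.Im (g y))).
Qed.

Lemma smooth_translate A g c : smooth A g ->
  smooth [set x | A (x - c)] (fun y => g (y - c)).
Proof. move=> [sr si]; split.
  exact: (smoothR_translate (c := - c) sr).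
exact: (smoothR_translate (c := - c) si).
Qed.

Lemma cpartial_reflect s g c x : smooth setT g ->
  cpartial s (fun y => g (c - y)) x = (-1) ^+ size s * cpartial s g (c - x).
Proof.
move=> [sr si]; apply: complex_ext; rewrite ?Re_sign ?Im_sign /=.
  by rewrite (partial_word_reflect _ _ _ sr).
by rewrite (partial_word_reflect _ _ _ si).
Qed.

Lemma smooth_reflect g c : smooth setT g -> smooth setT (fun y => g (c - y)).
Proof. by move=> [sr si]; split; [exact: (smoothR_reflect c sr)|exact: (smoothR_reflect c si)]. Qed.

Lemma smooth_continuous A g x : smooth A g -> A x ->
  {for x, continuous (fun y => complex.Re (g y))} /\
  {for x, continuous (fun y => complex.Im (g y))}.
Proof. by move=> [sr si] Ax; split; [have [] := sr [::] x Ax|have [] := si [::] x Ax]. Qed.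

Lemma continuous_compact_bounded K (h : Rn -> R) : compact K ->
  (forall x, K x -> {for x, continuous h}) ->
  exists2 M, 0 <= M & forall x, K x -> `|h x| <= M.
Proof.
move=> cK ch.
have wh : {within K, continuous h}.
  by apply: continuous_in_subspaceT => x /set_mem Kx; exact: ch.
have /compact_bounded[M [Mr MP]] := continuous_compact wh cK.
exists (`|M| + 1); first by rewrite addr_ge0.
move=> x Kx; apply: (MP (`|M| + 1)); last by exists x.
by rewrite (le_lt_trans (ler_norm _))// ltrDl.
Qed.

(** Induction on the order, splitting off the last letter [i] of the word, which is the derivative
    applied first: the induction hypothesis is used for the finitely many functions [cpartial [:: i]
    g], and the bounds are added. *)
Lemma smooth_compact_bounded A K g m : K `<=` A -> compact K -> smooth A g ->
  exists2 M, 0 <= M &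
    forall s x, (size s <= m)%N -> K x -> normc (cpartial s g x) <= M.
Proof.
move=> KA cK; elim: m g => [|m IH] g sg.
  have [M1 M10 M1P] := continuous_compact_bounded cK
    (fun x Kx => (smooth_continuous sg (KA x Kx)).1).
  have [M2 M20 M2P] := continuous_compact_bounded cK
    (fun x Kx => (smooth_continuous sg (KA x Kx)).2).
  exists (M1 + M2); first exact: addr_ge0.
  case=> // x _ Kx; rewrite cpartial_nil; apply: le_trans (normc_le_parts _) _.
  by apply: lerD; [exact: M1P|exact: M2P].
have /choice[M MP] : forall i, exists M, 0 <= M /\
    forall s x, (size s <= m)%N -> K x -> normc (cpartial s (cpartial [:: i] g) x) <= M.
  by move=> i; have [M ? ?] := IH _ (smooth_cpartial [:: i] sg); exists M.
have [M0 M00 M0P] := IH _ sg.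
exists (M0 + \sum_i M i).
  by rewrite addr_ge0// sumr_ge0// => i _; have [] := MP i.
move=> s x; case: (lastP s) => [|{}s i] sm Kx.
  apply: le_trans (M0P [::] x _ Kx) _ => //.
  by rewrite lerDl sumr_ge0// => i _; have [] := MP i.
have [M0i Mi] := MP i; rewrite -cats1 cpartial_cat.
apply: le_trans (Mi s x _ Kx) _; first by move: sm; rewrite size_rcons.
rewrite (bigD1 i)//= addrCA lerDl addr_ge0// sumr_ge0// => j _.
by have [] := MP j.
Qed.

(** Nonnegativity of [b] covers the empty set, whose supremum is 0. *)
Lemma seminorm_le K m g (b : R) : 0 <= b ->
  (forall s x, (size s <= m)%N -> K x -> normc (cpartial s g x) <= b) ->
  seminorm K m g <= b.
Proof.
move=> b0 gb; rewrite /seminorm.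
set S := (X in sup X).
have [->|/set0P S0] := eqVneq S set0; first by rewrite sup0.
apply: ge_sup => // _ [x Kx [a am <-]].
by rewrite partialE; apply: gb => //; rewrite size_canonical_word.
Qed.

(** The bound [M] makes the set under the supremum bounded, so that the supremum is an upper bound;
    its value does not enter the conclusion. An arbitrary word is first sorted into the canonical
    word of its multi-index. *)
Lemma cpartial_le_seminorm_aux A K m g (M : R) : open A -> K `<=` A -> smooth A g ->
  (forall s x, (size s <= m)%N -> K x -> normc (cpartial s g x) <= M) ->
  forall s x, (size s <= m)%N -> K x -> normc (cpartial s g x) <= seminorm K m g.
Proof.
move=> oA KA sg gM s x sm Kx; rewrite /seminorm.
rewrite (cpartial_perm oA sg (KA x Kx) (perm_canonical_word s)) -partialE.
apply: ub_le_sup.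
  exists M => _ [y Ky [a am <-]].
  by rewrite partialE; apply: gM => //; rewrite size_canonical_word.
by exists x => //; exists (multi_index_of s) => //=; rewrite mi_size_of.
Qed.

Lemma cpartial_le_seminorm A K m g s x : open A -> compact K -> K `<=` A ->
  smooth A g -> (size s <= m)%N -> K x -> normc (cpartial s g x) <= seminorm K m g.
Proof.
move=> oA cK KA sg sm Kx; have [M _ MP] := smooth_compact_bounded m KA cK sg.
exact: (cpartial_le_seminorm_aux oA KA sg MP).
Qed.

Lemma seminorm_ge0 K m g : 0 <= seminorm K m g.
Proof.
rewrite /seminorm; set S := (X in sup X).
have [->|/set0P[z Sz]] := eqVneq S set0; first by rewrite sup0.
(* A set without upper bound has supremum 0 by convention. *)
have [[M MP]|nb] := pselect (has_ubound S); last first.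
  by rewrite sup_out// => -[_].
apply: le_trans (_ : z <= _); last by apply: ub_le_sup => //; exists M.
by move: Sz => [x _ [a _ <-]]; exact: normc_ge0.
Qed.

Lemma notsupp phi x : ~ supp phi x -> phi x = 0.
Proof.
by move=> nx; apply/eqP/negPn/negP => px; apply: nx; exact: subset_closure.
Qed.

Lemma open_nsupp phi : open (~` supp phi).
Proof. exact/closed_openC/closed_closure. Qed.

Lemma cpartial_notsupp phi s x : ~ supp phi x -> cpartial s phi x = 0.
Proof.
move=> nx; rewrite (@cpartial_eq_on (~` supp phi) phi (fun=> 0))//.
- exact: cpartial_cst0.
- exact: open_nsupp.
- by move=> y; exact: notsupp.
Qed.

Lemma supp_sub phi K : closed K -> (forall x, ~ K x -> phi x = 0) -> supp phi `<=` K.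
Proof.
move=> cK p0; rewrite /supp (closure_id K).1//; apply: closure_subset => x.
by apply: contraPP => /= /p0 ->; rewrite eqxx.
Qed.

Lemma compact_closedRn K : compact K -> closed K.
Proof. by apply: compact_closed; exact: norm_hausdorff. Qed.

Lemma testfun_intro Om K phi : smooth setT phi -> compact K -> K `<=` Om ->
  (forall x, ~ K x -> phi x = 0) -> testfun Om phi /\ supp phi `<=` K.
Proof.
move=> sp cK KO p0; have sK := supp_sub (compact_closedRn cK) p0.
split => //; split => //; last exact: subset_trans KO.
by apply: subclosed_compact cK sK; exact: closed_closure.
Qed.

Lemma testfunT Om phi : testfun Om phi -> testfun setT phi.
Proof. by case=> ? ? ?; split. Qed.

Lemma testfun_cpartial Om phi s : testfun Om phi ->
  testfun Om (cpartial s phi) /\ supp (cpartial s phi) `<=` supp phi.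
Proof.
move=> [sp cp pO]; apply: (testfun_intro (smooth_cpartial s sp) cp pO) => x.
exact: cpartial_notsupp.
Qed.

Lemma testfun_lin Om K (a : C) phi psi : testfun Om phi -> testfun Om psi ->
  supp phi `<=` K -> supp psi `<=` K -> compact K -> K `<=` Om ->
  testfun Om (fun y => a * phi y + psi y) /\
  supp (fun y => a * phi y + psi y) `<=` K.
Proof.
move=> [sp cp pO] [sq cq qO] pK qK cK KO.
apply: (testfun_intro (smooth_lin a openT sp sq) cK KO) => x nK; rewrite (@notsupp phi) ?(@notsupp psi) ?mulr0 ?addr0//.
- by move/qK.
- by move/pK.
Qed.

Lemma testfun0 Om : testfun Om (fun=> 0).
Proof.
have [] // := @testfun_intro Om set0 (fun=> 0) (smooth_cst _ _).
exact: compact0.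
Qed.

Lemma compact_translate K c : compact K -> compact [set y | K (y - c)].
Proof.
move=> cK; have -> : [set y | K (y - c)] = (fun y => y + c) @` K.
  apply/seteqP; split => [y Ky|_ [y Ky <-]] /=; last by rewrite addrK.
  by exists (y - c) => //; rewrite subrK.
apply: continuous_compact cK; apply: continuous_subspaceT => y.
exact: (cvgD cvg_id (cvg_cst _)).
Qed.

Lemma testfun_translate Om phi c : testfun setT phi ->
  (forall y, supp phi y -> Om (c + y)) ->
  testfun Om (fun y => phi (y - c)) /\
  supp (fun y => phi (y - c)) `<=` [set y | supp phi (y - c)].
Proof.
move=> [sp cp _] pO; apply: testfun_intro.
- by have := smooth_translate c sp; apply: smooth_sub.
- exact: compact_translate.
- by move=> y /= /pO; rewrite addrCA subrr addr0.
- by move=> y /= /notsupp.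
Qed.

Lemma testfun_bounded phi m : testfun setT phi -> exists2 M, 0 <= M &
  forall s x, (size s <= m)%N -> normc (cpartial s phi x) <= M.
Proof.
move=> [sp cp _].
have [M M0 MP] := smooth_compact_bounded m (@subsetT _ (supp phi)) cp sp.
exists M => // s x sm; have [sx|nx] := pselect (supp phi x); first exact: MP.
by rewrite cpartial_notsupp// Normc.normc0.
Qed.

Lemma cpartial_le_seminormT phi m s x : testfun setT phi -> (size s <= m)%N ->
  normc (cpartial s phi x) <= seminorm setT m phi.
Proof.
move=> tp sm; have [M _ MP] := testfun_bounded m tp; have [sp _ _] := tp.
by apply: (cpartial_le_seminorm_aux openT _ sp (M := M)) => // t y tm _; exact: MP.
Qed.

(** The factor 2 accounts for the real and the imaginary part. Since the constant is a global
    seminorm, the estimate is the same for all translates of [phi]. *)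
Lemma testfun_lipschitz phi m s : testfun setT phi -> (size s <= m)%N ->
  forall x y, normc (cpartial s phi x - cpartial s phi y)
    <= 2 * (n%:R * seminorm setT m.+1 phi) * `|x - y|.
Proof.
move=> tp sm x y; have [[sr si] _ _] := tp.
apply: le_trans (normc_le_parts _) _; rewrite cReD cImD cReN cImN.
have -> a b : 2 * a * b = a * b + a * b :> R by ring.
apply: lerD.
  apply: (@lipschitz_of_partials R n (pw s (fun y => complex.Re (phi y)))).
    by move=> z i; have [_] := sr s z I; exact.
  move=> z i; apply: le_trans (cpartial_le_seminormT (s := i :: s) z tp _) => //.
  exact: (Re_le_normc (cpartial (i :: s) phi z)).
apply: (@lipschitz_of_partials R n (pw s (fun y => complex.Im (phi y)))).
  by move=> z i; have [_] := si s z I; exact.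
move=> z i; apply: le_trans (cpartial_le_seminormT (s := i :: s) z tp _) => //.
exact: (Im_le_normc (cpartial (i :: s) phi z)).
Qed.

End ComplexWords.

(** * Integration on R^n *)

Section BoundedSupport.
Context d (T : measurableType d) (R : realType) (mu : {measure set T -> \bar R}).
Implicit Types (D : set T) (F G : T -> R) (M : R).

(** The class of integrands used throughout: when [D] has finite measure, integrability is automatic
    and the integral is at most [M] times that measure. *)
Definition bdd_on D M F :=
  [/\ measurable_fun setT F, forall t, `|F t| <= M & forall t, ~ D t -> F t = 0].

Lemma bdd_on_restrict D M F : bdd_on D M F -> F \_ D = F.
Proof.
move=> [_ _ F0]; apply/funext => t; rewrite /patch; case: ifPn => // /negP Dt.
by rewrite F0// => Dt'; apply: Dt; rewrite inE.
Qed.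

Lemma bdd_on_integrable D M F : measurable D -> (mu D < +oo)%E ->
  bdd_on D M F -> mu.-integrable setT (EFin \o F).
Proof.
move=> mD Doo bF; have [mF FM F0] := bF.
have -> : EFin \o F = (EFin \o F) \_ D.
  apply/funext => t; rewrite /patch; case: ifPn => // /negP Dt /=.
  by rewrite F0// => Dt'; apply: Dt; rewrite inE.
apply: (integrable_mkcond _ mD).1; apply: measurable_bounded_integrable => //.
  exact: measurable_funTS.
exists M; split; first exact: num_real.
by move=> x Mx y _ /=; apply: le_trans (FM y) (ltW Mx).
Qed.

Lemma bdd_on_integral_le D M F : measurable D -> (mu D < +oo)%E ->
  bdd_on D M F -> `|\int[mu]_t F t| <= M * fine (mu D).
Proof.
move=> mD Doo bF; have [mF FM F0] := bF.
have iF := bdd_on_integrable mD Doo bF.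
have iFD : mu.-integrable D (EFin \o F) by exact: integrableS iF.
have fD : mu D \is a fin_num by rewrite ge0_fin_numE.
have icst : mu.-integrable D (EFin \o cst M).
  apply: measurable_bounded_integrable => //.
  exists `|M|; split; first exact: num_real.
  by move=> x Mx y _ /=; exact: ltW.
rewrite -(bdd_on_restrict bF) -Rintegral_mkcond.
apply: le_trans (le_normr_Rintegral mD iFD) _.
rewrite -Rintegral_cst//; apply: le_Rintegral; [exact: mD| |exact: icst|].
- exact: integrable_norm iFD.
- by move=> t _; exact: FM.
Qed.

Lemma bdd_on_lin D M M' F G (a : R) : bdd_on D M F ->
  bdd_on D M' G -> bdd_on D (`|a| * M + M') (fun t => a * F t + G t).
Proof.
move=> [mF FM F0] [mG GM G0]; split.
- by apply: measurable_funD => //; apply: measurable_funM.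
- move=> t; apply: le_trans (ler_normD _ _) _; rewrite normrM.
  by apply: lerD => //; exact: ler_wpM2l.
- by move=> t Dt; rewrite F0// G0// mulr0 addr0.
Qed.

Lemma bdd_on_mul D M M' F G : measurable_fun setT G ->
  (forall t, D t -> `|G t| <= M') -> 0 <= M' -> bdd_on D M F ->
  bdd_on D (M' * M) (fun t => G t * F t).
Proof.
move=> mG GM M'0 [mF FM F0]; split; first exact: measurable_funM.
  move=> t; have [Dt|nDt] := pselect (D t).
    by rewrite normrM; apply: ler_pM => //; exact: GM.
  rewrite F0// mulr0 normr0 mulr_ge0//.
  by apply: le_trans (FM t).
by move=> t Dt; rewrite F0// mulr0.
Qed.

End BoundedSupport.

(** * Iterated integration over tuples *)

Section TupleIntegral.
Variable R : realType.
Local Notation mR := (measurableTypeR R).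
Local Notation T n := (n.-tuple mR).
Local Notation leb n := (lebesgue_tuple R n).

Definition tbox n (b : R) : set (T n) := [set t | forall i, `|tnth t i| <= b].

Lemma tboxE n b : @tbox n b =
  \bigcap_(i in [set: 'I_n]) ((fun t : T n => tnth t i) @^-1` [set x : mR | `|x| <= b]).
Proof. by apply/seteqP; split => [t tb i _|t tb i]; [exact: tb|exact: tb]. Qed.

Lemma measurable_ball0 (b : R) : measurable ([set x : mR | `|x| <= b] : set mR).
Proof.
rewrite (_ : [set _ | _] = `[- b, b]%classic); first exact: measurable_itv.
by apply/seteqP; split => x /=; rewrite in_itv/= ler_norml.
Qed.

Lemma measurable_tbox n b : measurable (@tbox n b).
Proof.
rewrite tboxE; apply: fin_bigcap_measurable => // i _.
rewrite -[X in measurable X]setTI; apply: measurable_tnth => //.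
exact: measurable_ball0.
Qed.

Lemma lebesgue_ball0 (b : R) : 0 <= b ->
  lebesgue_measure ([set x : mR | `|x| <= b] : set mR) = (2 * b)%:E.
Proof.
move=> b0; rewrite (_ : [set _ | _] = `[- b, b]%classic); last first.
  by apply/seteqP; split => x /=; rewrite in_itv/= ler_norml.
rewrite lebesgue_measure_itv /= lte_fin; case: ifPn => [_|].
  by rewrite -EFinB; congr (_%:E); lra.
rewrite -leNgt => bb; have -> : b = 0 by move: b0 bb; lra.
by rewrite mulr0.
Qed.

Lemma tcons_tbox n b : @tcons R n @^-1` (@tbox n.+1 b) =
  [set x : mR | `|x| <= b] `*` @tbox n b.
Proof.
apply/seteqP; split => [[a t] /= tb|[a t] [/= ab tb] i].
  split => [|i]; first exact: (tb ord0).
  by have := tb (lift ord0 i); rewrite /tcons tnthS.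
case: (unliftP ord0 i) => [j ->|-> //]; rewrite /tcons tnthS; exact: tb.
Qed.

Lemma lebesgue_prod_box n (b : R) : 0 <= b -> leb n (@tbox n b) = ((2 * b) ^+ n)%:E ->
  (@lebesgue_measure R \x leb n)%E ([set x : mR | `|x| <= b] `*` @tbox n b)
    = ((2 * b) ^+ n.+1)%:E.
Proof.
move=> b0 E; rewrite product_measure1E; last 2 first.
- exact: measurable_ball0.
- exact: measurable_tbox.
by rewrite exprS EFinM; congr (_ * _)%E; [exact: lebesgue_ball0|exact: E].
Qed.

Lemma lebesgue_tbox n (b : R) : 0 <= b -> leb n (@tbox n b) = ((2 * b) ^+ n)%:E.
Proof.
move=> b0; elim: n => [|n IH].
  rewrite /= diracE (_ : _ \in _) ?expr0//.
  by rewrite inE => -[].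
rewrite [LHS]/= /lebesgue_step /pushforward tcons_tbox.
exact: lebesgue_prod_box.
Qed.

Lemma tbox_lty n (b : R) : (leb n (@tbox n b) < +oo)%E.
Proof.
have [b0|b0] := leP 0 b; first by rewrite lebesgue_tbox// ltry.
case: n => [|n]; first by rewrite /= diracE; case: (_ \in _); rewrite ltry.
rewrite (_ : tbox b = set0) ?measure0//.
by apply/seteqP; split => // t /(_ ord0) /(le_trans (normr_ge0 _)); rewrite leNgt b0.
Qed.

Definition tbdd n b M (F : T n -> R) := bdd_on (@tbox n b) M F.

Lemma tbdd_integrable n b M (F : T n -> R) : tbdd b M F ->
  (leb n).-integrable setT (EFin \o F).
Proof. by apply: bdd_on_integrable; [exact: measurable_tbox|exact: tbox_lty]. Qed.

Definition tint n (F : T n -> R) : R := \int[leb n]_t F t.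

Lemma tbdd_tint_le n b M (F : T n -> R) : 0 <= b -> tbdd b M F ->
  `|tint F| <= M * (2 * b) ^+ n.
Proof.
move=> b0 bF; have -> : (2 * b) ^+ n = fine (leb n (@tbox n b)).
  by rewrite lebesgue_tbox.
exact: bdd_on_integral_le (@measurable_tbox n b) (@tbox_lty n b) bF.
Qed.

Lemma tint0 (F : T 0 -> R) : tint F = F [tuple].
Proof.
rewrite /tint /= /Rintegral integral_dirac//=.
  by rewrite indicT mul1r.
have -> : (fun x : T 0 => (F x)%:E) = cst (F [tuple])%:E.
  by apply/funext => t; rewrite (tuple0 t).
exact: measurable_cst.
Qed.

Lemma tint_lin n b M b' M' (F G : T n -> R) (x : R) : tbdd b M F -> tbdd b' M' G ->
  tint (fun t => x * F t + G t) = x * tint F + tint G.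
Proof.
move=> bF bG; rewrite /tint.
have iF := tbdd_integrable bF; have iG := tbdd_integrable bG.
rewrite RintegralD//; first by rewrite RintegralZl.
have -> : EFin \o (fun t => x * F t) = (fun t => x%:E * (EFin \o F) t)%E.
  by apply/funext => t /=; rewrite EFinM.
exact: integrableZl.
Qed.

Lemma tbdd_section n b M (F : T n.+1 -> R) (a : R) :
  tbdd b M F -> tbdd b M (fun t => F (@tcons R n (a, t))).
Proof.
move=> [mF FM F0]; split.
- by apply: (measurableT_comp mF); exact: (measurable_cons (f := fun=> a) (g := id)).
- by move=> t; exact: FM.
- move=> t nt; apply: F0 => tb; apply: nt => i.
  by have := tb (lift ord0 i); rewrite /tcons tnthS.
Qed.

(** Integrating out all coordinates but the first stays within the class [bdd_on], so that iterated
    integrals can be treated one variable at a time. Measurability of the inner integral comes from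
    Fubini's theorem. *)
Lemma tbdd_sectionT n b M (F : T n.+1 -> R) : 0 <= b -> tbdd b M F ->
  bdd_on ([set x : mR | `|x| <= b] : set mR) (M * (2 * b) ^+ n)
    (fun a : mR => tint (fun t => F (@tcons R n (a, t)))).
Proof.
move=> b0 bF; split; last 2 first.
- by move=> a; apply: tbdd_tint_le => //; exact: tbdd_section.
- move=> a na; rewrite /tint (_ : (fun t => _) = fun=> 0); last first.
    apply/funext => t; have [_ _ ->//] := bF => tb; apply: na.
    exact: (tb ord0).
  by rewrite Rintegral_cst// mul0r.
have bF2 : bdd_on ([set x : mR | `|x| <= b] `*` @tbox n b) M (F \o @tcons R n).
  have [mF FM F0] := bF; split.
  - by apply: measurableT_comp => //; exact: measurable_tcons.
  - by move=> t; exact: FM.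
  by move=> t nt; apply: F0 => tb; apply: nt; rewrite -tcons_tbox.
have iFt : (@lebesgue_measure R \x leb n)%E.-integrable setT (EFin \o (F \o @tcons R n)).
  apply: bdd_on_integrable bF2.
    by apply: measurableX; [exact: measurable_ball0|exact: measurable_tbox].
  rewrite [X in (X < _)%E](_ : _ = ((2 * b) ^+ n.+1)%:E); first exact: ltry.
  by apply: lebesgue_prod_box => //; exact: lebesgue_tbox.
have := measurable_fubini_F iFt.
by move=> mH; exact: (measurableT_comp (fine_measurable measurableT) mH).
Qed.

(** The measure on tuples is the image of a product measure under [tcons], so this is a change of
    variables followed by Fubini's theorem. *)
Lemma tintS n b M (F : T n.+1 -> R) : 0 <= b -> tbdd b M F ->
  tint F = \int[@lebesgue_measure R]_a tint (fun t => F (@tcons R n (a, t))).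
Proof.
move=> b0 bF; have bF2 : bdd_on ([set x : mR | `|x| <= b] `*` @tbox n b) M (F \o @tcons R n).
  have [mF FM F0] := bF; split.
  - by apply: measurableT_comp => //; exact: measurable_tcons.
  - by move=> t; exact: FM.
  by move=> t nt; apply: F0 => tb; apply: nt; rewrite -tcons_tbox.
have iFt : (@lebesgue_measure R \x leb n)%E.-integrable setT (EFin \o (F \o @tcons R n)).
  apply: bdd_on_integrable bF2.
    by apply: measurableX; [exact: measurable_ball0|exact: measurable_tbox].
  rewrite [X in (X < _)%E](_ : _ = ((2 * b) ^+ n.+1)%:E); first exact: ltry.
  by apply: lebesgue_prod_box => //; exact: lebesgue_tbox.
rewrite /tint /Rintegral; congr fine.
have mF : measurable_fun setT (EFin \o F).
  by apply/measurable_EFinP; have [] := bF.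
rewrite (integral_pushforward (@measurable_tcons R n) mF iFt measurableT).
rewrite -integral12_prod_meas1//; apply: eq_integral => a _.
rewrite fineK//; apply: integrable_fin_num => //.
exact: (tbdd_integrable (tbdd_section a bF)).
Qed.

End TupleIntegral.

(** * Affine change of variable on the line *)

Section AffineChange.
Variable R : realType.
Local Notation mR := (measurableTypeR R).

Lemma measurable_affine (a b : R) :
  measurable_fun [set: mR] (fun t : mR => a * t + b : mR).
Proof.
apply: continuous_measurable_fun => t; apply: cvgD; last exact: cvg_cst.
by apply: cvgM; [exact: cvg_cst|exact: cvg_id].
Qed.

(** The left-hand side is a measure [nu] in [A] which agrees with Lebesgue measure on half-open
    intervals; uniqueness extends this to all measurable sets. *)
Lemma lebesgue_affine (a b : R) (a0 : 0 < a) (A : set mR) : measurable A ->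
  (a%:E * lebesgue_measure ((fun t : mR => (a * t + b)%R : mR) @^-1` A))%E
  = lebesgue_measure A.
Proof.
move=> mA.
pose nu : {measure set mR -> \bar R} := mscale (NngNum (ltW a0))
  (measure_function_pushforward__canonical__measure_function_Measure
    (@lebesgue_measure R) (measurable_affine a b)).
apply/esym; apply: (lebesgue_measure_unique (mu := nu)) mA => _ [[x y] _ <-].
rewrite -[RHS]/(a%:E * lebesgue_measure ((fun t : mR => (a * t + b)%R : mR) @^-1` `]x, y]))%E.
have -> : (fun t : mR => (a * t + b : mR)) @^-1` `]x, y] =
    `](x - b) / a, (y - b) / a]%classic.
  apply/seteqP; split => t /=; rewrite !in_itv/= ltr_pdivrMr// ler_pdivlMr//
    ltrBlDr lerBrDr [a * t]mulrC //.
rewrite !lebesgue_measure_itv /= !lte_fin ltr_pM2r ?invr_gt0// ltrD2r.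
case: ifPn => _; last by rewrite mule0.
rewrite -!EFinB -EFinM; congr (_%:E); field.
exact: lt0r_neq0.
Qed.

(** Equality of the measures gives the formula for nonnegative functions ([E]). It is then applied
    to the positive and the negative part, whose integrals are finite. *)
Lemma Rintegral_affine (a b B M : R) (G : mR -> R) : 0 < a ->
  bdd_on ([set x : mR | `|x| <= B] : set mR) M G ->
  \int[@lebesgue_measure R]_t G (a * t + b) = a^-1 * \int[@lebesgue_measure R]_t G t.
Proof.
move=> a0 bG; have [mG GM G0] := bG.
pose phi : mR -> mR := fun t => a * t + b.
have mphi : measurable_fun [set: mR] phi := measurable_affine a b.
have mE : measurable_fun setT (EFin \o G) by exact/measurable_EFinP.
pose S (r : R) : set mR := [set x : mR | `|x| <= r].
have fin r : (@lebesgue_measure R (S r) < +oo)%E.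
  apply: (@le_lt_trans _ _ (lebesgue_measure (S `|r|))).
    apply: le_measure; rewrite ?inE; [exact: measurable_ball0|exact: measurable_ball0|].
    by move=> x /= /le_trans; apply; exact: ler_norm.
  by rewrite lebesgue_ball0// ltry.
have iG := bdd_on_integrable (@measurable_ball0 R B) (fin B) bG.
have bGp : bdd_on ([set x : mR | `|x| <= (B + `|b|) / a] : set mR) M (G \o phi).
  split; [exact: measurableT_comp|by move=> t; exact: GM|].
  move=> t nt; apply: G0 => /= Bt; apply: nt; rewrite /= ler_pdivlMr//.
  rewrite -[X in _ * X](gtr0_norm a0) -normrM mulrC.
  have -> : a * t = phi t - b by rewrite /phi addrK.
  by apply: le_trans (ler_normB _ _) _; rewrite lerD2r.
have iGp := bdd_on_integrable (@measurable_ball0 R _) (fin _) bGp.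
pose nu : {measure set mR -> \bar R} := mscale (NngNum (ltW a0))
  (measure_function_pushforward__canonical__measure_function_Measure
    (@lebesgue_measure R) mphi).
have E (f : mR -> \bar R) : measurable_fun setT f -> (forall x, 0 <= f x)%E ->
    (\int[@lebesgue_measure R]_t f t = a%:E * \int[@lebesgue_measure R]_t f (phi t))%E.
  move=> mf f0; transitivity (\int[nu]_t f t)%E.
    apply: eq_measure_integral => A mA _; exact: (esym (lebesgue_affine b a0 mA)).
  rewrite ge0_integral_mscale//; congr (_ * _)%E.
  by rewrite ge0_integral_pushforward.
have E1 : (\int[@lebesgue_measure R]_t (G t)%:E =
    a%:E * \int[@lebesgue_measure R]_t (G (phi t))%:E)%E.
  rewrite [LHS]integralE [X in (_ * X)%E]integralE muleBr//; last first.
    apply: fin_num_adde_defl; rewrite fin_numN.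
    by apply: integrable_fin_num => //; exact: integrable_funeneg.
  congr (_ - _)%E.
    have Ep := E _ (measurable_funepos mE) (funepos_ge0 _).
    by apply: etrans Ep _; congr (_ * _)%E; apply: eq_integral => t _; rewrite !funeposE.
  have En := E _ (measurable_funeneg mE) (funeneg_ge0 _).
  by apply: etrans En _; congr (_ * _)%E; apply: eq_integral => t _; rewrite !funenegE.
rewrite /Rintegral E1 fineM//; last by apply: integrable_fin_num.
by rewrite mulKf// lt0r_neq0.
Qed.

End AffineChange.

Lemma continuous_nonexpansive (R : realType) (V W : normedModType R) (f : V -> W) :
  (forall x y, `|f x - f y| <= `|x - y|) -> continuous f.
Proof.
move=> fxy x; apply/cvgrPdist_lt => e e0; near=> y.
apply: le_lt_trans (fxy x y) _; near: y; exact: cvgr_dist_lt.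
Unshelve. all: by end_near. Qed.

(** * Integration of continuous functions of a row vector *)

Section RowIntegral.
Variable R : realType.
Local Notation mR := (measurableTypeR R).
Local Notation T n := (n.-tuple mR).
Local Notation Rn n := 'rV[R]_n.

(** The measure lives on tuples and the topology on row vectors; this map links the two. *)
Definition row_of_tuple n (t : T n) : Rn n := \row_i tnth t i.

Lemma dist_lt_of_common (e k q x y : R) : k < e / 2 ->
  x - k < q -> q < x + k -> q - k < y -> y < q + k -> `|x - y| < e.
Proof. by rewrite ltr_norml => *; apply/andP; split; lra. Qed.

(** An open set is the countable union of the cubes with rational centre and radius [k.+1%:R^-1]
    that it contains, and a cube is a finite intersection of preimages of intervals under the
    coordinates. *)
Lemma measurable_row_open n (W : set (Rn n)) : open W ->
  measurable (@row_of_tuple n @^-1` W).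
Proof.
move=> oW.
pose B (q : 'rV[rat]_n) (k : nat) : set (T n) :=
  \bigcap_(i in [set: 'I_n]) ((fun t : T n => tnth t i) @^-1`
     `](ratr (q ord0 i) - k.+1%:R^-1 : R), ratr (q ord0 i) + k.+1%:R^-1[%classic).
have mB q k : measurable (B q k).
  apply: fin_bigcap_measurable => // i _.
  have mI : measurable (`](ratr (q ord0 i) - k.+1%:R^-1 : R),
    ratr (q ord0 i) + k.+1%:R^-1[%classic : set mR) by exact: measurable_itv.
  rewrite -[X in measurable X]setTI; apply: measurable_tnth => //.
pose D (qk : 'rV[rat]_n * nat) := B qk.1 qk.2 `<=` @row_of_tuple n @^-1` W.
(* Pairs of centre and radius are enumerated by their codes; codes of no pair, and cubes not
   contained in [W], contribute the empty set. *)
have -> : @row_of_tuple n @^-1` W =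
    \bigcup_(m in [set: nat]) (if @unpickle ('rV[rat]_n * nat)%type m is Some qk
       then (if `[< D qk >] then B qk.1 qk.2 else set0) else set0).
  apply/seteqP; split => [t Wt|t [m _]]; last first.
    by case: (unpickle m) => // qk; case: asboolP => // Dqk; exact: Dqk.
  have : nbhs (row_of_tuple t) W by exact: open_nbhs_nbhs.
  move=> /(nbhs_ballP (row_of_tuple t))[e /= e0 eW].
  have [k kP] : exists k, k.+1%:R^-1 < (e / 2 : R).
    have e20 : 0 < (e / 2 : R) by rewrite divr_gt0.
    by have [k _ kP] := near_infty_natSinv_lt (PosNum e20); exists k; exact: (kP k (leqnn k)).
  have /choice[q qP] : forall i : 'I_n, exists q : rat,
      (ratr q : R) \in `](tnth t i - k.+1%:R^-1), (tnth t i + k.+1%:R^-1)[.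
    move=> i; apply: rat_in_itvoo.
    by rewrite ltrBlDr -addrA ltrDl addr_gt0.
  pose qr : 'rV[rat]_n := \row_i q i.
  exists (pickle (qr, k)) => //; rewrite pickleK.
  case: asboolP => [_ i _ /=|nD].
    by have := qP i; rewrite mxE !in_itv/= => /andP[q1 q2]; apply/andP; split;
      [rewrite ltrBlDr|rewrite -ltrBlDr].
  exfalso; apply: nD => s Bs /=; apply: eW; split => // i j; rewrite ord1 !mxE /=.
  have := Bs j I; rewrite /= mxE in_itv/= => /andP[s1 s2].
  have := qP j; rewrite in_itv/= => /andP[q1 q2].
  exact: (dist_lt_of_common kP q1 q2 s1 s2).
apply: bigcup_measurable => m _; case: (unpickle m) => // qk.
by case: asboolP.
Qed.

Lemma measurable_row_continuous n (G : Rn n -> R) : continuous G ->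
  measurable_fun [set: T n] (G \o @row_of_tuple n).
Proof.
move=> /continuousP cG; apply: (measurability _ (RGenOpens.measurableE R)).
move=> _ [_ [a [b ->] <-]]; rewrite setTI.
apply: (measurable_row_open (W := G @^-1` `]a, b[%classic)).
by apply: cG; exact: interval_open.
Qed.

Definition cont_on_ball n (b : R) (G : Rn n -> R) :=
  continuous G /\ forall x, ~ (`|x| <= b) -> G x = 0.

Lemma compact_norm_ball n (b : R) : compact [set x : Rn n | `|x| <= b].
Proof.
apply: bounded_closed_compact.
  exists b; split; first exact: num_real.
  by move=> M bM x /= xb; apply: le_trans xb (ltW bM).
rewrite (_ : [set x | _] = (fun x : Rn n => `|x|) @^-1` [set y | y <= b])//.
apply: closed_comp; last exact: closed_le.
by move=> x _; exact: norm_continuous.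
Qed.

Lemma row_in_tbox n (b : R) (t : T n) : 0 <= b ->
  (`|row_of_tuple t| <= b) <-> tbox b t.
Proof.
move=> b0; split => [tb i|tb].
  by apply: le_trans tb; have := rv_norm_ge (row_of_tuple t) i; rewrite mxE.
by apply: rv_norm_le => // i; rewrite mxE; exact: tb.
Qed.

Lemma cont_on_ball_tbdd n b M (G : Rn n -> R) : 0 <= b -> cont_on_ball b G ->
  (forall x, `|G x| <= M) -> tbdd b M (G \o @row_of_tuple n).
Proof.
move=> b0 [cG G0] GM; split; first exact: measurable_row_continuous.
  by move=> t; exact: GM.
by move=> t nt; apply: G0 => xb; apply: nt; apply/row_in_tbox.
Qed.

Lemma cont_on_ball_bounded n b (G : Rn n -> R) : cont_on_ball b G ->
  exists2 M, 0 <= M & forall x, `|G x| <= M.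
Proof.
move=> [cG G0].
have [M M0 MP] := continuous_compact_bounded (@compact_norm_ball n b)
  (fun x _ => cG x).
exists M => // x; have [xb|xb] := pselect (`|x| <= b); first exact: MP.
by rewrite G0// normr0.
Qed.

Definition cint n (G : Rn n -> R) : R := tint (G \o @row_of_tuple n).

Lemma integralRnE n (g : Rn n -> R[i]) : integralRn g =
  cint (fun x => complex.Re (g x)) +i* cint (fun x => complex.Im (g x)).
Proof. by []. Qed.

Definition vcons n (a : R) (x : Rn n) : Rn n.+1 :=
  \row_i oapp (x ord0) a (unlift ord0 i).

Lemma row_of_tcons n (a : R) (t : T n) :
  row_of_tuple (@tcons R n (a, t)) = vcons a (row_of_tuple t).
Proof.
apply/rowP => i; rewrite !mxE /tcons.
by case: unliftP => [j ->|->] /=; rewrite ?tnthS ?mxE.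
Qed.

Lemma vconsD n (a c : R) (x y : Rn n) : vcons a x + vcons c y = vcons (a + c) (x + y).
Proof. by apply/rowP => i; rewrite !mxE; case: unlift => [j|] //=; rewrite mxE. Qed.

Lemma vconsN n (a : R) (x : Rn n) : - vcons a x = vcons (- a) (- x).
Proof. by apply/rowP => i; rewrite !mxE; case: unlift => [j|] //=; rewrite mxE. Qed.

Lemma vconsP n (x : Rn n.+1) : exists a y, x = vcons a y.
Proof.
exists (x ord0 ord0), (\row_i x ord0 (lift ord0 i)).
by apply/rowP => i; rewrite !mxE; case: unliftP => [j ->|->] //=; rewrite mxE.
Qed.

Lemma norm_vcons n (a : R) (x : Rn n) : `|x| <= `|vcons a x|.
Proof.
apply: rv_norm_le => // i; apply: le_trans (rv_norm_ge _ (lift ord0 i)).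
by rewrite mxE liftK.
Qed.

Lemma norm_vcons0 n (x : Rn n) : `|vcons 0 x| <= `|x|.
Proof.
apply: rv_norm_le => // i; rewrite mxE; case: unliftP => [j _|_] /=.
  exact: rv_norm_ge.
by rewrite normr0.
Qed.

Lemma continuous_vcons n (a : R) : continuous (@vcons n a).
Proof.
apply: continuous_nonexpansive => x y.
by rewrite vconsN vconsD subrr; exact: norm_vcons0.
Qed.

Lemma cont_on_ball_section n b (G : Rn n.+1 -> R) a :
  cont_on_ball b G -> cont_on_ball b (fun x => G (vcons a x)).
Proof.
move=> [cG G0]; split.
  move=> x; apply: (@continuous_comp _ _ _ (vcons a) G).
    exact: continuous_vcons.
  exact: cG.
move=> x nx; apply: G0 => xb; apply: nx; apply: le_trans xb.
exact: norm_vcons.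
Qed.

Lemma cont_on_ball_translate n b (G : Rn n -> R) c :
  cont_on_ball b G -> cont_on_ball (b + `|c|) (fun x => G (x + c)).
Proof.
move=> [cG G0]; split.
  move=> x; apply: (@continuous_comp _ _ _ (fun y : Rn n => y + c) G).
    exact: (cvgD cvg_id (cvg_cst _)).
  exact: cG.
move=> x nx; apply: G0 => xb; apply: nx.
have -> : `|x| = `|(x + c) - c| by rewrite addrK.
apply: le_trans (ler_normB _ _) _.
by rewrite lerD2r.
Qed.

(** Induction on the dimension: the inner integral absorbs the translation of the last coordinates,
    and the affine change of variable with slope 1 that of the first. *)
Lemma cint_translate n b (G : Rn n -> R) c : 0 <= b -> cont_on_ball b G ->
  cint (fun x => G (x + c)) = cint G.
Proof.
elim: n G c => [|n IH] G c b0 cG.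
  by rewrite /cint !tint0 /=; congr G; apply/rowP => -[].
have [M M0 GM] := cont_on_ball_bounded cG.
have [c0 [c' cE]] := vconsP c.
have b'0 : 0 <= b + `|c| by rewrite addr_ge0.
rewrite /cint (tintS b'0 (cont_on_ball_tbdd b'0 (cont_on_ball_translate c cG)
  (fun x => GM _))).
have bG := cont_on_ball_tbdd b0 cG GM.
rewrite (tintS b0 bG).
pose H (a : mR) : R := tint (fun t => G (row_of_tuple (@tcons R n (a, t)))).
transitivity (\int[@lebesgue_measure R]_a H (1 * a + c0)).
  congr (Rintegral _ _ _); apply/funext => a; rewrite mul1r /H.
  transitivity (cint (fun x => (fun y => G (vcons (a + c0) y)) (x + c'))).
    congr tint; apply/funext => t /=.
    by rewrite row_of_tcons cE vconsD.
  rewrite (IH (fun y => G (vcons (a + c0) y)))//; last exact: cont_on_ball_section.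
  by congr tint; apply/funext => t /=; rewrite row_of_tcons.
rewrite (Rintegral_affine c0 (ltr01) (tbdd_sectionT b0 bG)).
by rewrite invr1 mul1r.
Qed.

Lemma cint_lin n b b' (F G : Rn n -> R) (x : R) : 0 <= b -> 0 <= b' ->
  cont_on_ball b F -> cont_on_ball b' G ->
  cint (fun t => x * F t + G t) = x * cint F + cint G.
Proof.
move=> b0 b'0 bF bG.
have [M M0 FM] := cont_on_ball_bounded bF; have [M' M'0 GM] := cont_on_ball_bounded bG.
exact: (tint_lin x (cont_on_ball_tbdd b0 bF FM) (cont_on_ball_tbdd b'0 bG GM)).
Qed.

Lemma cint_le n b M (G : Rn n -> R) : 0 <= b -> cont_on_ball b G ->
  (forall x, `|G x| <= M) -> `|cint G| <= M * (2 * b) ^+ n.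
Proof. by move=> b0 cG GM; apply: (tbdd_tint_le b0); exact: cont_on_ball_tbdd. Qed.

End RowIntegral.

(** * Complex-valued integrals *)

Section ComplexIntegral.
Variables (R : realType) (n : nat).
Local Notation Rn := 'rV[R]_n.
Local Notation C := R[i].
Local Notation normc := Normc.normc.
Implicit Types (f g phi psi : Rn -> C) (G : Rn -> R).

(** A boolean selects the real or the imaginary part, so that one argument treats both. *)
Definition cpart (b : bool) (z : C) : R := if b then complex.Re z else complex.Im z.

Lemma cpartD b z w : cpart b (z + w) = cpart b z + cpart b w.
Proof. by case: b; rewrite /cpart ?cReD ?cImD. Qed.

Lemma cpartN b z : cpart b (- z) = - cpart b z.
Proof. by case: b; rewrite /cpart ?cReN ?cImN. Qed.

Lemma cpart_scale b (r : R) z : cpart b (r%:C * z) = r * cpart b z.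
Proof. by case: b z => -[x y]; rewrite /cpart /=; ring. Qed.

Lemma cpart_le b z : `|cpart b z| <= normc z.
Proof. by case: b; [exact: Re_le_normc|exact: Im_le_normc]. Qed.

Lemma cpart_cpartial b s g :
  (fun x => cpart b (cpartial s g x)) = partial_word s (fun x => cpart b (g x)).
Proof. by case: b. Qed.

Lemma smooth_cpart A b g : smooth A g -> smoothR A (fun x => cpart b (g x)).
Proof. by move=> [sr si]; case: b; [exact: sr|exact: si]. Qed.

Definition ccont_on_ball (r : R) g := forall b, cont_on_ball r (fun x => cpart b (g x)).

Lemma cont_on_ball_lin r (a : R) G H : cont_on_ball r G -> cont_on_ball r H ->
  cont_on_ball r (fun x => a * G x + H x).
Proof.
move=> [cG G0] [cH H0]; split.
  by move=> x; have E := cvgD (cvgM (cvg_cst a) (cG x)) (cH x); exact: E.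
by move=> x nx; rewrite G0// H0// mulr0 addr0.
Qed.

Lemma Re_integralRn g : complex.Re (integralRn g) = cint (fun x => complex.Re (g x)).
Proof. by []. Qed.

Lemma Im_integralRn g : complex.Im (integralRn g) = cint (fun x => complex.Im (g x)).
Proof. by []. Qed.

Lemma integralRn_lin r (a : C) f g : 0 <= r -> ccont_on_ball r f -> ccont_on_ball r g ->
  integralRn (fun x => a * f x + g x) = a * integralRn f + integralRn g.
Proof.
move=> r0 cf cg.
have fr := cf true; have fi := cf false; have gr := cg true; have gi := cg false.
rewrite /cpart in fr fi gr gi.
apply: complex_ext.
  rewrite cReD cReM !Re_integralRn !Im_integralRn.
  rewrite (_ : (fun x => _) = fun x => complex.Re a * complex.Re (f x) +
     ((- complex.Im a) * complex.Im (f x) + complex.Re (g x))); last first.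
    by apply/funext => x; rewrite cReD cReM; ring.
  rewrite (cint_lin _ r0 r0 fr (cont_on_ball_lin _ fi gr)) (cint_lin _ r0 r0 fi gr).
  by ring.
rewrite cImD cImM !Re_integralRn !Im_integralRn.
rewrite (_ : (fun x => _) = fun x => complex.Re a * complex.Im (f x) +
   (complex.Im a * complex.Re (f x) + complex.Im (g x))); last first.
  by apply/funext => x; rewrite cImD cImM; ring.
rewrite (cint_lin _ r0 r0 fi (cont_on_ball_lin _ fr gi)) (cint_lin _ r0 r0 fr gi).
by ring.
Qed.

Lemma integralRn_le r M g : 0 <= r -> ccont_on_ball r g ->
  (forall x, normc (g x) <= M) -> normc (integralRn g) <= 2 * M * (2 * r) ^+ n.
Proof.
move=> r0 cg gM; apply: le_trans (normc_le_parts _) _; rewrite integralRnE /=.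
rewrite mulrDl mul1r mulrDl; apply: lerD.
  by apply: (cint_le r0 (cg true)) => x; apply: le_trans (gM x); exact: (cpart_le true).
by apply: (cint_le r0 (cg false)) => x; apply: le_trans (gM x); exact: (cpart_le false).
Qed.

Lemma integralRn_translate r g c : 0 <= r -> ccont_on_ball r g ->
  integralRn (fun x => g (x + c)) = integralRn g.
Proof.
move=> r0 cg; rewrite !integralRnE.
by rewrite (cint_translate c r0 (cg true)) (cint_translate c r0 (cg false)).
Qed.

(** At a point outside [A], where nothing is known about [h], the factor [k] vanishes on a
    neighbourhood, because [S] is closed and contained in [A]. *)
Lemma continuous_mul_supp (A S : set Rn) (h k : Rn -> R) :
  (forall x, A x -> {for x, continuous h}) -> continuous k -> closed S -> S `<=` A ->
  (forall x, ~ S x -> k x = 0) -> continuous (fun x => h x * k x).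
Proof.
move=> ch ck cS SA k0 x; have [Ax|nAx] := pselect (A x).
  by have E := cvgM (ch x Ax) (ck x); exact: E.
have nSx : (~` S) x by move=> /SA.
have oS : open (~` S) by exact: closed_openC.
apply: (@continuous_near_eq _ _ (fun=> 0)); last exact: cst_continuous.
near=> y; rewrite k0 ?mulr0//.
by near: y; exact: (open_nbhs_nbhs (conj oS nSx)).
Unshelve. all: by end_near. Qed.

Lemma ccont_mul Om f phi r : smooth Om f -> testfun Om phi ->
  (forall x, supp phi x -> `|x| <= r) -> ccont_on_ball r (fun y => f y * phi y).
Proof.
move=> sf [sp cp pO] pr b.
have H b1 b2 : cont_on_ball r (fun y => cpart b1 (f y) * cpart b2 (phi y)).
  split.
    apply: (@continuous_mul_supp Om (supp phi)).
    - by move=> x Ox; have [] := smooth_cpart b1 sf [::] Ox.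
    - by move=> x; have [] := smooth_cpart b2 sp [::] (x := x) I.
    - exact: closed_closure.
    - exact: pO.
    - by move=> x /notsupp ->; case: b2.
  move=> x nx; rewrite (@notsupp _ _ phi); first by case: b2; rewrite /cpart /= mulr0.
  by move=> /pr.
case: b.
  rewrite /cpart (_ : (fun y => _) = fun y => (-1) * (complex.Im (f y) * complex.Im (phi y))
     + complex.Re (f y) * complex.Re (phi y)).
    exact: (cont_on_ball_lin _ (H false false) (H true true)).
  by apply/funext => y; rewrite cReM; ring.
rewrite /cpart (_ : (fun y => _) = fun y => 1 * (complex.Re (f y) * complex.Im (phi y))
   + complex.Im (f y) * complex.Re (phi y)).
  exact: (cont_on_ball_lin _ (H true false) (H false true)).
by apply/funext => y; rewrite cImM; ring.
Qed.

Lemma compact_in_ball (K : set Rn) : compact K ->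
  exists2 r : R, 0 <= r & forall x, K x -> `|x| <= r.
Proof.
move=> /compact_bounded[M [Mr MP]]; exists (`|M| + 1); first by rewrite addr_ge0.
by move=> x Kx; apply: MP Kx; rewrite (le_lt_trans (ler_norm _))// ltrDl.
Qed.

Lemma dist_of_fun_distribution Om f : smooth Om f ->
  is_distribution Om (dist_of_fun f).
Proof.
move=> sf; split.
  move=> a phi psi tp tq; have [_ cp _] := tp; have [_ cq _] := tq.
  have [r1 r10 r1P] := compact_in_ball cp; have [r2 r20 r2P] := compact_in_ball cq.
  have r0 : 0 <= r1 + r2 by rewrite addr_ge0.
  rewrite /dist_of_fun.
  have -> : (fun y => f y * (a * phi y + psi y)) =
     (fun y => a * (f y * phi y) + f y * psi y).
    by apply/funext => y; ring.
  apply: (integralRn_lin _ r0).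
    by apply: (ccont_mul sf tp) => x /r1P xr; apply: le_trans xr _; rewrite lerDl.
  by apply: (ccont_mul sf tq) => x /r2P xr; apply: le_trans xr _; rewrite lerDr.
move=> K cK KO; have [r r0 rP] := compact_in_ball cK.
have [M M0 MP] := smooth_compact_bounded 0 KO cK sf.
exists (2 * M * (2 * r) ^+ n), 0%N => phi tp pK.
have cfp : ccont_on_ball r (fun y => f y * phi y).
  by apply: (ccont_mul sf tp) => x /pK; exact: rP.
apply: le_trans (integralRn_le (M := M * seminorm setT 0 phi) r0 cfp _) _.
  move=> x; rewrite Normc.normcM.
  have [Kx|nKx] := pselect (K x).
    apply: ler_pM; rewrite ?normc_ge0//.
      by have := MP [::] x isT Kx; rewrite cpartial_nil.
    have := cpartial_le_seminormT (s := [::]) (m := 0) x (testfunT tp) isT.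
    by rewrite cpartial_nil.
  rewrite (@notsupp _ _ phi); last by move=> /pK.
  by rewrite Normc.normc0 mulr0 mulr_ge0// seminorm_ge0.
by rewrite le_eqVlt; apply/orP; left; apply/eqP; ring.
Qed.

End ComplexIntegral.

(** The criterion behind every differentiation that is not a rule of calculus: of
    [x |-> u (shift_test phi x)], of integrals with a parameter, and of the flat exponential at
    0. *)
Lemma is_derive_quadratic (R : realType) (g : R -> R) (d c r : R) : 0 < r ->
  (forall s : R, `|s| <= r -> `|g s - g 0 - s * d| <= c * s ^+ 2) ->
  is_derive (0 : R) 1 g d.
Proof.
move=> r0 gq.
have c0 : 0 <= c.
  have := le_trans (normr_ge0 _) (gq r _); rewrite gtr0_norm// lexx => /(_ isT).
  by rewrite pmulr_lge0// exprn_gt0.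
have H : (fun h : R => h^-1 *: ((g \o shift 0) (h *: 1) - g 0)) @ 0^' --> d.
  apply/cvgrPdist_lt => e e0.
  have de : 0 < Num.min r (e / (c + 1)).
    by rewrite lt_min r0 divr_gt0// ltr_wpDl.
  near=> h.
  have h0 : h != 0 by near: h; exact: nbhs_dnbhs_neq.
  have hr : `|h| < Num.min r (e / (c + 1)).
    near: h; apply: (dnbhs0_lt de).
  move: hr; rewrite lt_min => /andP[hr he].
  rewrite /= addr0 /GRing.scale /= mulr1.
  have -> : d - h^-1 * (g h - g 0) = - (h^-1 * (g h - g 0 - h * d)).
    by field.
  rewrite normrN normrM normfV.
  have hp : 0 < `|h| by rewrite normr_gt0.
  rewrite mulrC ltr_pdivrMr//; apply: le_lt_trans (gq h (ltW hr)) _.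
  rewrite -[h ^+ 2]real_normK ?num_real// expr2 mulrA ltr_pM2r//.
  move: he; rewrite ltr_pdivlMr ?ltr_wpDl// => he.
  by apply: le_lt_trans he; rewrite mulrDr mulr1 mulrC lerDl.
by apply: DeriveDef; [apply/cvg_ex; exists d|exact: cvg_lim].
Unshelve. all: by end_near. Qed.

Lemma continuous_of_lipschitz_at (R : realType) (V : normedModType R) (g : V -> R)
    (x : V) (r L : R) : 0 < r -> 0 <= L ->
  (forall x', `|x - x'| <= r -> `|g x - g x'| <= L * `|x - x'|) ->
  {for x, continuous g}.
Proof.
move=> r0 L0 lip.
apply/cvgrPdist_lt => e e0.
have d0 : 0 < Num.min r (e / (L + 1)) by rewrite lt_min r0 divr_gt0// ltr_wpDl.
apply/(nbhs_ballP x); exists (Num.min r (e / (L + 1))) => //= x'.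
rewrite -ball_normE /ball_ /= lt_min => /andP[x'r x'e].
apply: le_lt_trans (lip x' (ltW x'r)) _.
move: x'e; rewrite ltr_pdivlMr ?ltr_wpDl// => x'e.
apply: le_lt_trans x'e; by rewrite mulrDr mulr1 mulrC lerDl.
Qed.

(** * Regularization of distributions *)

Section DistributionCalculus.
Variables (R : realType) (n : nat).
Local Notation Rn := 'rV[R]_n.
Local Notation C := R[i].
Local Notation normc := Normc.normc.
Variables (Om : set Rn) (u : (Rn -> C) -> C).
Hypotheses (Om_open : open Om) (u_dist : is_distribution Om u).
Implicit Types (phi psi : Rn -> C).

Definition shift_test phi (x : Rn) : Rn -> C := fun y => phi (y - x).

Lemma dist_lin (a : C) phi psi : testfun Om phi -> testfun Om psi ->
  u (fun y => a * phi y + psi y) = a * u phi + u psi.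
Proof. by have [ul _] := u_dist; exact: ul. Qed.

(** The continuity of [u] in the form in which it is used: a nonnegative constant, and any common
    bound [b] of the derivatives along words in place of the seminorm. *)
Lemma dist_estimate (K : set Rn) : compact K -> K `<=` Om ->
  exists (M : R) (m : nat), 0 <= M /\ forall phi (b : R), testfun Om phi ->
    supp phi `<=` K -> 0 <= b ->
    (forall s x, (size s <= m)%N -> normc (cpartial s phi x) <= b) ->
    normc (u phi) <= M * b.
Proof.
move=> cK KO; have [_ uc] := u_dist; have [M [m uM]] := uc K cK KO.
exists `|M|, m; split => // phi b tp pK b0 pb.
apply: le_trans (uM phi tp pK) _; apply: le_trans (ler_norm _) _.
rewrite normrM; apply: ler_wpM2l => //; rewrite ger0_norm ?seminorm_ge0//.
by apply: seminorm_le => // s x sm _; exact: pb.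
Qed.

Lemma Udom_sub phi psi : supp psi `<=` supp phi -> Udom Om phi `<=` Udom Om psi.
Proof. by move=> qp x [Ox xO]; split => // y /qp; exact: xO. Qed.

(** Compactness of the support makes the admissible displacement of [x] uniform in [y]. A single
    compact [K] containing all nearby translates of the support is what allows one estimate of [u]
    to serve them all. *)
Lemma Udom_nbhs phi x : testfun setT phi -> Udom Om phi x ->
  exists r (K : set Rn), [/\ 0 < r, compact K, K `<=` Om &
    forall x', `|x - x'| <= r -> Udom Om phi x' /\ forall y, supp phi y -> K (x' + y)].
Proof.
move=> [_ cp _] [Ox xO].
have H : \forall x' \near nbhs x, supp phi `<=` [set y | Om (x' + y)].
  apply: ((compact_near_coveringP (supp phi)).1 cp).
  move=> y py.
  have /(nbhs_ballP (x + y))[e /= e0 eO] := open_nbhs_nbhs (conj Om_open (xO y py)).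
  exists (ball y (e / 2), ball x (e / 2)).
    by split; apply: nbhsx_ballx; rewrite divr_gt0.
  move=> -[y' x'] /=; rewrite -!ball_normE /ball_ /= => -[yy' xx'].
  apply: eO; rewrite -ball_normE /ball_ /= opprD addrACA.
  by rewrite (le_lt_trans (ler_normD _ _))// [ltRHS]splitr ltrD.
have : \forall x' \near nbhs x, Om x' /\ supp phi `<=` [set y | Om (x' + y)].
  exact: (@filterI _ _ (nbhs_filter x) _ _ (open_nbhs_nbhs (conj Om_open Ox)) H).
move=> /(nbhs_ballP x)[r0 /= r00 rP].
have {r0 r00 rP} [r0 r00 rP] : exists2 r0 : R, 0 < r0 & forall x', ball x r0 x' ->
    Om x' /\ supp phi `<=` [set y | Om (x' + y)] by exists r0.
have rU x' : `|x - x'| <= r0 / 2 -> Udom Om phi x'.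
  move=> xx'; have [] : Om x' /\ supp phi `<=` [set y | Om (x' + y)].
    apply: rP; rewrite -ball_normE /ball_ /=; apply: le_lt_trans xx' _.
    by rewrite ltr_pdivrMr// ltr_pMr// ltr1n.
  by split.
pose B := [set z : Rn | `|z| <= r0 / 2].
(* The image of a compact product under addition, hence compact. *)
pose K := (fun z : Rn * Rn => x + z.1 + z.2) @` (B `*` supp phi).
exists (r0 / 2), K; split.
- by rewrite divr_gt0.
- apply: continuous_compact; last by apply: compact_setX => //; exact: compact_norm_ball.
  apply: continuous_subspaceT => z.
  have E := cvgD (cvgD (cvg_cst x) (@cvg_fst _ _ (nbhs z.1) (nbhs z.2) _))
    (@cvg_snd _ _ (nbhs z.1) (nbhs z.2) _).
  exact: E.
- move=> _ [[z y] [/= Bz py] <-].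
  have [_] : Udom Om phi (x + z) by apply: rU; rewrite opprD addrA subrr add0r normrN.
  exact.
- move=> x' xx'; split; first exact: rU.
  move=> y py; exists (x' - x, y) => /=; last by rewrite addrCA subrr addr0.
  by split => //; rewrite /B /= distrC.
Qed.

Lemma Udom_open phi : testfun setT phi -> open (Udom Om phi).
Proof.
move=> tp; rewrite openE => x Ux.
have [r [K [r0 _ _ rP]]] := Udom_nbhs tp Ux.
apply/(nbhs_ballP x); exists r => //= y; rewrite -ball_normE /ball_ /= => xy.
by have [] := rP y (ltW xy).
Qed.

Lemma shift_testfun phi x : testfun setT phi -> Udom Om phi x ->
  testfun Om (shift_test phi x).
Proof. by move=> tp [_ xO]; have [] := testfun_translate tp xO. Qed.

Lemma shift_supp phi x (K : set Rn) : testfun setT phi -> Udom Om phi x ->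
  (forall y, supp phi y -> K (x + y)) -> supp (shift_test phi x) `<=` K.
Proof.
move=> tp [_ xO] xK; have [_ sp] := testfun_translate tp xO.
by move=> y /sp /= /xK; rewrite addrCA subrr addr0.
Qed.

(** Taylor's formula for [cpartial t phi] at [y - x] with increment [- s]: moving the translation
    forward moves the argument backward, whence the plus sign. The remainder costs two derivatives
    beyond the length of [t]. *)
Lemma second_difference (b : bool) phi t i (x y : Rn) (s : R) (m : nat) :
  testfun setT phi -> (size t <= m)%N ->
  `|cpart b (cpartial t (shift_test phi (x + s *: 'e_i)) y) -
    cpart b (cpartial t (shift_test phi x) y) +
    s * cpart b (cpartial t (shift_test (cpartial [:: i] phi) x) y)|
  <= seminorm setT m.+2 phi * s ^+ 2.
Proof.
move=> tp tm; have [sp _ _] := tp.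
rewrite /shift_test !cpartial_translate; set z := y - x.
have -> : y - (x + s *: 'e_i) = z + (- s) *: 'e_i by rewrite opprD addrA scaleNr.
pose k := fun y => cpart b (cpartial t phi y).
have kE : k = partial_word t (fun y => cpart b (phi y)) by rewrite -cpart_cpartial.
have sk : smoothR setT k by rewrite kE; apply: smoothR_partial; exact: smooth_cpart.
have kP w : partial_word w k = fun y => cpart b (cpartial (w ++ t) phi y).
  by rewrite kE -partial_word_cat -cpart_cpartial.
have H : `|k (z + (- s) *: 'e_i) - (k z + - s * partial_word [:: i] k z)|
    <= seminorm setT m.+2 phi * s ^+ 2.
  rewrite -[s ^+ 2]sqrrN; apply: (taylor_line2 sk) => // s' _.
  by rewrite kP; apply: le_trans (cpart_le _ _) _; exact: cpartial_le_seminormT.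
apply: le_trans H.
rewrite le_eqVlt; apply/orP; left; apply/eqP; congr (`|_|).
rewrite -cpartial_cat (cpartial_perm (s := t ++ [:: i]) openT sp I (t := [:: i] ++ t));
  last by rewrite perm_catC.
rewrite kP -/(k _) -/(k z); ring.
Qed.

(** By linearity the Taylor remainder of the regularization is the value of [u] at a test function
    [q], all of whose relevant derivatives are of size [s ^+ 2] by [second_difference]; the estimate
    of [u] and [is_derive_quadratic] conclude. *)
Lemma iota_is_derive b phi x i : testfun setT phi -> Udom Om phi x ->
  is_derive x 'e_i (fun x => cpart b (u (shift_test phi x)))
    (- cpart b (u (shift_test (cpartial [:: i] phi) x))).
Proof.
move=> tp Ux; apply: is_derive_line0.
have [r [K [r0 cK KO rP]]] := Udom_nbhs tp Ux.
have [M [m [M0 uM]]] := dist_estimate cK KO.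
apply: (is_derive_quadratic (c := M * (2 * seminorm setT m.+2 phi)) r0) => s sr.
have xs : `|x - (x + s *: 'e_i)| <= r.
  rewrite opprD addrA subrr add0r normrN normrZ; apply: le_trans sr.
  by rewrite -[leRHS]mulr1; apply: ler_wpM2l => //; exact: norm_delta_le1.
have [Us Ks] := rP _ xs.
have [_ Kx] : Udom Om phi x /\ forall y, supp phi y -> K (x + y).
  by apply: rP; rewrite subrr normr0 ltW.
have [tdp dps] := testfun_cpartial [:: i] tp.
have Ud : Udom Om (cpartial [:: i] phi) x by exact: Udom_sub dps _ Ux.
have t1 := shift_testfun tp Us; have k1 := shift_supp tp Us Ks.
have t0 := shift_testfun tp Ux; have k0 := shift_supp tp Ux Kx.
have td := shift_testfun tdp Ud.
have kd : supp (shift_test (cpartial [:: i] phi) x) `<=` K.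
  by apply: (shift_supp tdp Ud) => y /dps; exact: Kx.
have [t01 k01] := testfun_lin (-1) t0 t1 k0 k1 cK KO.
have [tq kq] := testfun_lin s%:C td t01 kd k01 cK KO.
have uq := dist_lin s%:C td t01; rewrite (dist_lin (-1) t0 t1) in uq.
set q := (fun y => s%:C * _ + _) in tq kq uq.
have -> : cpart b (u (shift_test phi (x + s *: 'e_i))) -
    cpart b (u (shift_test phi (x + 0 *: 'e_i))) -
    s * - cpart b (u (shift_test (cpartial [:: i] phi) x)) = cpart b (u q).
  by rewrite scale0r addr0 uq !cpartD cpart_scale mulN1r cpartN; ring.
apply: le_trans (cpart_le _ _) _; rewrite -mulrA.
apply: (uM _ _ tq kq) => [|t y tm].
  by apply: mulr_ge0; [rewrite mulr_ge0// seminorm_ge0|exact: sqr_ge0].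
have [st _ _] := td; have [s0 _ _] := t0; have [s1 _ _] := t1; have [s01 _ _] := t01.
rewrite (cpartial_lin _ _ openT st s01 I) (cpartial_lin _ _ openT s0 s1 I) mulN1r.
apply: le_trans (normc_le_parts _) _.
rewrite -[X in `|X| + _]/(cpart true _) -[X in _ + `|X|]/(cpart false _).
rewrite -mulrA mulrDl mul1r !cpartD !cpart_scale !cpartN.
have H b' := second_difference b' i x y s tp tm.
by apply: lerD; rewrite addrC [X in X + _]addrC; exact: H.
Qed.

Lemma iota_continuous b phi x : testfun setT phi -> Udom Om phi x ->
  {for x, continuous (fun x => cpart b (u (shift_test phi x)))}.
Proof.
move=> tp Ux; have [r [K [r0 cK KO rP]]] := Udom_nbhs tp Ux.
have [M [m [M0 uM]]] := dist_estimate cK KO.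
pose L := M * (2 * (n%:R * seminorm setT m.+1 phi)).
have L0 : 0 <= L by rewrite !mulr_ge0// seminorm_ge0.
have lip x' : `|x - x'| <= r ->
    `|cpart b (u (shift_test phi x)) - cpart b (u (shift_test phi x'))| <= L * `|x - x'|.
  move=> xx'; have [Us Ks] := rP _ xx'.
  have [_ Kx] : Udom Om phi x /\ forall y, supp phi y -> K (x + y).
    by apply: rP; rewrite subrr normr0 ltW.
  have t1 := shift_testfun tp Us; have k1 := shift_supp tp Us Ks.
  have t0 := shift_testfun tp Ux; have k0 := shift_supp tp Ux Kx.
  have [t01 k01] := testfun_lin (-1) t1 t0 k1 k0 cK KO.
  have -> : cpart b (u (shift_test phi x)) - cpart b (u (shift_test phi x')) =
     cpart b (u (fun y => -1 * shift_test phi x' y + shift_test phi x y)).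
    by rewrite (dist_lin (-1) t1 t0) cpartD mulN1r cpartN addrC.
  apply: le_trans (cpart_le _ _) _; rewrite /L -mulrA.
  apply: (uM _ _ t01 k01) => [|t y tm].
    by rewrite !mulr_ge0// seminorm_ge0.
  have [s0 _ _] := t0; have [s1 _ _] := t1.
  rewrite (cpartial_lin _ _ openT s1 s0 I) mulN1r addrC /shift_test !cpartial_translate.
  apply: le_trans (testfun_lipschitz tp tm _ _) _.
  by rewrite opprB addrC addrA subrK distrC.
exact: continuous_of_lipschitz_at r0 L0 lip.
Qed.

Lemma iota_partial b s phi x : testfun setT phi -> Udom Om phi x ->
  partial_word s (fun x => cpart b (u (shift_test phi x))) x =
  (-1) ^+ size s * cpart b (u (shift_test (cpartial s phi) x)).
Proof.
move=> tp; elim: s x => [|i s IH] x Ux; first by rewrite mul1r cpartial_nil.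
rewrite -[LHS]/('D_('e_i) (partial_word s _) x).
rewrite (@near_eq_derive _ _ _ _
  (fun x => (-1) ^+ size s * cpart b (u (shift_test (cpartial s phi) x)))); last first.
  near=> y; apply: IH.
  by near: y; exact: (open_nbhs_nbhs (conj (Udom_open tp) Ux)).
have [tsp sps] := testfun_cpartial s tp.
have [_ ->] := is_deriveZ ((-1) ^+ size s)
  (iota_is_derive b i tsp (Udom_sub sps Ux)).
by rewrite -cpartial_cat /GRing.scale /= exprS mulN1r mulNr mulrN.
Unshelve. all: by end_near. Qed.

Lemma iota_smoothR b phi : testfun setT phi ->
  smoothR (Udom Om phi) (fun x => cpart b (u (shift_test phi x))).
Proof.
move=> tp s x Ux; have [tsp sps] := testfun_cpartial s tp.
have E : \near x, (-1) ^+ size s * cpart b (u (shift_test (cpartial s phi) x)) =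
   partial_word s (fun x => cpart b (u (shift_test phi x))) x.
  near=> y; apply/esym/iota_partial => //.
  by near: y; exact: (open_nbhs_nbhs (conj (Udom_open tp) Ux)).
have Us := Udom_sub sps Ux.
split.
  apply: continuous_near_eq E _.
  have H := cvgM (cvg_cst ((-1) ^+ size s : R)) (iota_continuous (b := b) tsp Us); exact: H.
move=> i; apply: near_eq_derivable E _.
by have [D _] := is_deriveZ ((-1) ^+ size s) (iota_is_derive b i tsp Us); exact: D.
Unshelve. all: by end_near. Qed.

Lemma iota_smooth phi : testfun setT phi -> smooth (Udom Om phi) (iota_c u phi).
Proof. by move=> tp; split; [exact: (iota_smoothR true)|exact: (iota_smoothR false)]. Qed.

Lemma iota_cpartial s phi x : testfun setT phi -> Udom Om phi x ->
  cpartial s (iota_c u phi) x = (-1) ^+ size s * iota_c u (cpartial s phi) x.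
Proof.
move=> tp Ux; apply: complex_ext; rewrite ?Re_sign ?Im_sign.
  exact: (iota_partial true s tp Ux).
exact: (iota_partial false s tp Ux).
Qed.

End DistributionCalculus.

(** * Moderateness of both embeddings and negligibility of their difference *)

Section EmbeddingModerate.
Variables (R : realType) (n : nat).
Local Notation Rn := 'rV[R]_n.
Local Notation C := R[i].
Local Notation normc := Normc.normc.
Variables (Om : set Rn) (Om_open : open Om).
Implicit Types (f g phi psi : Rn -> C) (K L : set Rn).

Lemma translates_in_Udom K L phi : K `<=` Om -> L `<=` Om ->
  translates_in K phi L -> K `<=` Udom Om phi.
Proof. by move=> KO LO tr x Kx; split => [|y py]; [exact: KO|apply: LO; exact: tr]. Qed.

Lemma iota_moderate (u : (Rn -> C) -> C) : is_distribution Om u ->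
  c_moderate Om (iota_c u).
Proof.
move=> u_dist; split; first by move=> phi; exact: iota_smooth.
move=> x0 Ox0; exists Om; split => // K L [cK KO] [cL LO] _ m.
have {}KO : K `<=` Om by move=> x /KO /interior_subset.
have {}LO : L `<=` Om by move=> x /LO /interior_subset.
have [M [m0 [M0 uM]]] := dist_estimate u_dist cL LO.
(* [m] derivatives in [x] fall on the test function, and [m0] more come from the estimate of [u] on
   [L]. *)
exists (m + m0)%N, (M *: 'X); split.
  by move=> i /=; rewrite coefZ coefX mulr_ge0.
move=> phi tp tr; rewrite hornerZ hornerX; apply: seminorm_le.
  by rewrite mulr_ge0// seminorm_ge0.
move=> s x sm Kx; have Ux := translates_in_Udom KO LO tr Kx.
rewrite (iota_cpartial Om_open u_dist s tp Ux) Normc.normcM normc_sign mul1r.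
have [tsp sps] := testfun_cpartial s tp; have Us := Udom_sub sps Ux.
apply: uM.
- exact: shift_testfun.
- by apply: (shift_supp tsp Us) => y /sps; exact: tr.
- exact: seminorm_ge0.
- move=> t y tm; rewrite /shift_test cpartial_translate -cpartial_cat.
  by apply: cpartial_le_seminormT => //; rewrite size_cat addnC leq_add.
Qed.

Lemma sigma_moderate f : smooth Om f -> c_moderate Om (sigma_c f).
Proof.
move=> sf; split; first by move=> phi _; apply: smooth_sub sf => x [].
move=> x0 Ox0; exists Om; split => // K L _ _ _ m.
exists 0%N, (seminorm K m f)%:P; split.
  by move=> i /=; rewrite coefC; case: ifP => // _; exact: seminorm_ge0.
by move=> phi _ _; rewrite hornerC.
Qed.

Lemma integralRn0 : integralRn (fun _ : Rn => 0 : C) = 0.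
Proof.
apply: Normc.eq0_normc; apply/eqP; rewrite eq_le normc_ge0 andbT.
have := @integralRn_le R n 0 0 (fun=> 0) (lexx 0).
rewrite mulr0 mul0r; apply => [b|x]; last by rewrite Normc.normc0.
split; first by move=> x; exact: cst_continuous.
by move=> x _; case: b.
Qed.

Lemma integralRn_scale r (a : C) f : 0 <= r -> ccont_on_ball r f ->
  integralRn (fun x => a * f x) = a * integralRn f.
Proof.
move=> r0 cf; have c0 : ccont_on_ball r (fun _ : Rn => 0 : C).
  by move=> b; split; [move=> x; exact: cst_continuous|move=> x _; case: b].
have := integralRn_lin a r0 cf c0; rewrite integralRn0 addr0 => <-.
by congr integralRn; apply/funext => x; rewrite addr0.
Qed.

(** Differentiating in the translation parameter and differentiating the reflected function
    [x' |-> phi (y - x')] produce the same sign, so the two signs cancel. The right-hand side is the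
    integral that occurs in [delta_seminorm]. *)
Lemma partial_iota_fun f s phi x : smooth Om f -> testfun setT phi ->
  Udom Om phi x ->
  cpartial s (iota_c (dist_of_fun f) phi) x =
  integralRn (fun y => f y * cpartial s (fun x' => phi (y - x')) x).
Proof.
move=> sf tp Ux; have [sp _ _] := tp.
rewrite (iota_cpartial Om_open (dist_of_fun_distribution sf) s tp Ux).
rewrite /iota_c /dist_of_fun.
have [tsp sps] := testfun_cpartial s tp.
have ts := shift_testfun tsp (Udom_sub sps Ux).
have [_ cs _] := ts; have [r r0 rP] := compact_in_ball cs.
have cf := ccont_mul sf ts rP.
rewrite -(integralRn_scale _ r0 cf); congr integralRn; apply/funext => y.
by rewrite /shift_test cpartial_reflect// mulrCA.
Qed.

Lemma smooth_sub_iota f phi : smooth Om f -> testfun setT phi ->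
  smooth (Udom Om phi) ((iota_c (dist_of_fun f) - sigma_c f) phi).
Proof.
move=> sf tp; have oU := Udom_open Om_open tp.
have si := iota_smooth Om_open (dist_of_fun_distribution sf) tp.
have sfU : smooth (Udom Om phi) f by apply: smooth_sub sf => x [].
apply: smooth_eq_on (smooth_lin (-1) oU sfU si) => // y _.
by rewrite mulN1r addrC.
Qed.

Lemma partial_sub_iota f s phi x : smooth Om f -> testfun setT phi ->
  Udom Om phi x ->
  cpartial s ((iota_c (dist_of_fun f) - sigma_c f) phi) x =
  integralRn (fun y => f y * cpartial s (fun x' => phi (y - x')) x) - cpartial s f x.
Proof.
move=> sf tp Ux; have oU := Udom_open Om_open tp.
have si := iota_smooth Om_open (dist_of_fun_distribution sf) tp.
have sfU : smooth (Udom Om phi) f by apply: smooth_sub sf => y [].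
rewrite (cpartial_eq_on s (g := fun y => -1 * f y + iota_c (dist_of_fun f) phi y) oU _ Ux).
  by rewrite (cpartial_lin (-1) s oU sfU si Ux) partial_iota_fun// mulN1r addrC.
by move=> y _; rewrite mulN1r addrC.
Qed.

Lemma iota_sub_sigma_negligible f : smooth Om f ->
  c_negligible Om (iota_c (dist_of_fun f) - sigma_c f).
Proof.
move=> sf; split; first by move=> phi; exact: smooth_sub_iota.
move=> x0 Ox0; exists Om; split => // K L [cK KO] [cL LO] _ m.
have {}KO : K `<=` Om by move=> x /KO /interior_subset.
have {}LO : L `<=` Om by move=> x /LO /interior_subset.
exists m, 'X, [set f]; split.
- split; last by rewrite hornerX.
  by move=> i j; rewrite coefX; case: eqP => _; rewrite ?coefC ?coef0//; case: ifP.
- split; first by move=> _ ->.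
  by move=> K' m' _ _; exists (seminorm K' m' f) => _ ->.
move=> phi tp tr; rewrite /eval2 hornerX hornerC /seminorm /delta_seminorm.
(* Both sides are suprema of the same set, so the estimate is an equality. *)
rewrite le_eqVlt; apply/orP; left; apply/eqP; congr sup; apply/seteqP; split.
  move=> _ [x Kx [a am <-]]; exists x, a, f; split => //.
  by rewrite !partialE partial_sub_iota//; exact: translates_in_Udom tr _ Kx.
move=> _ [x [a [_ [Kx am -> ->]]]]; exists x => //; exists a => //.
by rewrite !partialE partial_sub_iota//; exact: translates_in_Udom tr _ Kx.
Qed.

End EmbeddingModerate.

(** * Mollifiers with vanishing moments *)

Section SmoothFunctions.
Variable R : realType.
Implicit Types (f g : R -> R) (N : nat).

(** Nested existence of derivatives makes stability under products a plain induction, without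
    Leibniz's formula for higher derivatives. *)
Fixpoint ndiff N f : Prop :=
  if N is N'.+1 then
    exists2 f', (forall x : R, is_derive x 1 f (f' x)) & ndiff N' f'
  else True.

Lemma ndiffW N f : ndiff N.+1 f -> ndiff N f.
Proof.
elim: N f => // N IH f [f' df /IH ?]; by exists f'.
Qed.

Lemma ndiff_lin N (a b : R) f g : ndiff N f -> ndiff N g ->
  ndiff N (fun x => a * f x + b * g x).
Proof.
elim: N f g => // N IH f g [f' df nf] [g' dg ng].
exists (fun x => a * f' x + b * g' x); last exact: IH.
by move=> x; exact: (is_deriveD (is_deriveZ a (df x)) (is_deriveZ b (dg x))).
Qed.

Lemma ndiffM N f g : ndiff N f -> ndiff N g -> ndiff N (fun x => f x * g x).
Proof.
elim: N f g => // N IH f g nf ng.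
have nf1 := ndiffW nf; have ng1 := ndiffW ng.
case: nf ng => [f' df nf] [g' dg ng].
exists (fun x => 1 * (f' x * g x) + 1 * (f x * g' x)).
  move=> x; apply: (is_derive_eq (is_deriveM (df x) (dg x))).
  by rewrite /GRing.scale /=; ring.
by apply: ndiff_lin; exact: IH.
Qed.

Lemma ndiff_affine N (a b : R) f : ndiff N f -> ndiff N (fun x => f (a * x + b)).
Proof.
elim: N f => // N IH f [f' df nf].
exists (fun x => a * f' (a * x + b) + 0 * f' (a * x + b)).
  move=> x; have H : is_derive x 1 (fun x : R => a * x + b) a.
    apply: (is_derive_eq
      (is_deriveD (is_deriveZ a (is_derive_id x (1 : R))) (is_derive_cst b x (1 : R)))).
    by rewrite /GRing.scale /=; ring.
  rewrite -[fun x => f (a * x + b)]/(f \o (fun x => a * x + b)).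
  apply: (is_derive_eq (@is_derive1_comp R f (fun x => a * x + b) x _ _ (df _) H)).
  by ring.
by apply: ndiff_lin; exact: IH.
Qed.

Lemma ndiff_derivatives f : (forall N, ndiff N f) ->
  exists2 r : nat -> R -> R, r 0%N = f &
    forall j (x : R), is_derive x 1 (r j) (r j.+1 x).
Proof.
move=> nf; exists (fun j => derive1n j f); first by [].
move=> j x.
elim: j f nf => [|j IH] f nf.
  by have [f' df _] := nf 1%N; rewrite derive1n1 derive1E; apply: DeriveDef; have [] := df x.
have [f' df _] := nf 1%N.
have fE : derive1 f = f' by apply/funext => y; rewrite derive1E; have [_] := df y.
rewrite [derive1n j.+1 f]derive1Sn [derive1n j.+2 f]derive1Sn fE; apply: IH => N.
have [f1 df1 nf1] := nf N.+1.
(* Each order supplies its own first derivative; uniqueness of derivatives identifies them. *)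
suff -> : f' = f1 by [].
by apply/funext => y; have [_ <-] := df y; have [_ <-] := df1 y.
Qed.

(** The functions t^(-k) exp(-1/t) for t > 0, extended by 0. With [k] as a parameter the family is
    closed under differentiation up to linear combinations. *)
Definition flat_exp k (t : R) : R :=
  if 0 < t then (t^-1) ^+ k * expR (- t^-1) else 0.

(** A single term of the exponential series is at most its sum. *)
Lemma expR_flat k (s : R) : 0 <= s -> s ^+ k * expR (- s) <= k`!%:R.
Proof.
move=> s0; rewrite expRN ler_pdivrMr ?expR_gt0//.
case: k => [|k].
  by rewrite expr0 fact0 mul1r; apply: le_trans (expR_ge1Dx s); rewrite lerDl.
rewrite mulrC -ler_pdivrMr ?ltr0n ?fact_gt0//.
by apply: le_trans (expR_ge1Dxn k s0); rewrite lerDr.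
Qed.

(** Dividing by [t ^+ 2] raises the exponent of [t^-1] to [k + 2], whence the factorial. The bound
    is quadratic in order to give the derivative at 0. *)
Lemma flat_exp_le k (t : R) : `|flat_exp k t| <= (k.+2)`!%:R * t ^+ 2.
Proof.
rewrite /flat_exp; case: ifPn => [t0|_]; last first.
  by rewrite normr0 mulr_ge0// sqr_ge0.
have s0 : 0 <= t^-1 by rewrite invr_ge0 ltW.
rewrite ger0_norm; last by rewrite mulr_ge0 ?exprn_ge0 ?expR_ge0.
rewrite -ler_pdivrMr ?exprn_gt0// -exprVn mulrAC -exprD addn2.
exact: expR_flat.
Qed.

Lemma flat_exp_is_derive k (t : R) :
  is_derive t 1 (flat_exp k) (- k%:R * flat_exp k.+1 t + 1 * flat_exp k.+2 t).
Proof.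
have [t0|t0|->] := ltgtP t 0.
- have E : \near t, (fun=> 0 : R) t = flat_exp k t.
    near=> s; rewrite /flat_exp; case: ifPn => // s0; exfalso.
    have : s < 0 by near: s; exact: lt_nbhsl.
    by rewrite ltNge (ltW s0).
  apply: (near_eq_is_derive E).
  apply: (is_derive_eq (is_derive_cst _ _ _)).
  by rewrite /flat_exp ltNge (ltW t0) /= !mulr0 addr0.
- have E : \near t, (t^-1) ^+ k * expR (- t^-1) = flat_exp k t.
    near=> s; rewrite /flat_exp; case: ifPn => // s0; exfalso.
    by move: s0; apply/negP/negPn; near: s; exact: lt_nbhsr.
  apply: (near_eq_is_derive E).
  have H1 := is_deriveV (lt0r_neq0 t0) (is_derive_id t (1 : R)).
  have H2 := is_deriveX k H1.
  have H3 := @is_derive1_comp R expR (fun x => - x^-1) t _ _ (is_derive_expR _) (is_deriveN H1).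
  have H4 := is_deriveM H2 H3; rewrite exprfctE in H4.
  apply: (is_derive_eq H4); rewrite /flat_exp t0 /GRing.scale /= -exprVn.
  case: k {E H2 H4} => [|k] /=; first by rewrite expr0; ring.
  by rewrite !exprS; ring.
apply: (is_derive_quadratic (c := (k.+2)`!%:R) (r := 1) ltr01) => s _.
have F j : flat_exp j 0 = 0 by rewrite /flat_exp ltxx.
by rewrite !F !mulr0 addr0 mulr0 !subr0; exact: flat_exp_le.
Unshelve. all: by end_near. Qed.

Lemma flat_exp_ndiff N k : ndiff N (flat_exp k).
Proof.
elim: N k => // N IH k; exists (fun t => - k%:R * flat_exp k.+1 t + 1 * flat_exp k.+2 t).
  by move=> x; exact: flat_exp_is_derive.
exact: ndiff_lin.
Qed.

(** The product of two flat exponentials, one vanishing for t <= -1 and the other for t >= 1; the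
    reflection t |-> -t exchanges them. The affine arguments are written in the shape of
    [ndiff_affine]. *)
Definition bump (t : R) : R := flat_exp 0 (1 * t + 1) * flat_exp 0 ((- 1) * t + 1).

Lemma bump_ndiff N : ndiff N bump.
Proof. by apply: ndiffM; apply: ndiff_affine; exact: flat_exp_ndiff. Qed.

Lemma bump_even t : bump (- t) = bump t.
Proof. by rewrite /bump mulrC mulrNN mul1r mul1r mulN1r. Qed.

Lemma flat_exp_ge0 k t : 0 <= flat_exp k t.
Proof.
rewrite /flat_exp; case: ifPn => // t0; rewrite mulr_ge0 ?expR_ge0//.
by rewrite exprn_ge0// invr_ge0 ltW.
Qed.

Lemma bump_ge0 t : 0 <= bump t.
Proof. by rewrite mulr_ge0 ?flat_exp_ge0. Qed.

Lemma bump_out t : ~ (`|t| <= 1) -> bump t = 0.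
Proof.
move/negP; rewrite -ltNge /bump /flat_exp ltr_normr => /orP[t1|t1].
  by rewrite [X in _ * X]ifF ?mulr0//; apply/negbTE; rewrite -leNgt; lra.
by rewrite [X in X * _]ifF ?mul0r//; apply/negbTE; rewrite -leNgt; lra.
Qed.

Lemma flat_exp_half (t : R) : 1 / 2 <= t -> expR (- 2) <= flat_exp 0 t.
Proof.
move=> t2; have t0 : 0 < t by lra.
rewrite /flat_exp t0 expr0 mul1r ler_expR lerN2.
by rewrite invf_ple ?posrE//; lra.
Qed.

Lemma bump_half t : `|t| <= 1 / 2 -> expR (- 2) * expR (- 2) <= bump t.
Proof.
rewrite ler_norml => /andP[t1 t2].
by apply: ler_pM; rewrite ?expR_ge0//; apply: flat_exp_half; lra.
Qed.

End SmoothFunctions.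

Section Kernels.
Variable R : realType.
Local Notation mR := (measurableTypeR R).
Implicit Types (r : nat -> R -> R) (N : nat).

Definition sball (e : R) : set mR := [set x : mR | `|x| <= e].

Definition int1 (F : R -> R) : R := \int[@lebesgue_measure R]_t F t.

Lemma sball_lty (e : R) : (@lebesgue_measure R (sball e) < +oo)%E.
Proof.
apply: (@le_lt_trans _ _ (lebesgue_measure (sball `|e|))).
  apply: le_measure; rewrite ?inE; [exact: measurable_ball0|exact: measurable_ball0|].
  by move=> x /= /le_trans; apply; exact: ler_norm.
by rewrite lebesgue_ball0// ltry.
Qed.

Lemma sball_integrable e M F : bdd_on (sball e) M F ->
  (@lebesgue_measure R).-integrable setT (EFin \o F).
Proof. by apply: bdd_on_integrable; [exact: measurable_ball0|exact: sball_lty]. Qed.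

Lemma int1_lin e M e' M' F G (a : R) : bdd_on (sball e) M F -> bdd_on (sball e') M' G ->
  int1 (fun t => a * F t + G t) = a * int1 F + int1 G.
Proof.
move=> bF bG; rewrite /int1.
have iF := sball_integrable bF; have iG := sball_integrable bG.
rewrite RintegralD//; first by rewrite RintegralZl.
have -> : EFin \o (fun t => a * F t) = (fun t => a%:E * (EFin \o F) t)%E.
  by apply/funext => t /=; rewrite EFinM.
exact: integrableZl.
Qed.

Lemma int1_le e M F : 0 <= e -> bdd_on (sball e) M F -> `|int1 F| <= M * (2 * e).
Proof.
move=> e0 bF; have -> : 2 * e = fine (@lebesgue_measure R (sball e)).
  by rewrite lebesgue_ball0.
exact: bdd_on_integral_le (@measurable_ball0 R e) (sball_lty e) bF.
Qed.

Lemma int1_affine e M F (a b : R) : 0 < a -> bdd_on (sball e) M F ->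
  int1 (fun t => F (a * t + b)) = a^-1 * int1 F.
Proof. by move=> a0 bF; exact: Rintegral_affine a0 bF. Qed.

(** A function is carried together with all its derivatives, so that scaling and linear combinations
    act on the whole sequence. *)
Definition derivative_chain r := forall j (x : R), is_derive x 1 (r j) (r j.+1 x).

Lemma chain_continuous r j : derivative_chain r -> continuous (r j).
Proof.
move=> dr x; apply: differentiable_continuous.
by apply/derivable1_diffP; have [] := dr j x.
Qed.

Lemma chain_support r : derivative_chain r -> (forall x, ~ (`|x| <= 1) -> r 0%N x = 0) ->
  forall j x, ~ (`|x| <= 1) -> r j x = 0.
Proof.
move=> dr r0; elim=> [//|j IH] x nx.
have E : \near x, (fun=> 0 : R) x = r j x.
  have x1 : 1 < `|x| by rewrite ltNge; apply/negP.
  near=> y; rewrite IH//; apply/negP; rewrite -ltNge.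
  near: y; have c : {for x, continuous (fun y : R => `|y|)} by exact: norm_continuous.
  exact: (c _ (lt_nbhsr x1)).
have [_ <-] := dr j x.
rewrite -(near_eq_derive _ E); exact: derive_cst.
Unshelve. all: by end_near. Qed.

Lemma chain_bounded r j : derivative_chain r -> (forall x, ~ (`|x| <= 1) -> r j x = 0) ->
  exists2 D, 0 <= D & forall x, `|r j x| <= D.
Proof.
move=> dr r0.
have wh : {within `[-1, 1], continuous (r j)}.
  by apply: continuous_subspaceT; exact: chain_continuous.
have /compact_bounded[M [Mr MP]] := continuous_compact wh (@segment_compact R (-1) 1).
exists (`|M| + 1); first by rewrite addr_ge0.
move=> x; have [x1|nx1] := pselect (`|x| <= 1); last by rewrite r0// normr0 addr_ge0.
apply: (MP (`|M| + 1)); first by rewrite (le_lt_trans (ler_norm _))// ltrDl.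
by exists x => //=; rewrite in_itv/= -ler_norml.
Qed.

Lemma chain_bdd r j e D : derivative_chain r -> (forall x, ~ (`|x| <= e) -> r j x = 0) ->
  (forall x, `|r j x| <= D) -> bdd_on (sball e) D (r j).
Proof.
move=> dr r0 rD; split => //.
by apply: continuous_measurable_fun; exact: chain_continuous.
Qed.

Lemma measurable_exprn (k : nat) : measurable_fun [set: mR] (fun t : mR => t ^+ k : R).
Proof. by apply: continuous_measurable_fun => x; exact: exprn_continuous. Qed.

Lemma moment_bdd (F : mR -> R) e D k : 0 <= e -> bdd_on (sball e) D F ->
  bdd_on (sball e) (e ^+ k * D) (fun t => t ^+ k * F t).
Proof.
move=> e0 bF; apply: (bdd_on_mul (measurable_exprn k) _ _ bF).
  by move=> t te; rewrite normrX lerXn2r// nnegrE.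
by rewrite exprn_ge0.
Qed.

Definition kernel N r :=
  [/\ derivative_chain r,
      forall j x, ~ (`|x| <= 1) -> r j x = 0,
      forall x, r 0%N (- x) = r 0%N x,
      int1 (r 0%N) = 1 &
      forall k, (0 < k < N)%N -> int1 (fun t => t ^+ k * r 0%N t) = 0].

(** Comparison with [c] times the indicator of [-1/2, 1/2]: this interval has length 1, so the
    integral is at least [c]. *)
Lemma bump_int_gt0 : 0 < int1 (@bump R).
Proof.
have [r rE dr] := ndiff_derivatives (@bump_ndiff R).
have r0 x : ~ (`|x| <= 1) -> r 0%N x = 0 by rewrite rE; exact: bump_out.
have [D D0 rD] := chain_bounded dr r0.
have bb := chain_bdd dr r0 rD.
rewrite rE in bb.
pose c : R := expR (- 2) * expR (- 2).
have c0 : 0 < c by rewrite mulr_gt0 ?expR_gt0.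
pose S := sball (1 / 2).
have bS : bdd_on S c (cst c \_ S).
  split.
  - rewrite -measurable_restrictT; last exact: measurable_ball0.
    exact: measurable_cst.
  - by move=> t; rewrite /patch; case: ifP => _; rewrite ?normr0 ?gtr0_norm// ltW.
  - by move=> t nt; rewrite /patch ifF//; apply/negP; rewrite inE.
have : c <= int1 (@bump R).
  have -> : c = int1 (cst c \_ S).
    have E1 : fine (@lebesgue_measure R S) = 1.
      by rewrite lebesgue_ball0 ?divr_ge0//= mul1r divff.
    rewrite /int1 -Rintegral_mkcond Rintegral_cst; last exact: measurable_ball0.
    by rewrite -[LHS]mulr1; congr (_ * _); exact: (esym E1).
  apply: le_Rintegral => //; [exact: sball_integrable bS|exact: sball_integrable bb|].
  move=> t _; rewrite /patch; case: ifPn => [|_]; last exact: bump_ge0.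
  by rewrite inE; exact: bump_half.
exact: lt_le_trans.
Qed.

Lemma kernel1_exists : exists r, kernel 1 r.
Proof.
have [r rE dr] := ndiff_derivatives (@bump_ndiff R).
have r0 x : ~ (`|x| <= 1) -> r 0%N x = 0 by rewrite rE; exact: bump_out.
have [D D0 rD] := chain_bounded dr r0.
have b0 := bump_int_gt0.
pose c := (int1 (@bump R))^-1.
have bb := chain_bdd dr r0 rD; rewrite rE in bb.
exists (fun j x => c * r j x); split.
- by move=> j x; exact: (is_deriveZ c (dr j x)).
- by move=> j x nx; rewrite (chain_support dr r0)// mulr0.
- by move=> x; rewrite rE bump_even.
- rewrite rE /int1 RintegralZl//; first by rewrite /c mulVf// lt0r_neq0.
  exact: sball_integrable bb.
- by move=> [|[|k]].
Qed.

(* Richardson extrapolation: in [2^N * 2 rho(2t) - rho(t)], the moment of order [k]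
   gets multiplied by [2^(N-k) - 1]. *)
Lemma kernel_step N r : (0 < N)%N -> kernel N r -> exists r', kernel N.+1 r'.
Proof.
move=> N0 [dr r0 re r1 rm].
have q0 : (2 : R) ^+ N - 1 != 0.
  rewrite subr_eq0 gt_eqF// exprn_egt1 ?ltr1n//.
  by rewrite -lt0n.
(* Division by [2 ^+ N - 1] restores the integral: [al / 2 + be = 1]. The moment of order [N] is
   multiplied by [al / (2 ^+ N * 2) + be = 0], while those of lower positive order remain zero. *)
pose al : R := 2 ^+ N.+1 / (2 ^+ N - 1); pose be : R := - (2 ^+ N - 1)^-1.
have [D D0 rD] := chain_bounded dr (r0 0%N).
have bb := chain_bdd dr (r0 0%N) rD.
have bm k := moment_bdd k ler01 bb.
have bm2 k : bdd_on (sball 1) (1 ^+ k * D) (fun t => t ^+ k * r 0%N (2 * t + 0)).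
  apply: moment_bdd => //; split.
  - apply: (@measurableT_comp _ _ _ _ _ _ (r 0%N : mR -> R)); first by case: bb.
    exact: measurable_affine.
  - by move=> t; exact: rD.
  - move=> t nt; apply: r0; rewrite addr0 normrM gtr0_norm// => t1; apply: nt.
    by rewrite /sball /=; have := normr_ge0 t; lra.
have mk k : int1 (fun t => t ^+ k * (al * r 0%N (2 * t + 0) + be * r 0%N t)) =
    (al / (2 ^+ k * 2) + be) * int1 (fun t => t ^+ k * r 0%N t).
  have H : int1 (fun t => t ^+ k * r 0%N (2 * t + 0)) =
      (2 ^+ k * 2)^-1 * int1 (fun t => t ^+ k * r 0%N t).
    have := int1_affine 0 (ltr0n R 2) (bm k).
    (* The zero summand brings the scaling into the form of [int1_lin]. *)
    have -> : (fun t => (2 * t + 0) ^+ k * r 0%N (2 * t + 0)) =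
       (fun t => 2 ^+ k * (t ^+ k * r 0%N (2 * t + 0)) + 0 * (t ^+ k * r 0%N t)).
      by apply/funext => t; rewrite addr0 exprMn; ring.
    have bz : bdd_on (sball 1) 0 (fun t => 0 * (t ^+ k * r 0%N t)).
      rewrite (_ : (fun _ => _) = cst 0); last by apply/funext => t; rewrite mul0r.
      by split => [|t|//]; [exact: measurable_cst|rewrite normr0].
    rewrite (int1_lin _ (bm2 k) bz).
    have -> : int1 (fun t => 0 * (t ^+ k * r 0%N t)) = 0.
      have := int1_le ler01 bz; rewrite mul0r => h0; apply/eqP.
      by rewrite -normr_eq0 eq_le h0 normr_ge0.
    rewrite addr0 => E; apply: (mulfI (_ : (2 : R) ^+ k != 0)).
      by rewrite expf_neq0.
    rewrite E; have : (2 : R) ^+ k != 0 by rewrite expf_neq0.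
    by move=> ?; field.
  have -> : (fun t => t ^+ k * (al * r 0%N (2 * t + 0) + be * r 0%N t)) =
    (fun t => al * (t ^+ k * r 0%N (2 * t + 0)) + be * (t ^+ k * r 0%N t)).
    by apply/funext => t; ring.
  have bbe : bdd_on (sball 1) (`|be| * (1 ^+ k * D)) (fun t => be * (t ^+ k * r 0%N t)).
    apply: (bdd_on_mul (G := cst be)) (bm k) => //; exact: measurable_cst.
  rewrite (int1_lin al (bm2 k) bbe) H /int1 RintegralZl//; first by ring.
  exact: sball_integrable (bm k).
exists (fun j x => (al * 2 ^+ j) * r j (2 * x + 0) + be * r j x); split.
- move=> j x; have H : is_derive x 1 (fun x : R => 2 * x + 0) 2.
    apply: (is_derive_eq
      (is_deriveD (is_deriveZ (2 : R) (is_derive_id x (1 : R))) (is_derive_cst (0 : R) x (1 : R)))).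
    by rewrite /GRing.scale /=; ring.
  have H2 := @is_derive1_comp R (r j) (fun x => 2 * x + 0) x _ _ (dr j _) H.
  apply: (is_derive_eq (is_deriveD (is_deriveZ (al * 2 ^+ j) H2) (is_deriveZ be (dr j x)))).
  by rewrite /GRing.scale /= exprS; ring.
- move=> j x nx; rewrite (r0 j x)// (r0 j) ?mulr0 ?addr0//.
  rewrite normrM gtr0_norm// => x1; apply: nx.
  by have := normr_ge0 x; lra.
- by move=> x; rewrite re addr0 mulrN re addr0.
- have := mk 0%N; rewrite !expr0 !mul1r.
  have -> : (fun t => t ^+ 0 * r 0%N t) = r 0%N by apply/funext => t; rewrite expr0 mul1r.
  rewrite r1 mulr1 => E.
  have -> : (fun x => al * 2 ^+ 0 * r 0%N (2 * x + 0) + be * r 0%N x) =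
     (fun t => t ^+ 0 * (al * r 0%N (2 * t + 0) + be * r 0%N t)).
    by apply/funext => t; rewrite !expr0 mul1r mulr1.
  by rewrite E /al /be exprS; field.
- move=> k /andP[k0 kN].
  rewrite (_ : (fun t => _) = (fun t => t ^+ k * (al * r 0%N (2 * t + 0) + be * r 0%N t)));
    last by apply/funext => t; rewrite expr0 mulr1.
  rewrite mk; move: kN; rewrite ltnS leq_eqVlt => /orP[/eqP ->|kN]; last first.
    by rewrite rm ?mulr0// k0.
  rewrite (_ : al / _ + be = 0) ?mul0r// /al /be exprS.
  have : (2 : R) ^+ N != 0 by rewrite expf_neq0.
  by move=> ?; field; apply/andP.
Qed.

Lemma kernel_exists N : (0 < N)%N -> exists r, kernel N r.
Proof.
case: N => // N _; elim: N => [|N [r /(kernel_step (ltn0Sn N))]//].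
exact: kernel1_exists.
Qed.

(** The [j]-th derivative of t |-> e^(-1) rho(t/e), where rho is [r 0]; hence the exponent [j.+1].
    The summand 0 fits the affine change of variable. *)
Definition scaled_kernel r (e : R) (j : nat) (t : R) : R :=
  e^-1 ^+ j.+1 * r j (e^-1 * t + 0).

Section Scaled.
Variables (N : nat) (r : nat -> R -> R) (e : R).
Hypotheses (kr : kernel N r) (e0 : 0 < e).
Local Notation w := (scaled_kernel r e).

Lemma scaled_chain : derivative_chain w.
Proof.
have [dr _ _ _ _] := kr.
move=> j x; have H : is_derive x 1 (fun x : R => e^-1 * x + 0) (e^-1).
  apply: (is_derive_eq
    (is_deriveD (is_deriveZ (e^-1) (is_derive_id x (1 : R))) (is_derive_cst (0 : R) x (1 : R)))).
  by rewrite /GRing.scale /=; ring.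
have H2 := @is_derive1_comp R (r j) (fun x => e^-1 * x + 0) x _ _ (dr j _) H.
apply: (is_derive_eq (is_deriveZ (e^-1 ^+ j.+1) H2)).
by rewrite /scaled_kernel /GRing.scale /= [in RHS]exprS; ring.
Qed.

Lemma scaled_support j x : ~ (`|x| <= e) -> w j x = 0.
Proof.
have [_ r0 _ _ _] := kr.
move=> nx; rewrite /scaled_kernel r0 ?mulr0// addr0 normrM gtr0_norm ?invr_gt0//.
by rewrite mulrC ler_pdivrMr// mul1r.
Qed.

Lemma scaled_even x : w 0 (- x) = w 0 x.
Proof. by have [_ _ re _ _] := kr; rewrite /scaled_kernel mulrN !addr0 re. Qed.

Lemma scaled_le j D : (forall x, `|r j x| <= D) -> forall x, `|w j x| <= e^-1 ^+ j.+1 * D.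
Proof.
move=> rD x; rewrite normrM ger0_norm; last by rewrite exprn_ge0// invr_ge0 ltW.
by apply: ler_wpM2l => //; rewrite exprn_ge0// invr_ge0 ltW.
Qed.

Lemma scaled_moment k : int1 (fun t => t ^+ k * w 0 t) =
  e ^+ k * int1 (fun t => t ^+ k * r 0%N t).
Proof.
have [dr r0 _ _ _] := kr.
have [D D0 rD] := chain_bounded dr (r0 0%N).
have bm := moment_bdd k ler01 (chain_bdd dr (r0 0%N) rD).
have ei0 : 0 < e^-1 by rewrite invr_gt0.
have [dw w0 wD] : [/\ derivative_chain w, (forall x, ~ (`|x| <= e) -> w 0 x = 0) &
   forall x, `|w 0 x| <= e^-1 ^+ 1 * D].
  by split; [exact: scaled_chain|exact: scaled_support|exact: scaled_le].
have bw := moment_bdd k (ltW e0) (chain_bdd dw w0 wD).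
have en0 : e != 0 by rewrite lt0r_neq0.
have := int1_affine 0 ei0 bm; rewrite invrK.
have -> : (fun t => (e^-1 * t + 0) ^+ k * r 0%N (e^-1 * t + 0)) =
   (fun t => (e * e^-1 ^+ k) * (t ^+ k * w 0 t)).
  apply/funext => t; rewrite /scaled_kernel expr1 addr0 exprMn.
  by rewrite [RHS](_ : _ = (e * e^-1) * (e^-1 ^+ k * t ^+ k * r 0%N (e^-1 * t)));
    [rewrite divff// mul1r|ring].
rewrite /int1 RintegralZl//; last exact: sball_integrable bw.
move=> /(congr1 (fun z => e ^+ k * e^-1 * z)).
rewrite [in RHS]mulrA -[e ^+ k * e^-1 * e]mulrA mulVf// mulr1 => <-.
rewrite mulrA (_ : e ^+ k * e^-1 * (e * e^-1 ^+ k) = (e^-1 * e) * (e ^+ k * e^-1 ^+ k));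
  last by ring.
by rewrite mulVf// -exprMn divff// expr1n !mul1r.
Qed.

(** The numbers [c j] stand for the derivatives of [k] at 0. Vanishing moments make the Taylor
    polynomial integrate to [c 0] exactly, and the remainder, at most [C * e ^+ N], meets a kernel
    of height [e^-1 * D] on an interval of length [2 * e]. *)
Lemma kernel_estimate (k : mR -> R) (c : nat -> R) (M C D : R) : (0 < N)%N ->
  measurable_fun setT k -> (forall t, `|k t| <= M) ->
  (forall x, `|r 0%N x| <= D) ->
  (forall t, `|t| <= e -> `|k t - \sum_(j < N) c j * t ^+ j / j`!%:R| <= C * `|t| ^+ N) ->
  `|int1 (fun t => k t * w 0 t) - c 0%N| <= 2 * C * D * e ^+ N.
Proof.
move=> N0 mk kM rD kc; have [_ _ _ r1 rm] := kr.
have D0 : 0 <= D by apply: le_trans (rD 0).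
have M0 : 0 <= M by apply: le_trans (kM 0).
have C0 : 0 <= C.
  have := kc e; rewrite gtr0_norm// lexx => /(_ isT) /(le_trans (normr_ge0 _)).
  by rewrite pmulr_lge0// exprn_gt0.
have bw : bdd_on (sball e) (e^-1 ^+ 1 * D) (w 0).
  by apply: chain_bdd; [exact: scaled_chain|exact: scaled_support|exact: scaled_le].
pose P N' (t : R) := \sum_(j < N') c j * t ^+ j / j`!%:R.
(* Terms are added one at a time: the first contributes [c 0], and every later one a vanishing
   moment. *)
have bP N' : (N' <= N)%N -> (exists B, bdd_on (sball e) B (fun t => P N' t * w 0 t)) /\
    int1 (fun t => P N' t * w 0 t) = if N' == 0%N then 0 else c 0%N.
  elim: N' => [|N' IH] lN.
    have z : (fun t => P 0%N t * w 0 t) = cst 0.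
      by apply/funext => t; rewrite /P big_ord0 mul0r.
    rewrite z; split; last by rewrite /int1 Rintegral_cst// mul0r.
    by exists 0; split => [|t|//]; [exact: measurable_cst|rewrite normr0].
  have [[B bB] IE] := IH (ltnW lN).
  have E : (fun t => P N'.+1 t * w 0 t) =
      (fun t => (c N' / N'`!%:R) * (t ^+ N' * w 0 t) + P N' t * w 0 t).
    by apply/funext => t; rewrite /P big_ord_recr /=; ring.
  have bm := moment_bdd N' (ltW e0) bw.
  split; first by rewrite E; eexists; exact: bdd_on_lin bm bB.
  rewrite E (int1_lin _ bm bB) IE scaled_moment /=.
  case: N' lN {IH bB E bm IE} => [|N'] lN /=.
    have -> : (fun t => t ^+ 0 * r 0%N t) = r 0%N by apply/funext => t; rewrite expr0 mul1r.
    by rewrite r1 fact0 expr0 divr1 !mulr1 addr0.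
  by rewrite rm ?mulr0 ?add0r.
have [[B bB] PE] := bP N (leqnn N).
rewrite (gtn_eqF N0) in PE.
have bk := bdd_on_mul mk (fun t _ => kM t) M0 bw.
have -> : int1 (fun t => k t * w 0 t) - c 0%N =
    int1 (fun t => (-1) * (P N t * w 0 t) + k t * w 0 t).
  by rewrite (int1_lin _ bB bk) PE mulN1r addrC.
have [mkP _ z0] := bdd_on_lin (-1) bB bk.
have bd : bdd_on (sball e) (C * e ^+ N * (e^-1 * D))
    (fun t => (-1) * (P N t * w 0 t) + k t * w 0 t).
  split => // t; have [te|nte] := pselect (`|t| <= e); last first.
    rewrite z0// normr0; apply: mulr_ge0; apply: mulr_ge0 => //.
      by rewrite exprn_ge0// ltW.
    by rewrite invr_ge0 ltW.
  have -> : -1 * (P N t * w 0 t) + k t * w 0 t = (k t - P N t) * w 0 t by ring.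
  rewrite normrM; apply: ler_pM => //; last first.
    by have [_ wD _] := bw; have := wD t; rewrite expr1.
  apply: le_trans (kc t te) _; apply: ler_wpM2l => //.
  by rewrite lerXn2r// nnegrE ltW.
apply: le_trans (int1_le (ltW e0) bd) _.
rewrite le_eqVlt; apply/orP; left; apply/eqP.
have en0 : e != 0 by rewrite lt0r_neq0.
by field.
Qed.

End Scaled.

End Kernels.

(** * Approximation by product kernels *)

Section TensorEstimate.
Variable R : realType.
Local Notation mR := (measurableTypeR R).
Local Notation T n := (n.-tuple mR).
Variables (w : R -> R) (e A : R).
Hypotheses (e0 : 0 <= e) (bw : bdd_on (@sball R e) A w).

Definition tset n (p : T n) (i : 'I_n) (t : R) : T n :=
  [tuple (if j == i then t else tnth p j) | j < n].

Lemma tset_cons0 n (p : T n) (a t : R) :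
  tset (@tcons R n (a, p)) ord0 t = @tcons R n (t, p).
Proof.
apply: eq_from_tnth => j; rewrite tnth_mktuple /tcons.
by case: (unliftP ord0 j) => [k ->|->]; rewrite ?tnthS ?tnth0.
Qed.

Lemma tset_consS n (p : T n) (a t : R) i :
  tset (@tcons R n (a, p)) (lift ord0 i) t = @tcons R n (a, tset p i t).
Proof.
apply: eq_from_tnth => j; rewrite tnth_mktuple /tcons.
by case: (unliftP ord0 j) => [k ->|->]; rewrite ?tnthS ?tnth0 ?tnth_mktuple.
Qed.

Definition tzero n : T n := [tuple (0 : R) | _ < n].

Lemma tcons0 n : @tcons R n (0, tzero n) = tzero n.+1.
Proof.
apply: eq_from_tnth => j; rewrite tnth_mktuple /tcons.
by case: (unliftP ord0 j) => [k ->|->]; rewrite ?tnthS ?tnth0 ?tnth_mktuple.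
Qed.

Definition tprod n (t : T n) : R := \prod_(i < n) w (tnth t i).

Lemma tprod_cons n (p : T n) (a : R) : tprod (@tcons R n (a, p)) = w a * tprod p.
Proof.
rewrite /tprod big_ord_recl /tcons tnth0; congr (_ * _).
by apply: eq_bigr => i _; rewrite tnthS.
Qed.

Lemma tprod_bdd n : tbdd e (A ^+ n) (@tprod n).
Proof.
have [mw wA w0] := bw; split.
- apply: measurable_prod => i _.
  exact: (measurableT_comp mw (measurable_tnth i)).
- move=> t; rewrite normr_prod -[X in A ^+ X]card_ord -prodr_const.
  by apply: ler_prod => i _; rewrite normr_ge0 wA.
- move=> t nt; apply: contrapT => /eqP /prodf_neq0 tp.
  apply: nt => i; apply: contrapT => ni.
  by have := tp i isT; rewrite w0// eqxx.
Qed.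

(** The variables are set to 0 one after the other. The first costs [eta]; the error left by the
    others is integrated against a kernel bounded by [A] on an interval of length [2 * e], which
    multiplies it by [A * (2 * e)]. Iteration gives the geometric sum. *)
Lemma tensor_estimate n (G : T n -> R) (M eta : R) :
  measurable_fun setT G -> (forall t, `|G t| <= M) -> 0 <= eta ->
  (forall i p, tbox e p ->
     `|int1 (fun t => G (tset p i t) * w t) - G (tset p i 0)| <= eta) ->
  `|tint (fun t => G t * tprod t) - G (tzero n)| <=
    eta * \sum_(i < n) (A * (2 * e)) ^+ i.
Proof.
have [mw wA w0] := bw; have A0 : 0 <= A by apply: le_trans (wA 0).
elim: n G M => [|n IH] G M mG GM eta0 Gw.
  rewrite tint0 big_ord0 mulr0 /tprod big_ord0 mulr1.
  by rewrite (tuple0 (tzero 0)) subrr normr0.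
have M0 : 0 <= M by apply: le_trans (GM (tzero _)).
have bF : tbdd e (M * A ^+ n.+1) (fun t => G t * tprod t).
  exact: (bdd_on_mul mG (fun t _ => GM t) M0 (tprod_bdd n.+1)).
rewrite (tintS e0 bF).
pose S := \sum_(i < n) (A * (2 * e)) ^+ i.
have S0 : 0 <= S by apply: sumr_ge0 => i _; rewrite exprn_ge0// !mulr_ge0.
have mcons (p : T n) : measurable_fun [set: mR] (fun a : mR => @tcons R n (a, p)).
  exact: (measurable_cons (f := id) (g := fun=> p)).
have mconsr (a : mR) : measurable_fun [set: T n] (fun p : T n => @tcons R n (a, p)).
  exact: (measurable_cons (f := fun=> a) (g := id)).
pose I a := tint (fun p : T n => G (@tcons R n (a, p)) * tprod p).
have IE a : tint (fun p : T n => G (@tcons R n (a, p)) * tprod (@tcons R n (a, p)))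
    = w a * I a.
  have b1 := bdd_on_mul (measurableT_comp mG (mconsr a)) (fun t _ => GM _) M0 (tprod_bdd n).
  rewrite /I /tint -RintegralZl//; last exact: (tbdd_integrable b1).
  by congr (Rintegral _ _ _); apply/funext => p; rewrite tprod_cons; ring.
have bI := tbdd_sectionT e0 bF.
have bG0 : bdd_on (@sball R e) (M * A) (fun a : mR => G (@tcons R n (a, tzero n)) * w a).
  exact: (bdd_on_mul (measurableT_comp mG (mcons (tzero n))) (fun t _ => GM _) M0 bw).
have dI a : `|a| <= e -> `|I a - G (@tcons R n (a, tzero n))| <= eta * S.
  move=> ae; apply: (IH (fun p => G (@tcons R n (a, p))) M) => //.
    exact: (measurableT_comp mG (mconsr a)).
  move=> i p pb.
  have := Gw (lift ord0 i) (@tcons R n (a, p)); rewrite tset_consS.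
  under [X in int1 X]eq_fun do rewrite tset_consS.
  apply => j; rewrite /tcons.
  by case: (unliftP ord0 j) => [k ->|->]; rewrite ?tnthS ?tnth0.
have bD : bdd_on (@sball R e) (A * (eta * S))
    (fun a : mR => (-1) * (G (@tcons R n (a, tzero n)) * w a) +
       tint (fun p : T n => G (@tcons R n (a, p)) * tprod (@tcons R n (a, p)))).
  have [mD _ D0] := bdd_on_lin (-1) bG0 bI; split => // a.
  have [ae|nae] := pselect (`|a| <= e); last by rewrite D0// normr0 !mulr_ge0.
  rewrite IE (_ : _ + _ = w a * (I a - G (@tcons R n (a, tzero n)))); last by ring.
  by rewrite normrM; apply: ler_pM => //; exact: dI.
have -> : \int[@lebesgue_measure R]_a tint (fun t : T n =>
      G (@tcons R n (a, t)) * tprod (@tcons R n (a, t))) - G (tzero n.+1) =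
   int1 (fun a : mR => (-1) * (G (@tcons R n (a, tzero n)) * w a) +
       tint (fun p : T n => G (@tcons R n (a, p)) * tprod (@tcons R n (a, p)))) +
   (int1 (fun a : mR => G (@tcons R n (a, tzero n)) * w a) - G (tzero n.+1)).
  by rewrite (int1_lin (-1) bG0 bI) /int1; ring.
apply: le_trans (ler_normD _ _) _.
rewrite big_ord_recl expr0 mulrDr mulr1 addrC; apply: lerD.
  have := Gw ord0 (tzero n.+1); rewrite -tcons0 tset_cons0.
  under [X in int1 X]eq_fun do rewrite tset_cons0.
  by apply => j; rewrite tcons0 tnth_mktuple normr0.
apply: le_trans (int1_le e0 bD) _.
rewrite le_eqVlt; apply/orP; left; apply/eqP.
under [in RHS]eq_bigr do rewrite lift0 exprS.
by rewrite -mulr_sumr -/S; ring.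
Qed.

End TensorEstimate.

Section ProductKernel.
Variables (R : realType) (n : nat).
Local Notation Rn := 'rV[R]_n.
Local Notation normc := Normc.normc.
Variables (w : nat -> R -> R) (dw : derivative_chain w).
Implicit Types (m : 'I_n -> nat) (s : seq 'I_n).

(** The orders [m i] are parameters because partial derivatives of a product kernel are again
    product kernels, with these orders increased. *)
Definition product_kernel m (z : Rn) : R := \prod_(i < n) w (m i) (z ord0 i).

Lemma product_kernel_is_derive m (z : Rn) j :
  is_derive z 'e_j (product_kernel m)
    (product_kernel (fun i => m i + (i == j))%N z).
Proof.
apply: is_derive_line0.
pose P := \prod_(i < n | i != j) w (m i) (z ord0 i).
have -> : (fun s : R => product_kernel m (z + s *: 'e_j)) =
    (fun s : R => P * w (m j) (1 * s + z ord0 j)).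
  apply/funext => s; rewrite /product_kernel (bigD1 j)//= !mxE !eqxx mulr1.
  rewrite mulrC mul1r [s + _]addrC; congr (_ * _).
  by apply: eq_bigr => i ij; rewrite !mxE (negbTE ij) andbF mulr0 addr0.
have H : is_derive (0 : R) 1 (fun s : R => 1 * s + z ord0 j) (1 : R).
  apply: (is_derive_eq (is_deriveD (is_deriveZ (1 : R) (is_derive_id (0 : R) (1 : R)))
     (is_derive_cst (z ord0 j) (0 : R) (1 : R)))).
  by rewrite /GRing.scale /=; ring.
have H2 := @is_derive1_comp R (w (m j)) (fun x => 1 * x + z ord0 j) 0 _ _ (dw (m j) _) H.
apply: (is_derive_eq (is_deriveZ P H2)).
rewrite /GRing.scale /= mulr1 mulr0 add0r /product_kernel [RHS](bigD1 j)//= eqxx addn1 mulrC.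
by congr (_ * _); apply: eq_bigr => i ij; rewrite (negbTE ij) addn0.
Qed.

Lemma partial_product_kernel s m :
  partial_word s (product_kernel m) = product_kernel (fun i => m i + count_mem i s)%N.
Proof.
elim: s => [|j s IH] /=.
  by congr product_kernel; apply/funext => i; rewrite addn0.
rewrite IH; apply/funext => z.
have [_ ->] := product_kernel_is_derive (fun i => m i + count_mem i s)%N z j.
by congr (product_kernel _ z); apply/funext => i;
  rewrite -addnA [(count_mem _ _ + _)%N]addnC eq_sym.
Qed.

Lemma continuous_product_kernel m : continuous (product_kernel m).
Proof.
have cw i : continuous (fun z : Rn => w (m i) (z ord0 i)).
  move=> z; apply: (@continuous_comp _ _ _ (fun z : Rn => z ord0 i) (w (m i))).
    apply: continuous_nonexpansive => x y.
    by have := rv_norm_ge (x - y) i; rewrite !mxE.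
  exact: chain_continuous.
rewrite /product_kernel; elim: (index_enum 'I_n) => [|i l IH] z.
  have -> : (fun z : Rn => \prod_(i <- [::]) w (m i) (z ord0 i)) = fun=> 1.
    by apply/funext => y; rewrite big_nil.
  exact: cst_continuous.
have -> : (fun z : Rn => \prod_(i <- i :: l) w (m i) (z ord0 i)) =
   fun z => w (m i) (z ord0 i) * \prod_(i <- l) w (m i) (z ord0 i).
  by apply/funext => y; rewrite big_cons.
have E := cvgM (cw i z) (IH z); exact: E.
Qed.

Lemma smooth_product_kernel m : smoothR setT (product_kernel m).
Proof.
move=> s z _; rewrite partial_product_kernel; split.
  exact: continuous_product_kernel.
by move=> i; have [] := product_kernel_is_derive (fun i => m i + count_mem i s)%N z i.
Qed.

Definition kernel_test (z : Rn) : R[i] := (product_kernel (fun=> 0%N) z)%:C.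

Lemma smooth_kernel_test : smooth setT kernel_test.
Proof. by split; [exact: smooth_product_kernel|exact: smoothR_cst]. Qed.

Lemma cpartial_kernel_test s z :
  cpartial s kernel_test z = (product_kernel (fun i => count_mem i s) z)%:C.
Proof.
apply: complex_ext => /=; last exact: partial_word_cst0.
by rewrite -[X in partial_word s X]/(product_kernel (fun=> 0%N)) partial_product_kernel.
Qed.

Variable e : R.
Hypothesis (e0 : 0 < e) (w0 : forall j x, ~ (`|x| <= e) -> w j x = 0).

Lemma product_kernel_out m z : ~ (`|z| <= e) -> product_kernel m z = 0.
Proof.
move=> nz; apply: contrapT => /eqP /prodf_neq0 tp.
apply: nz; apply: rv_norm_le; first exact: ltW.
move=> i; apply: contrapT => ni.
by have := tp i isT; rewrite w0// eqxx.
Qed.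

Lemma testfun_kernel : testfun setT kernel_test /\
  supp kernel_test `<=` [set z | `|z| <= e].
Proof.
apply: (testfun_intro smooth_kernel_test (@compact_norm_ball R n e)) => // z nz.
by rewrite /kernel_test product_kernel_out.
Qed.

(** Each factor contributes one power of [e^-1] more than its order of differentiation. The
    exponents therefore add up to the length of the word plus [n], and [e <= 1] allows the length to
    be replaced by [c]. *)
Lemma seminorm_kernel c (D : R) : 0 <= D -> e <= 1 ->
  (forall j x, (j <= c)%N -> `|w j x| <= e^-1 ^+ j.+1 * D) ->
  seminorm setT c kernel_test <= e^-1 ^+ (c + n) * D ^+ n.
Proof.
move=> D0 e1 wD; have ei1 : 1 <= e^-1 by rewrite invf_ge1.
have ei0 : 0 <= e^-1 by rewrite invr_ge0 ltW.
apply: seminorm_le; first by rewrite mulr_ge0// exprn_ge0.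
move=> s z sc _; rewrite cpartial_kernel_test normc_real normr_prod.
have cs i : (count_mem i s <= c)%N by apply: leq_trans sc; exact: count_size.
apply: (@le_trans _ _ (\prod_(i < n) (e^-1 ^+ (count_mem i s).+1 * D))).
  by apply: ler_prod => i _; rewrite normr_ge0 wD.
rewrite big_split /= prodr_const card_ord; apply: ler_wpM2r; first exact: exprn_ge0.
have E : (\sum_(i < n) (count_mem i s).+1 = size s + n)%N.
  under eq_bigr do rewrite -addn1.
  rewrite big_split /= sum_nat_const card_ord muln1 -(mi_size_of s) /mi_size.
  by congr (_ + _)%N; apply: eq_bigr => i _; rewrite ffunE.
by rewrite prodrXr E; apply: ler_weXn2l => //; rewrite leq_add2r.
Qed.


End ProductKernel.

(** * Regularization of smooth functions, with derivatives on the function *)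

Section ConvolutionDerivative.
Variables (R : realType) (n : nat).
Local Notation Rn := 'rV[R]_n.
Local Notation C := R[i].
Local Notation normc := Normc.normc.
Variables (U : set Rn) (phi : Rn -> C).
Hypotheses (oU : open U) (tp : testfun setT phi).
Implicit Types (g : Rn -> C).

(** The regularization of [g] at [x] after the substitution y = x + z. In this form derivatives in
    [x] fall on [g] instead of [phi], which is needed for approximation with all derivatives. *)
Definition correlate g (x : Rn) : C := integralRn (fun z => g (x + z) * phi z).

Lemma ccont_correlate g x r : smooth U g -> Udom U phi x ->
  (forall z, supp phi z -> `|z| <= r) ->
  ccont_on_ball r (fun z => g (x + z) * phi z).
Proof.
move=> sg [_ xU] pr; have [sp cp _] := tp.
have H : (fun z => g (x + z) * phi z) = (fun z => (fun y => g (y - (- x))) z * phi z).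
  by apply/funext => z; rewrite opprK addrC.
rewrite H; apply: (@ccont_mul _ _ [set z | U (z - - x)]) => //.
  exact: smooth_translate.
by split => // z /xU; rewrite /= opprK addrC.
Qed.

(** The Taylor remainder of [g] is at most [M * s ^+ 2] for each part, uniformly over the compact
    set that contains all points [x + z] and their small displacements. Integrated against [phi] it
    remains quadratic in [s]. *)
Lemma correlate_is_derive b g x i : smooth U g -> Udom U phi x ->
  is_derive x 'e_i (fun x => cpart b (correlate g x))
    (cpart b (correlate (cpartial [:: i] g) x)).
Proof.
move=> sg Ux; apply: is_derive_line0.
have [r [K [r0 cK KU rP]]] := Udom_nbhs oU tp Ux.
have [_ cp _] := tp; have [q q0 qP] := compact_in_ball cp.
have [M M0 MP] := smooth_compact_bounded 2 KU cK sg.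
have [P P0 PP] := testfun_bounded 0 tp.
apply: (is_derive_quadratic (c := 2 * (2 * M * P) * (2 * q) ^+ n) r0) => s sr.
have xs : `|x - (x + s *: 'e_i)| <= r.
  rewrite opprD addrA subrr add0r normrN normrZ; apply: le_trans sr.
  by rewrite -[leRHS]mulr1; apply: ler_wpM2l => //; exact: norm_delta_le1.
have [Us _] := rP _ xs.
have sdg := smooth_cpartial [:: i] sg.
have c1 := ccont_correlate sg Us qP; have c0 := ccont_correlate sg Ux qP.
have cd := ccont_correlate sdg Ux qP.
have [c01 E01] : ccont_on_ball q (fun z => -1 * (g (x + z) * phi z) + g (x + s *: 'e_i + z) * phi z)
   /\ integralRn (fun z => -1 * (g (x + z) * phi z) + g (x + s *: 'e_i + z) * phi z) =
      - correlate g x + correlate g (x + s *: 'e_i).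
  split; last by rewrite (integralRn_lin (-1) q0 c0 c1) mulN1r.
  move=> b'; have := cont_on_ball_lin (-1) (c0 b') (c1 b').
  by under [X in cont_on_ball _ X]eq_fun do
    rewrite mulN1r -cpartN -cpartD -mulN1r.
have Ed := integralRn_lin (- s%:C) q0 cd c01.
rewrite E01 in Ed.
have cq : ccont_on_ball q (fun z => - s%:C * (cpartial [:: i] g (x + z) * phi z) +
     (-1 * (g (x + z) * phi z) + g (x + s *: 'e_i + z) * phi z)).
  move=> b'; have := cont_on_ball_lin (- s) (cd b') (c01 b').
  by under [X in cont_on_ball _ X]eq_fun do
    rewrite -cpart_scale -cpartD rmorphN.
rewrite scale0r addr0.
rewrite (_ : _ - _ - _ = cpart b (integralRn
   (fun z => - s%:C * (cpartial [:: i] g (x + z) * phi z) +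
     (-1 * (g (x + z) * phi z) + g (x + s *: 'e_i + z) * phi z)))); last first.
  by rewrite Ed !cpartD -rmorphN cpart_scale cpartN /correlate; ring.
apply: le_trans (cpart_le _ _) _.
apply: le_trans (integralRn_le (M := 2 * M * s ^+ 2 * P) q0 cq _) _; last first.
  by rewrite le_eqVlt; apply/orP; left; apply/eqP; ring.
move=> z; have [pz|npz] := pselect (supp phi z); last first.
  rewrite (notsupp npz) !mulr0 !addr0 Normc.normc0.
  by apply: mulr_ge0 => //; apply: mulr_ge0; [exact: mulr_ge0|exact: sqr_ge0].
rewrite (_ : _ + _ = (- s%:C * cpartial [:: i] g (x + z) +
     (-1 * g (x + z) + g (x + s *: 'e_i + z))) * phi z); last by ring.
rewrite Normc.normcM; apply: ler_pM; rewrite ?normc_ge0//; last first.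
  by have := PP [::] z isT; rewrite cpartial_nil.
apply: le_trans (normc_le_parts _) _.
rewrite -[X in `|X| + _]/(cpart true _) -[X in _ + `|X|]/(cpart false _).
rewrite -mulrA mulrDl mul1r.
have H b' : `|cpart b' (- s%:C * cpartial [:: i] g (x + z) +
    (-1 * g (x + z) + g (x + s *: 'e_i + z)))| <= M * s ^+ 2.
  pose k := fun y => cpart b' (g y).
  have Kz (s' : R) : `|s'| <= `|s| -> K (x + z + s' *: 'e_i).
    move=> ss'; rewrite addrAC.
    have [_] : Udom U phi (x + s' *: 'e_i) /\
        forall y, supp phi y -> K (x + s' *: 'e_i + y).
      apply: rP; rewrite opprD addrA subrr add0r normrN normrZ.
      apply: le_trans (le_trans ss' sr).
      by rewrite -[leRHS]mulr1; apply: ler_wpM2l => //; exact: norm_delta_le1.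
    exact.
  have sk : smoothR U k by exact: smooth_cpart.
  have H : `|k (x + z + s *: 'e_i) - (k (x + z) + s * partial_word [:: i] k (x + z))|
      <= M * s ^+ 2.
    apply: (taylor_line2 sk) => [s' h|s' h]; first exact: KU _ (Kz s' h).
    rewrite /k -cpart_cpartial; apply: le_trans (cpart_le _ _) _.
    by apply: MP => //; exact: Kz.
  apply: le_trans H.
  rewrite le_eqVlt; apply/orP; left; apply/eqP; congr (`|_|).
  rewrite -rmorphN mulN1r !cpartD cpart_scale cpartN [x + s *: _ + _]addrAC.
  by rewrite /k -cpart_cpartial; ring.
by apply: lerD; exact: H.
Qed.

Lemma correlate_cpartial s g x : smooth U g -> Udom U phi x ->
  cpartial s (correlate g) x = correlate (cpartial s g) x.
Proof.
move=> sg; elim: s x => [|i s IH] x Ux; first by rewrite !cpartial_nil.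
have oD : open (Udom U phi) := Udom_open oU tp.
have sgs := smooth_cpartial s sg.
have H b : 'D_('e_i) (fun x => cpart b (cpartial s (correlate g) x)) x =
    cpart b (correlate (cpartial (i :: s) g) x).
  rewrite (@near_eq_derive _ _ _ _ (fun x => cpart b (correlate (cpartial s g) x))).
    by have [_ ->] := correlate_is_derive b i sgs Ux; rewrite -cpartial_cat.
  near=> y; rewrite IH//.
  by near: y; exact: (open_nbhs_nbhs (conj oD Ux)).
by apply: complex_ext; [exact: (H true)|exact: (H false)].
Unshelve. all: by end_near. Qed.

End ConvolutionDerivative.

Section Approximation.
Variables (R : realType) (n N : nat) (r : nat -> R -> R) (e D : R).
Local Notation Rn := 'rV[R]_n.
Local Notation C := R[i].
Local Notation normc := Normc.normc.
Hypotheses (N0 : (0 < N)%N) (kr : kernel N r) (e0 : 0 < e)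
  (rD : forall x, `|r 0%N x| <= D).
Local Notation w := (scaled_kernel r e).
Local Notation phi := (@kernel_test R n w).
Let dw : derivative_chain w := @scaled_chain R N r e kr.
Let w0 j x : ~ (`|x| <= e) -> w j x = 0 := @scaled_support R N r e kr e0 j x.

(** The geometric sum of [tensor_estimate] for kernels of height [A = e^-1 * D]: then
    [A * (2 * e) = 2 * D], so it does not depend on [e]. *)
Definition approx_constant : R := \sum_(i < n) (2 * D) ^+ i.

Lemma approx_constant_ge0 : 0 <= approx_constant.
Proof.
have D0 : 0 <= D by exact: le_trans (rD 0).
by apply: sumr_ge0 => i _; rewrite exprn_ge0// mulr_ge0.
Qed.

(* The kernel is supported in the ball of radius [e], so the factor [cutoff] does
   not change the integrand; it makes the other factor globally continuous and bounded. *)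
Definition cutoff (z : Rn) : R :=
  2^-1 * (`|(2 - e^-1 * `|z|)| - `|(1 - e^-1 * `|z|)| + 1).

Lemma continuous_cutoff : continuous cutoff.
Proof.
move=> z.
have cz c : {for z, continuous (fun z : Rn => c - e^-1 * `|z|)}.
  have E := cvgB (cvg_cst c) (cvgM (cvg_cst (e^-1)) (@norm_continuous _ _ z)).
  exact: E.
have cn c : {for z, continuous (fun z : Rn => `|(c - e^-1 * `|z|)|)}.
  have E := cvg_norm (cz c); exact: E.
have E := cvgM (cvg_cst (2^-1 : R)) (cvgD (cvgB (cn 2) (cn 1)) (cvg_cst (1 : R))).
exact: E.
Qed.

Lemma cutoff1 z : `|z| <= e -> cutoff z = 1.
Proof.
move=> ze; have h : e^-1 * `|z| <= 1 by rewrite mulrC ler_pdivrMr// mul1r.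
by rewrite /cutoff (ger0_norm (_ : 0 <= 2 - _)) ?(ger0_norm (_ : 0 <= 1 - _)); lra.
Qed.

Lemma cutoff_out z : ~ (`|z| <= 2 * e) -> cutoff z = 0.
Proof.
move=> /negP; rewrite -ltNge => ze.
have h : 2 <= e^-1 * `|z| by rewrite mulrC ler_pdivlMr// ltW.
by rewrite /cutoff (ler0_norm (_ : 2 - _ <= 0)) ?(ler0_norm (_ : 1 - _ <= 0)); lra.
Qed.

Lemma row_of_tset p i (t : R) :
  row_of_tuple (tset p i t) = row_of_tuple (tset p i 0) + t *: ('e_i : Rn).
Proof.
apply/rowP => j; rewrite !mxE !tnth_mktuple eqxx /=.
by case: eqP => _; rewrite ?mulr1 ?mulr0 ?add0r ?addr0.
Qed.

(** [kernel_estimate] provides the one-variable error [2 * M * D * e ^+ N] for [tensor_estimate].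
    Since one coordinate is treated at a time, the only derivatives to be bounded are the pure ones
    of order [N]. The radius [2 * e] leaves room for the cutoff, and the outer factor 2 is for the
    two parts of [g]. *)
Lemma kernel_approximation (U : set Rn) (g : Rn -> C) (x : Rn) (M : R) :
  0 <= M -> smooth U g -> (forall z, `|z| <= 2 * e -> U (x + z)) ->
  (forall i z, `|z| <= e -> normc (cpartial (nseq N i) g (x + z)) <= M) ->
  normc (correlate phi g x - g x) <= 2 * (2 * M * D * e ^+ N * approx_constant).
Proof.
move=> M0 sg xU gM.
have en0 : e != 0 by rewrite lt0r_neq0.
have D0 : 0 <= D by exact: le_trans (rD 0).
have bw : bdd_on (sball e) (e^-1 ^+ 1 * D) (w 0%N).
  by apply: chain_bdd => //; [exact: w0|exact: scaled_le].
have part b : `|cpart b (correlate phi g x) - cpart b (g x)| <=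
    2 * M * D * e ^+ N * approx_constant.
  pose k y := cpart b (g y).
  have sk : smoothR U k by exact: smooth_cpart.
  pose h z := k (x + z) * cutoff z.
  have ch : continuous h.
    apply: (@continuous_mul_supp _ _ [set z | U (x + z)] [set z | `|z| <= 2 * e]).
    - move=> z Uz; apply: (@continuous_comp _ _ _ (fun z => x + z) k).
        exact: (cvgD (cvg_cst _) cvg_id).
      by have [] := sk [::] _ Uz.
    - exact: continuous_cutoff.
    - exact: compact_closedRn (@compact_norm_ball _ _ _).
    - exact: xU.
    - exact: cutoff_out.
  have hb : cont_on_ball (2 * e) h.
    by split => // z nz; rewrite /h cutoff_out// mulr0.
  have [B B0 hB] := cont_on_ball_bounded hb.
  pose G := h \o @row_of_tuple R n.
  have mG : measurable_fun setT G by exact: measurable_row_continuous.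
  have zero_row : row_of_tuple (tzero R n) = 0.
    by apply/rowP => j; rewrite !mxE tnth_mktuple.
  have E1 : cpart b (correlate phi g x) = tint (fun t => G t * tprod (w 0%N) t).
    have -> : cpart b (correlate phi g x) =
        cint (fun z => cpart b (g (x + z) * phi z)).
      by rewrite /correlate; case: (b); rewrite integralRnE.
    rewrite /cint; congr tint; apply/funext => t /=; rewrite /G /= /h.
    have -> : tprod (w 0%N) t = product_kernel w (fun=> 0%N) (row_of_tuple t).
      by apply: eq_bigr => i _; rewrite mxE.
    rewrite /kernel_test mulrC cpart_scale -/(k _) mulrC.
    have [te|nte] := pselect (`|row_of_tuple t| <= e); first by rewrite cutoff1// mulr1.
    by rewrite (product_kernel_out e0 w0 _ nte) !mulr0.
  have E2 : cpart b (g x) = G (tzero R n).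
    by rewrite /G /= zero_row /h addr0 cutoff1 ?normr0 ?ltW// mulr1.
  rewrite E1 E2.
  have eta0 : 0 <= 2 * M * D * e ^+ N by rewrite !mulr_ge0// exprn_ge0// ltW.
  apply: le_trans (tensor_estimate (ltW e0) bw mG (fun t => hB _) eta0 _) _; last first.
    rewrite le_eqVlt; apply/orP; left; apply/eqP; congr (_ * _).
    by apply: eq_bigr => i _; congr (_ ^+ _); rewrite expr1; field.
  (* At [x0] the [i]-th displacement is reset to 0. For [|t| <= e] the cutoff is 1, so [G] along
     this coordinate is [k] on the line through [x0], and Taylor's formula on that line applies. *)
  move=> i p pb; pose x0 := x + row_of_tuple (tset p i 0).
  have mset : measurable_fun [set: measurableTypeR R] (fun t : measurableTypeR R => tset p i t).
    apply/measurable_fun_tnthP => j.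
    rewrite (_ : _ \o _ = fun t : measurableTypeR R => if j == i then t else tnth p j).
      by case: eqP => _; [exact: measurable_id|exact: measurable_cst].
    by apply/funext => t /=; rewrite tnth_mktuple.
  have pe (t : R) : `|t| <= e -> `|row_of_tuple (tset p i t)| <= e.
    move=> te; apply: rv_norm_le; first exact: ltW.
    by move=> j; rewrite mxE tnth_mktuple; case: eqP => // _; exact: pb.
  have Gt (t : R) : `|t| <= e -> G (tset p i t) = k (x0 + t *: 'e_i).
    move=> te; rewrite /G /= /h cutoff1; last exact: pe.
    by rewrite mulr1 row_of_tset /x0 addrA.
  have x0E t : x0 + t *: 'e_i = x + row_of_tuple (tset p i t).
    by rewrite [in RHS]row_of_tset /x0 addrA.
  have G0 : G (tset p i 0) = k x0.
    by rewrite Gt ?scale0r ?addr0// normr0 ltW.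
  have := kernel_estimate (k := fun t => G (tset p i t))
    (c := fun j => partial_word (nseq j i) k x0) kr e0 N0 (measurableT_comp mG mset)
    (fun t => hB _) rD (C := M).
  rewrite G0; apply => t te.
  rewrite Gt//; apply: (taylor_line sk (r := e)) => // s' se.
    by rewrite x0E; apply: xU; apply: le_trans (pe _ se) _; rewrite ler_pMl// ler1n.
  rewrite x0E /k -cpart_cpartial; apply: le_trans (cpart_le _ _) _.
  by apply: gM; exact: pe.
apply: le_trans (normc_le_parts _) _; rewrite mulrDl mul1r cReD cImD cReN cImN.
by apply: lerD; [exact: (part true)|exact: (part false)].
Qed.


End Approximation.

(** The part free of z vanishes, so each remaining monomial contains z, and z^k <= z on [0, 1]. [A]
    is the sum of all coefficients and [q] bounds the degrees in y. *)
Lemma I0_eval_bound (R : realType) (l : {poly {poly R}}) : I0 l ->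
  exists A q, 0 <= A /\ forall y z Y : R, 1 <= Y -> 0 <= y -> y <= Y -> 0 <= z -> z <= 1 ->
    eval2 l y z <= A * Y ^+ q * z.
Proof.
move=> [lp l0].
pose sz (k : nat) : nat := size (l`_k : {poly R}).
pose q := (\max_(k < size l) sz k)%N.
pose A := \sum_(k < size l) \sum_(j < size (l`_k : {poly R})) (l`_k : {poly R})`_j.
exists A, q; split.
  by apply: sumr_ge0 => k _; apply: sumr_ge0 => j _; exact: lp.
move=> y z Y Y1 y0 yY z0 z1; rewrite /eval2 (horner_coef l) horner_sum /A !mulr_suml.
apply: ler_sum => k _.
rewrite hornerM horner_exp hornerC.
(* The coefficient of z^0 is the polynomial lambda(y, 0), which is zero. *)
case: k => -[|k] /= kl.
  have -> : (l`_0 : {poly R}) = 0 by rewrite -horner_coef0.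
  rewrite horner0 mul0r !mulr_ge0// ?exprn_ge0//; last by rewrite (le_trans _ Y1).
  by apply: sumr_ge0 => j _; rewrite coef0.
have zk : z ^+ k.+1 <= z.
  by rewrite exprS -[leRHS]mulr1 ler_wpM2l// exprn_ile1.
have lk0 (j : nat) : 0 <= (l`_k.+1 : {poly R})`_j := lp k.+1 j.
apply: ler_pM => //; rewrite ?exprn_ge0//.
  by rewrite horner_coef; apply: sumr_ge0 => j _; rewrite mulr_ge0// exprn_ge0.
rewrite horner_coef mulr_suml; apply: ler_sum => j _.
apply: ler_wpM2l => //; apply: (@le_trans _ _ (Y ^+ j)).
  by rewrite lerXn2r// nnegrE (le_trans y0).
apply: ler_weXn2l => //; apply: leq_trans (ltnW (ltn_ord j)) _.
exact: (@leq_bigmax _ (fun k : 'I_(size l) => sz k) (Ordinal kl)).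
Qed.
(** * Vanishing of distributions with negligible image *)

Section NegligibleKernel.
Variables (R : realType) (n : nat).
Local Notation Rn := 'rV[R]_n.
Local Notation C := R[i].
Local Notation normc := Normc.normc.
Implicit Types (f : Rn -> C) (phi : Rn -> C).

Lemma iota_correlate (U : set Rn) f phi y : open U -> smooth U f -> testfun setT phi ->
  Udom U phi y -> iota_c (dist_of_fun f) phi y = correlate phi f y.
Proof.
move=> oU sf tp Uy; have ts := shift_testfun tp Uy.
have [_ cs _] := ts; have [q q0 qP] := compact_in_ball cs.
rewrite /iota_c /dist_of_fun -(integralRn_translate y q0 (ccont_mul sf ts qP)).
by congr integralRn; apply/funext => z; rewrite /shift_test addrK [z + y]addrC.
Qed.

(** The quantities under the supremum are derivatives of [correlate phi f - f]. They fall on [f], so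
    [kernel_approximation] applies to [cpartial s f]; at most [c + N] derivatives of [f] on [L]
    occur, and boundedness of [B] makes the estimate uniform in [f]. *)
Lemma delta_seminorm_kernel (U K L : set Rn) (B : set (Rn -> C)) (c N : nat)
    (r : nat -> R -> R) (e D M : R) :
  open U -> compact L -> L `<=` U -> (0 < N)%N -> kernel N r -> 0 < e ->
  (forall x, `|r 0%N x| <= D) -> 0 <= M ->
  (forall x z, K x -> `|z| <= 2 * e -> L (x + z)) ->
  (forall f, B f -> smooth U f) -> (forall f, B f -> seminorm L (c + N) f <= M) ->
  delta_seminorm K c B (@kernel_test R n (scaled_kernel r e)) <=
    2 * (2 * M * D * e ^+ N * approx_constant n D).
Proof.
move=> oU cL LU N0 kr e0 rD M0 KL Bs BM.
have D0 : 0 <= D by exact: le_trans (rD 0).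
set phi := kernel_test _.
have [tp sp] : testfun setT phi /\ supp phi `<=` [set z | `|z| <= e].
  apply: testfun_kernel => //; [exact: scaled_chain kr|exact: (scaled_support kr)].
have b0 : 0 <= 2 * (2 * M * D * e ^+ N * approx_constant n D).
  rewrite mulr_ge0// mulr_ge0 ?(approx_constant_ge0 n rD)//.
  by rewrite !mulr_ge0// exprn_ge0// ltW.
rewrite /delta_seminorm; set S := (X in sup X).
have [->|/set0P S0] := eqVneq S set0; first by rewrite sup0.
apply: ge_sup => // _ [x [a [f [Kx ac Bf ->]]]].
have Ux : Udom U phi x.
  split=> [|z /sp /= ze]; apply: LU.
    by rewrite -[x]addr0; apply: KL => //; rewrite normr0 mulr_ge0// ltW.
  by apply: KL => //; apply: le_trans ze _; rewrite ler_pMl// ler1n.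
have sf := Bs f Bf; rewrite !partialE; set s := canonical_word a.
have sc : (size s <= c)%N by rewrite size_canonical_word.
rewrite -(partial_iota_fun oU s sf tp Ux).
rewrite (cpartial_eq_on s (g := correlate phi f) (Udom_open oU tp) _ Ux); last first.
  by move=> y Uy; exact: iota_correlate Uy.
rewrite (correlate_cpartial oU tp s sf Ux).
apply: (kernel_approximation N0 kr e0 rD M0 (smooth_cpartial s sf)).
  by move=> z ze; apply: LU; exact: KL.
move=> i z ze; rewrite -cpartial_cat; apply: le_trans (BM f Bf).
apply: (cpartial_le_seminorm oU cL LU sf).
  by rewrite size_cat size_nseq addnC leq_add2r.
by apply: KL => //; apply: le_trans ze _; rewrite ler_pMl// ler1n.
Qed.

Lemma delta_seminorm_ge0 (K : set Rn) c (B : set (Rn -> C)) phi :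
  0 <= delta_seminorm K c B phi.
Proof.
rewrite /delta_seminorm; set S := (X in sup X).
have [->|/set0P[z Sz]] := eqVneq S set0; first by rewrite sup0.
have [[M MP]|nb] := pselect (has_ubound S); last first.
  by rewrite sup_out// => -[_].
apply: le_trans (_ : z <= _); last by apply: ub_le_sup => //; exists M.
by move: Sz => [x [a [f [_ _ _ ->]]]]; exact: normc_ge0.
Qed.

(** The bound is taken at least 1 so that the resulting bound of the kernel's seminorm is at least
    1, as [I0_eval_bound] demands. *)
Lemma chain_bounded_upto (r : nat -> R -> R) N c : kernel N r ->
  exists2 D, 1 <= D & forall j x, (j <= c)%N -> `|r j x| <= D.
Proof.
move=> [dr r0 _ _ _].
have /choice[D DP] : forall j, exists D, 0 <= D /\ forall x, `|r j x| <= D.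
  by move=> j; have [D ? ?] := chain_bounded dr (r0 j); exists D.
exists (1 + \sum_(j < c.+1) D j).
  by rewrite lerDl sumr_ge0// => j _; have [] := DP j.
move=> j x jc; have [D0 Dx] := DP j; apply: le_trans (Dx x) _.
rewrite (bigD1 (Ordinal (jc : j < c.+1)%N))//= addrCA lerDl addr_ge0// sumr_ge0// => k _.
by have [] := DP k.
Qed.

Lemma expr_inv_le (e : R) (a N : nat) : 0 < e -> e <= 1 -> (a < N)%N ->
  e^-1 ^+ a * e ^+ N <= e.
Proof.
move=> e0 e1 aN; rewrite -(subnKC aN) addSn exprS exprD mulrCA -[leRHS]mulr1.
apply: ler_wpM2l; first exact: ltW.
rewrite mulrA -exprMn mulVf ?lt0r_neq0// expr1n mul1r.
by rewrite exprn_ile1// ltW.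
Qed.

(** The radius [d] and the threshold [N0] depend on the point alone; [N], the kernel and [eta] come
    afterwards. This order lets one kernel be used for a finite cover. *)
Lemma negligible_kernel (Om : set Rn) (u : (Rn -> C) -> C) (x0 : Rn) :
  open Om -> is_distribution Om u -> c_negligible Om (iota_c u) -> Om x0 ->
  exists2 d : R, 0 < d & exists N0 : nat, forall N r, (N0 <= N)%N -> (0 < N)%N ->
    kernel N r -> forall eta : R, 0 < eta -> exists2 e1 : R, 0 < e1 &
    forall e x, 0 < e -> e < e1 -> `|x0 - x| <= d ->
      normc (iota_c u (@kernel_test R n (scaled_kernel r e)) x) <= eta.
Proof.
move=> oO ud [_ neg] Ox0; have [U [oU Ux0 UO UP]] := neg x0 Ox0.
have /(nbhs_ballP x0)[q /= q0 qU] := open_nbhs_nbhs (conj oU Ux0).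
have {q q0 qU} [q q0 qU] : exists2 q : R, 0 < q & forall x, `|x0 - x| < q -> U x.
  by exists q => // x xq; apply: qU; rewrite -ball_normE.
(* [K] and [L] are the closed balls of radius [d] and [3 * d]: for e <= d, points of [K] displaced
   by up to [2 * e] stay in [L], and [3 * d < q]. *)
pose d := q / 4.
have d0 : 0 < d by rewrite divr_gt0.
pose cb (s : R) := [set x : Rn | `|x0 - x| <= s].
have ccb s : compact (cb s).
  have := compact_translate (c := x0) (@compact_norm_ball R n s).
  have E : [set y | [set x : Rn | `|x| <= s] (y - x0)] = cb s.
    by apply/funext => y; rewrite /cb /mkset distrC.
  by rewrite E.
have cbU s : s < q -> cb s `<=` U by move=> sq x xs; apply: qU; exact: le_lt_trans sq.
have open_ball s : open [set x : Rn | `|x0 - x| < s].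
  rewrite (_ : [set x | _] = ball x0 s); first exact: ball_open.
  by rewrite -ball_normE.
have d1q : d < q by rewrite /d; lra.
have d3q : 3 * d < q by rewrite /d; lra.
have KU : compactly_inside (cb d) U.
  by split => // x /(cbU _ d1q); rewrite (interior_id U).1.
have LU : compactly_inside (cb (3 * d)) U.
  by split => // x /(cbU _ d3q); rewrite (interior_id U).1.
have KL : compactly_inside (cb d) (cb (3 * d)).
  split => // x xd; have xd3 : [set x : Rn | `|x0 - x| < 3 * d] x.
    by rewrite /mkset; apply: le_lt_trans xd _; lra.
  have nx := open_nbhs_nbhs (conj (open_ball (3 * d)) xd3).
  by apply: (@filterS _ _ (nbhs_filter x) _ _ _ nx) => y /ltW.
have [c [l [B [lI [Bs Bb] UB]]]] := UP _ _ KU LU KL 0%N.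
have [A [p [A0 AP]]] := I0_eval_bound lI.
(* The power [Y ^+ p] grows like [e^-1 ^+ ((c + n) * p)]; an [N] beyond this exponent leaves a
   factor [e]. *)
exists d => //; exists ((c + n) * p).+1 => N r NN N0 kr eta eta0.
have [D D1 rD] := chain_bounded_upto c kr.
have D0 : 0 <= D by apply: le_trans D1.
have [M1 M1P] := Bb _ (c + N)%N (ccb (3 * d)) (cbU _ d3q).
pose M := `|M1|; have MP f : B f -> seminorm (cb (3 * d)) (c + N) f <= M.
  by move=> /M1P h; apply: le_trans h (ler_norm _).
pose Z := 2 * (2 * M * D * approx_constant n D).
have Z0 : 0 <= Z.
  have M0 : 0 <= M by exact: normr_ge0.
  have S0 := approx_constant_ge0 n (fun x => rD 0%N x isT).
  by rewrite /Z !mulr_ge0.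
pose W := A * (D ^+ n) ^+ p * Z.
have W0 : 0 <= W.
  by apply: mulr_ge0 => //; apply: mulr_ge0 => //; do 2 apply: exprn_ge0.
(* The bounds 1 and [d] control powers and supports, the third makes [delta_seminorm] at most 1, and
   the last brings the final estimate [W * e] below [eta]. Adding 1 keeps the denominators
   positive. *)
pose e1 := Num.min (Num.min 1 d) (Num.min (Z + 1)^-1 (eta / (W + 1))).
have e10 : 0 < e1.
  by rewrite !lt_min ltr01 d0 invr_gt0 divr_gt0 ?ltr_wpDl.
exists e1 => // e x e0; rewrite !lt_min => /andP[/andP[e_1 e_d] /andP[eZ eW]] xd.
set phi := kernel_test _.
have dw := scaled_chain e kr; have w0 := @scaled_support R N r e kr e0.
have [tp sp] : testfun setT phi /\ supp phi `<=` [set z | `|z| <= e].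
  exact: testfun_kernel.
have tr : translates_in (cb d) phi (cb (3 * d)).
  move=> y z yd /sp /= ze; rewrite /cb /= opprD addrA.
  by apply: le_trans (ler_normB _ _) _; move: yd ze; rewrite /cb /=; lra.
have KOm : cb d `<=` Om by move=> y /(cbU _ d1q) /UO.
have LOm : cb (3 * d) `<=` Om by move=> y /(cbU _ d3q) /UO.
have KUd := translates_in_Udom KOm LOm tr.
have H := UB phi tp tr.
apply: (@le_trans _ _ (seminorm (cb d) 0 (iota_c u phi))).
  have := @cpartial_le_seminorm R n (Udom Om phi) (cb d) 0 (iota_c u phi) [::] x
    (Udom_open oO tp) (ccb d) KUd (iota_smooth oO ud tp) isT xd.
  by rewrite cpartial_nil.
apply: le_trans H _.
have ei1 : 1 <= e^-1 by rewrite invf_ge1// ltW.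
have zB : delta_seminorm (cb d) c B phi <= Z * e ^+ N.
  have := @delta_seminorm_kernel U (cb d) (cb (3 * d)) B c N r e D M oU (ccb _)
    (cbU _ d3q) N0 kr e0 (fun x => rD 0%N x isT) (normr_ge0 _) _ Bs MP.
  rewrite -/phi => h; apply: le_trans (h _) _.
    move=> y z yd ze; rewrite /cb /= opprD addrA.
    by apply: le_trans (ler_normB _ _) _; move: yd ze; rewrite /cb /=; lra.
  by rewrite le_eqVlt; apply/orP; left; apply/eqP; rewrite /Z; ring.
have eN : e ^+ N <= e.
  by have := expr_inv_le e0 (ltW e_1) N0; rewrite expr0 mul1r.
have z1 : delta_seminorm (cb d) c B phi <= 1.
  apply: le_trans zB _; apply: le_trans (_ : Z * e <= 1); first exact: ler_wpM2l.
  have : e * (Z + 1) < 1 by rewrite -ltr_pdivlMr ?ltr_wpDl// div1r.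
  by move/ltW; apply: le_trans; rewrite mulrDr mulr1 mulrC lerDl ltW.
pose Y := e^-1 ^+ (c + n) * D ^+ n.
have Y1 : 1 <= Y by rewrite /Y -[leLHS]mulr1 ler_pM// exprn_ege1.
have yY : seminorm setT c phi <= Y.
  apply: seminorm_kernel => //; first exact: ltW.
  move=> j y jc; apply: scaled_le => // y'; exact: rD.
apply: le_trans (AP _ _ Y Y1 (seminorm_ge0 _ _ _) yY (delta_seminorm_ge0 _ _ _ _) z1) _.
apply: (@le_trans _ _ (A * Y ^+ p * (Z * e ^+ N))).
  by apply: ler_wpM2l => //; rewrite mulr_ge0// exprn_ge0// (le_trans _ Y1).
have -> : A * Y ^+ p * (Z * e ^+ N) = W * (e^-1 ^+ ((c + n) * p) * e ^+ N).
  rewrite /W /Y exprMn -[(e^-1 ^+ (c + n)) ^+ p]exprM.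
  move: (e^-1 ^+ _) (e ^+ N) ((D ^+ n) ^+ p) => X1 X2 X3; ring.
apply: (@le_trans _ _ (W * e)).
  apply: ler_wpM2l => //.
  exact: (expr_inv_le e0 (ltW e_1) NN).
move: eW; rewrite ltr_pdivlMr ?ltr_wpDl// => eW; apply: le_trans (ltW eW).
by rewrite mulrDr mulr1 mulrC lerDl ltW.
Qed.

End NegligibleKernel.

(** * Integrals over a set and Riemann sums *)

Section SetIntegral.
Context d (T : measurableType d) (R : realType) (mu : {measure set T -> \bar R}).
Local Notation C := R[i].
Local Notation normc := Normc.normc.
Implicit Types (A B : set T) (g h : T -> C).

Definition cintA A g : C :=
  (\int[mu]_(t in A) complex.Re (g t)) +i* (\int[mu]_(t in A) complex.Im (g t)).

Definition cbdd A M g :=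
  (forall b, measurable_fun setT (fun t => cpart b (g t))) /\
  forall t, A t -> normc (g t) <= M.

Lemma cbdd_integrable A M g b : measurable A -> (mu A < +oo)%E -> cbdd A M g ->
  mu.-integrable A (EFin \o (fun t => cpart b (g t))).
Proof.
move=> mA Aoo [mg gM]; apply: measurable_bounded_integrable => //.
  exact: measurable_funTS.
exists M; split; first exact: num_real.
by move=> x Mx y Ay /=; apply: le_trans (cpart_le _ _) (le_trans (gM y Ay) (ltW Mx)).
Qed.

Lemma cpart_cintA A g b : cpart b (cintA A g) = \int[mu]_(t in A) cpart b (g t).
Proof. by case: b. Qed.

Lemma Rintegral_lin A (x : R) (F G : T -> R) : measurable A ->
  mu.-integrable A (EFin \o F) -> mu.-integrable A (EFin \o G) ->
  \int[mu]_(t in A) (x * F t + G t) = x * \int[mu]_(t in A) F t + \int[mu]_(t in A) G t.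
Proof.
move=> mA iF iG; rewrite RintegralD//; first by rewrite RintegralZl.
have -> : EFin \o (fun t => x * F t) = (fun t => x%:E * (EFin \o F) t)%E.
  by apply/funext => t /=; rewrite EFinM.
exact: integrableZl.
Qed.

Lemma integrable_lin A (x : R) (F G : T -> R) : measurable A ->
  mu.-integrable A (EFin \o F) -> mu.-integrable A (EFin \o G) ->
  mu.-integrable A (EFin \o (fun t => x * F t + G t)).
Proof.
move=> mA iF iG.
have -> : EFin \o (fun t => x * F t + G t) = (fun t => x%:E * (EFin \o F) t + (EFin \o G) t)%E.
  by apply/funext => t /=; rewrite EFinD EFinM.
by apply: integrableD => //; exact: integrableZl.
Qed.

Lemma cintA_lin A M M' g h (a : C) : measurable A -> (mu A < +oo)%E ->
  cbdd A M g -> cbdd A M' h ->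
  cintA A (fun t => a * g t + h t) = a * cintA A g + cintA A h.
Proof.
move=> mA Aoo bg bh.
have gr := cbdd_integrable true mA Aoo bg; have gi := cbdd_integrable false mA Aoo bg.
have hr := cbdd_integrable true mA Aoo bh; have hi := cbdd_integrable false mA Aoo bh.
rewrite /cpart in gr gi hr hi.
apply: complex_ext.
  rewrite cReD cReM -!/(cpart true _) -!/(cpart false _) !cpart_cintA /cpart.
  rewrite (_ : (fun t => _) = fun t => complex.Re a * complex.Re (g t) +
     ((- complex.Im a) * complex.Im (g t) + complex.Re (h t))); last first.
    by apply/funext => x; rewrite cReD cReM; ring.
  by rewrite Rintegral_lin ?Rintegral_lin//; [ring|exact: integrable_lin].
rewrite cImD cImM -!/(cpart true _) -!/(cpart false _) !cpart_cintA /cpart.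
rewrite (_ : (fun t => _) = fun t => complex.Re a * complex.Im (g t) +
   (complex.Im a * complex.Re (g t) + complex.Im (h t))); last first.
  by apply/funext => x; rewrite cImD cImM; ring.
by rewrite Rintegral_lin ?Rintegral_lin//; [ring|exact: integrable_lin].
Qed.

Lemma cintA_le A M g : measurable A -> (mu A < +oo)%E -> cbdd A M g ->
  normc (cintA A g) <= 2 * M * fine (mu A).
Proof.
move=> mA Aoo bg; have [mg gM] := bg; apply: le_trans (normc_le_parts _) _.
have H b : `|cpart b (cintA A g)| <= M * fine (mu A).
  rewrite cpart_cintA; have ig := cbdd_integrable b mA Aoo bg.
  have icst : mu.-integrable A (EFin \o cst M).
    apply: measurable_bounded_integrable => //.
    exists `|M|; split; first exact: num_real.
    by move=> x Mx y _ /=; exact: ltW.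
  apply: le_trans (le_normr_Rintegral mA ig) _.
  rewrite -Rintegral_cst//; apply: le_Rintegral; [exact: mA| |exact: icst|].
  - exact: integrable_norm ig.
  - by move=> t At; apply: le_trans (cpart_le _ _) (gM t At).
by rewrite -mulrA mulrDl mul1r; apply: lerD; [exact: (H true)|exact: (H false)].
Qed.

Lemma cintA_split A B M g : measurable A -> measurable B -> (mu A < +oo)%E ->
  cbdd A M g -> cintA A g = cintA (A `&` B) g + cintA (A `\` B) g.
Proof.
move=> mA mB Aoo bg; have AE : A = (A `&` B) `|` (A `\` B) by rewrite setUIDK.
have mI : measurable (A `&` B) by exact: measurableI.
have mD : measurable (A `\` B) by exact: measurableD.
have dis : [disjoint A `&` B & A `\` B].
  by apply/disj_setPS => t [[_ Bt] [_ nBt]].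
have H b : \int[mu]_(t in A) cpart b (g t) =
    \int[mu]_(t in A `&` B) cpart b (g t) + \int[mu]_(t in A `\` B) cpart b (g t).
  rewrite {1}AE Rintegral_setU// -AE; exact: cbdd_integrable bg.
by apply: complex_ext; [rewrite cReD; exact: (H true)|rewrite cImD; exact: (H false)].
Qed.

End SetIntegral.

Section Quadrature.
Variables (R : realType) (n : nat).
Local Notation mR := (measurableTypeR R).
Local Notation T := (n.-tuple mR).
Local Notation Rn := 'rV[R]_n.
Local Notation C := R[i].
Local Notation normc := Normc.normc.
Local Notation leb := (lebesgue_tuple R n).

Lemma cpart_mul_measurable (g h : T -> C) :
  (forall b, measurable_fun setT (fun t => cpart b (g t))) ->
  (forall b, measurable_fun setT (fun t => cpart b (h t))) ->
  forall b, measurable_fun setT (fun t => cpart b (g t * h t)).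
Proof.
move=> mg mh b.
have E : (fun t => cpart b (g t * h t)) = if b
  then (fun t => cpart true (g t) * cpart true (h t) - cpart false (g t) * cpart false (h t))
  else (fun t => cpart true (g t) * cpart false (h t) + cpart false (g t) * cpart true (h t)).
  by case: b; apply/funext => t; rewrite /cpart ?cReM ?cImM.
rewrite E; case: b {E}.
  by apply: measurable_funB; apply: measurable_funM.
by apply: measurable_funD; apply: measurable_funM.
Qed.

(** Nodes and weights are fixed before [k], so that one sum serves all derivatives of a test
    function at all points. The set [A] is cut along the balls around the nodes, and each node is
    weighted by the integral of [g] over its piece, on which [k] varies by at most [La * dlt]. *)
Lemma quadrature (g : T -> C) (P dlt : R) (ps : seq Rn) : 0 <= P -> 0 <= dlt ->
  (forall b, measurable_fun setT (fun t => cpart b (g t))) ->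
  (forall t, normc (g t) <= P) ->
  forall A : set T, measurable A -> (leb A < +oo)%E ->
  (forall t, A t -> exists2 p, p \in ps & `|p - row_of_tuple t| < dlt) ->
  exists ws : seq (C * Rn), [/\ (forall wp, wp \in ws -> wp.2 \in ps),
    \sum_(wp <- ws) normc wp.1 <= 2 * P * fine (leb A) &
    forall (k : Rn -> C) (La Mk : R), 0 <= La ->
      (forall b, continuous (fun x => cpart b (k x))) -> (forall x, normc (k x) <= Mk) ->
      (forall x y, normc (k x - k y) <= La * `|x - y|) ->
      normc (cintA leb A (fun t => g t * k (row_of_tuple t)) -
             \sum_(wp <- ws) wp.1 * k wp.2) <= 2 * (P * (La * dlt)) * fine (leb A)].
Proof.
move=> P0 dlt0 mg gP; elim: ps => [|p ps IH] A mA Aoo cov.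
  have -> : A = set0 by apply/seteqP; split => // t /cov [].
  exists [::]; split => //; first by rewrite big_nil measure0 mulr0.
  move=> k La Mk La0 ck kM kL; rewrite big_nil subr0 measure0 mulr0.
  by rewrite /cintA !Rintegral_set0 Normc.normc0.
pose B : set T := @row_of_tuple R n @^-1` [set x | `|p - x| < dlt].
have mB : measurable B.
  apply: measurable_row_open.
  rewrite (_ : [set x | _] = ball p dlt); first exact: ball_open.
  by rewrite -ball_normE.
have mI : measurable (A `&` B) by exact: measurableI.
have mD : measurable (A `\` B) by exact: measurableD.
have Ioo : (leb (A `&` B) < +oo)%E.
  by apply: le_lt_trans Aoo; apply: le_measure; rewrite ?inE//; exact: subIsetl.
have Doo : (leb (A `\` B) < +oo)%E.
  by apply: le_lt_trans Aoo; apply: le_measure; rewrite ?inE//; exact: subDsetl.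
have muE : fine (leb A) = fine (leb (A `&` B)) + fine (leb (A `\` B)).
  rewrite -fineD ?ge0_fin_numE//; congr fine.
  by rewrite addeC -measureDI.
have [|ws [wsP wsS wsE]] := IH _ mD Doo.
  move=> t [At nBt]; have [q] := cov t At; rewrite inE => /orP[/eqP -> //|qs qt].
  by exists q.
pose w := cintA leb (A `&` B) g.
exists ((w, p) :: ws); split.
- by move=> wp; rewrite !inE => /orP[/eqP -> /=|/wsP ->]; rewrite ?eqxx ?orbT.
- rewrite big_cons muE mulrDr; apply: lerD => //=.
  by apply: cintA_le => //; split => // t _.
move=> k La Mk La0 ck kM kL.
have mk b : measurable_fun setT (fun t => cpart b (k (@row_of_tuple R n t))).
  exact: (measurable_row_continuous (ck b)).
have bg A' : cbdd A' P g by split => // t _.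
have bgk A' : cbdd A' (P * Mk) (fun t => g t * k (row_of_tuple t)).
  split; first exact: cpart_mul_measurable.
  by move=> t _; rewrite Normc.normcM; apply: ler_pM; rewrite ?normc_ge0.
rewrite (cintA_split mA mB Aoo (bgk A)) big_cons /=.
have -> a b c e : a + b - (c + e) = (a - c) + (b - e) :> C by ring.
apply: le_trans (normc_addle _ _) _; rewrite muE mulrDr; apply: lerD; last exact: wsE.
have -> : cintA leb (A `&` B) (fun t => g t * k (row_of_tuple t)) - w * k p =
    cintA leb (A `&` B) (fun t => (- k p) * g t + g t * k (row_of_tuple t)).
  by rewrite (cintA_lin (- k p) mI Ioo (bg _) (bgk _)) /w; ring.
apply: cintA_le => //; split.
  have mkp b : measurable_fun [set: T] (fun t : T => cpart b (- k p)) by exact: measurable_cst.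
  move=> b.
  rewrite (_ : (fun t => _) = fun t => cpart b (- k p * g t) + cpart b (g t * k (row_of_tuple t))).
    by apply: measurable_funD; exact: cpart_mul_measurable.
  by apply/funext => t; rewrite cpartD.
move=> t [_ Bt]; rewrite (_ : _ + _ = g t * (k (row_of_tuple t) - k p)); last by ring.
rewrite Normc.normcM; apply: ler_pM; rewrite ?normc_ge0//.
apply: le_trans (kL _ _) _; apply: ler_wpM2l => //.
by rewrite distrC; exact: ltW.
Qed.

Lemma compact_ball_cover (K : set Rn) (r : Rn -> R) : compact K ->
  (forall x, K x -> 0 < r x) -> exists ps : seq Rn, (forall p, p \in ps -> K p) /\
    forall x, K x -> exists2 p, p \in ps & `|p - x| < r p.
Proof.
rewrite compact_cover => cK r0.
have [|x Kx|D' D'K cov] := cK _ K (fun p => [set x | `|p - x| < r p]).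
- move=> p Kp; rewrite (_ : [set x | _] = ball p (r p)); first exact: ball_open.
  by rewrite -ball_normE.
- by exists x => //=; rewrite subrr normr0; exact: r0.
exists (finmap.enum_fset D'); split; first by move=> p pD; have := D'K p pD; rewrite inE.
by move=> x /cov [p pD px]; exists p.
Qed.

(** [K] is covered by finitely many balls of radius [r p] whose doubles lie in [Om]; a displacement
    below every [r p] stays inside the doubled balls. *)
Lemma compact_thickening (Om K : set Rn) : open Om -> compact K -> K `<=` Om ->
  exists (e : R) (K' : set Rn), [/\ 0 < e, compact K', K' `<=` Om &
    forall x z, K x -> `|z| <= e -> K' (x + z)].
Proof.
move=> oO cK KO.
have /choice[r rP] : forall x, exists r : R, K x -> 0 < r /\ forall y, `|x - y| < 2 * r -> Om y.
  move=> x; have [Kx|nK] := pselect (K x); last by exists 0.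
  have /(nbhs_ballP x)[q /= q0 qU] := open_nbhs_nbhs (conj oO (KO x Kx)).
  exists (q / 2) => _; split; first by rewrite divr_gt0.
  by move=> y; rewrite mulrC divfK// => xy; apply: qU; rewrite -ball_normE.
have [ps [psK psC]] := compact_ball_cover cK (fun x Kx => (rP x Kx).1).
have [e e0 ep] : exists2 e : R, 0 < e & forall p, p \in ps -> e <= r p.
  elim: ps psK {psC} => [|p ps IH] psK; first by exists 1.
  have [q qs|e e0 ep] := IH; first by apply: psK; rewrite inE qs orbT.
  have rp0 : 0 < r p by apply: (rP p _).1; apply: psK; rewrite mem_head.
  exists (Num.min e (r p)); first by rewrite lt_min e0.
  move=> q; rewrite inE => /orP[/eqP ->|/ep h]; rewrite ge_min ?lexx ?orbT//.
  by rewrite h.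
pose K' := (fun z : Rn * Rn => z.1 + z.2) @` (K `*` [set z | `|z| <= e]).
exists e, K'; split => //.
- apply: continuous_compact; last by apply: compact_setX => //; exact: compact_norm_ball.
  apply: continuous_subspaceT => z.
  have E := cvgD (@cvg_fst _ _ (nbhs z.1) (nbhs z.2) _) (@cvg_snd _ _ (nbhs z.1) (nbhs z.2) _).
  exact: E.
- move=> _ [[x z] [/= Kx ze] <-]; have [p pps px] := psC x Kx.
  have [_ pO] := rP p (psK p pps); apply: pO.
  rewrite opprD addrA; apply: le_lt_trans (ler_normB _ _) _.
  by have := ep p pps; move: px ze; lra.
- by move=> x z Kx ze; exists (x, z).
Qed.

End Quadrature.

Section Vanishing.
Variables (R : realType) (n : nat).
Local Notation Rn := 'rV[R]_n.
Local Notation C := R[i].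
Local Notation normc := Normc.normc.
Local Notation leb := (lebesgue_tuple R n).
Variables (Om : set Rn) (u : (Rn -> C) -> C).
Hypotheses (oO : open Om) (ud : is_distribution Om u).
Implicit Types (phi psi : Rn -> C).

Lemma mul_div_le (x e : R) : 0 <= x -> 0 <= e -> x * (e / (x + 1)) <= e.
Proof.
move=> x0 e0; rewrite mulrCA; apply: ler_piMr => //.
by rewrite ler_pdivrMr ?ltr_wpDl// mul1r lerDl.
Qed.

Lemma quadrature_testfun phi (K : set Rn) (S : set Rn) (ws : seq (C * Rn)) :
  testfun setT phi -> compact K -> K `<=` Om -> S `<=` Om ->
  (forall x y, S x -> supp phi y -> K (x + y)) ->
  (forall wp, wp \in ws -> S wp.2) ->
  let Q := fun y => \sum_(wp <- ws) wp.1 * phi (y - wp.2) in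
  [/\ testfun Om Q, supp Q `<=` K,
    forall s y, cpartial s Q y = \sum_(wp <- ws) wp.1 * cpartial s phi (y - wp.2) &
    u Q = \sum_(wp <- ws) wp.1 * iota_c u phi wp.2].
Proof.
move=> tp cK KO SO SK; elim: ws => [|[w p] ws IH] wsS /=.
  have -> : (fun y : Rn => \sum_(wp <- [::]) wp.1 * phi (y - wp.2)) = fun=> 0 :> C.
    by apply/funext => y; rewrite big_nil.
  split; first exact: testfun0.
  - by apply: supp_sub => //; exact: compact_closedRn.
  - by move=> s y; rewrite cpartial_cst0 big_nil.
  - have := dist_lin ud 1 (testfun0 Om) (testfun0 Om).
    rewrite big_nil (_ : (fun y => _) = fun=> 0); last by apply/funext => y; rewrite mulr0 addr0.
    by move/eqP; rewrite mul1r -subr_eq0 opprD addrA subrr add0r oppr_eq0 => /eqP.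
have [|tQ sQ dQ uQ] := IH; first by move=> wp h; apply: wsS; rewrite inE h orbT.
have Sp : S p by apply: (wsS (w, p)); rewrite mem_head.
have Up : Udom Om phi p by split => [|y py]; [exact: SO|apply: KO; exact: SK].
have tphi := shift_testfun tp Up.
have sphi : supp (shift_test phi p) `<=` K by exact: (shift_supp tp Up (fun y py => SK _ _ Sp py)).
have E : (fun y => \sum_(wp <- (w, p) :: ws) wp.1 * phi (y - wp.2)) =
  (fun y => w * shift_test phi p y + \sum_(wp <- ws) wp.1 * phi (y - wp.2)).
  by apply/funext => y; rewrite big_cons.
rewrite E; have [tN sN] := testfun_lin w tphi tQ sphi sQ cK KO.
split => //.
- move=> s y; have [s1 _ _] := tphi; have [s2 _ _] := tQ.
  by rewrite (cpartial_lin w s openT s1 s2 I) dQ big_cons /shift_test cpartial_translate.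
- by rewrite (dist_lin ud w tphi tQ) uQ big_cons.
Qed.

(** For even [phi] the function y |-> integral of psi(x) phi(x - y) is the convolution of [psi] and
    [phi]; evenness also places its support in the sum of the two supports. *)
Lemma convolution_testfun psi phi (K : set Rn) :
  testfun Om psi -> testfun setT phi -> (forall z, phi (- z) = phi z) ->
  compact K -> K `<=` Om ->
  (forall x y, supp psi x -> supp phi y -> K (x + y)) ->
  testfun Om (iota_c (dist_of_fun psi) phi) /\
  supp (iota_c (dist_of_fun psi) phi) `<=` K.
Proof.
move=> tq tp pe cK KO qK; have [sq _ _] := tq.
apply: (@testfun_intro _ _ _ K _ _ cK KO).
  have := iota_smooth openT (dist_of_fun_distribution sq) tp.
  by apply: smooth_sub => x _; split.
move=> y nK; rewrite /iota_c /dist_of_fun -[RHS](integralRn0 R n).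
congr integralRn; apply/funext => x.
have [->|/eqP q0] := eqVneq (psi x) 0; first by rewrite mul0r.
have [->|/eqP p0] := eqVneq (phi (x - y)) 0; first by rewrite mulr0.
exfalso; apply: nK; rewrite -[y](addrNK x) addrC; apply: qK.
  by apply: contrapT => /notsupp.
by apply: contrapT => /notsupp; rewrite -opprB pe.
Qed.

(** A Riemann sum [Q] of translates of [phi] approximates the convolution together with its
    derivatives up to order [m], so [u] is almost unchanged. As [u Q] is the weighted sum of the
    regularizations at the nodes, it is bounded by the total weight times [eta]. The constant
    depends on [psi] only. *)
Lemma dist_convolution_le psi : testfun Om psi ->
  exists2 B : R, 0 <= B & forall phi (K : set Rn) (eta : R),
    testfun setT phi -> (forall z, phi (- z) = phi z) -> compact K -> K `<=` Om ->
    (forall x y, supp psi x -> supp phi y -> K (x + y)) -> 0 <= eta ->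
    (forall x, supp psi x -> normc (iota_c u phi x) <= eta) ->
    normc (u (iota_c (dist_of_fun psi) phi)) <= B * eta.
Proof.
move=> tq; have [sq cq qO] := tq; have tqT := testfunT tq.
have [P P0 PP] := testfun_bounded 0 tqT.
have qP x : normc (psi x) <= P by have := PP [::] x isT; rewrite cpartial_nil.
pose A := @row_of_tuple R n @^-1` supp psi.
have mA : measurable A.
  rewrite -[A]setCK; apply: measurableC.
  by apply: (measurable_row_open (W := ~` supp psi)); exact: open_nsupp.
have [b b0 bP] := compact_in_ball cq.
have Aoo : (leb A < +oo)%E.
  apply: (@le_lt_trans _ _ (leb (@tbox R n b))); last exact: tbox_lty.
  apply: le_measure; rewrite ?inE//; first exact: measurable_tbox.
  by move=> t /bP/(row_in_tbox _ b0).
pose V := fine (leb A).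
have V0 : 0 <= V by exact: fine_ge0.
exists (2 * P * V); first by rewrite !mulr_ge0.
move=> phi K eta tp pe cK KO qK eta0 Teta; have [sp _ _] := tp.
have [tPsi sPsi] := convolution_testfun tq tp pe cK KO qK.
set Psi := iota_c (dist_of_fun psi) phi in tPsi sPsi *.
have [M [m [M0 uM]]] := dist_estimate ud cK KO.
pose La := 2 * (n%:R * seminorm setT m.+1 phi).
have La0 : 0 <= La by rewrite !mulr_ge0// seminorm_ge0.
apply/ler_addgt0Pl => e e0.
(* The mesh is chosen so that [M] times the quadrature error is at most [e]. *)
pose dlt := e / (M * (2 * (P * La) * V) + 1).
have X0 : 0 <= M * (2 * (P * La) * V).
  exact: (mulr_ge0 M0 (mulr_ge0 (mulr_ge0 (ler0n _ _) (mulr_ge0 P0 La0)) V0)).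
have dlt0 : 0 < dlt by rewrite divr_gt0// ltr_wpDl.
have [ps [psS psC]] := compact_ball_cover cq (fun (x : Rn) _ => dlt0).
pose g := psi \o @row_of_tuple R n.
have mg b' : measurable_fun setT (fun t => cpart b' (g t)).
  apply: (measurable_row_continuous (G := fun x => cpart b' (psi x))) => x.
  by have [] := smooth_cpart b' sq [::] (x := x) I.
have [ws [wsP wsS wsE]] := quadrature P0 (ltW dlt0) mg (fun t => qP _) mA Aoo
  (fun t At => psC _ At).
have [tQ sQ dQ uQ] := quadrature_testfun tp cK KO qO qK (fun wp h => psS _ (wsP wp h)).
set Q := (fun y => \sum_(wp <- ws) _) in tQ sQ dQ uQ.
have [tD sD] := testfun_lin (-1) tQ tPsi sQ sPsi cK KO.
have uE : u Psi = u (fun y => -1 * Q y + Psi y) + u Q.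
  by rewrite (dist_lin ud (-1) tQ tPsi) mulN1r addrAC addNr add0r.
rewrite uE; apply: le_trans (normc_addle _ _) _; apply: lerD.
  apply: (@le_trans _ _ (M * (2 * (P * (La * dlt)) * V))); last first.
    have -> : M * (2 * (P * (La * dlt)) * V) = M * (2 * (P * La) * V) * dlt by ring.
    exact: mul_div_le X0 (ltW e0).
  apply: uM => //.
    exact: (mulr_ge0 (mulr_ge0 (ler0n _ _) (mulr_ge0 P0 (mulr_ge0 La0 (ltW dlt0)))) V0).
  move=> s y sm; have [s1 _ _] := tQ; have [s2 _ _] := tPsi.
  rewrite (cpartial_lin (-1) s openT s1 s2 I) dQ mulN1r addrC.
  (* Evenness turns [phi (t - x')] into [phi (x' - t)], whose derivatives are translates of
     [cpartial s phi]; the integrand vanishes off the support of [psi]. *)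
  have -> : cpartial s Psi y = cintA leb A (fun t => g t * cpartial s phi (y - row_of_tuple t)).
    rewrite /Psi (partial_iota_fun openT s sq tp); last by split.
    have H b' : cpart b' (integralRn (fun x => psi x *
          cpartial s (fun x' => phi (x - x')) y)) =
        cpart b' (cintA leb A (fun t => g t * cpartial s phi (y - row_of_tuple t))).
      rewrite cpart_cintA (_ : cpart b' (integralRn _) =
        \int[leb]_t cpart b' (psi (row_of_tuple t) *
          cpartial s (fun x' => phi (row_of_tuple t - x')) y)); last by case: b'.
      rewrite [in RHS]Rintegral_mkcond; congr (Rintegral _ _ _); apply/funext => t.
      rewrite /patch; case: ifPn => [_|nA].
        congr (cpart _ (_ * _)).
        rewrite -[RHS]/((fun y' => cpartial s phi (y' - row_of_tuple t)) y).
        rewrite -cpartial_translate; congr (cpartial s _ y).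
        by apply/funext => y'; rewrite -opprB pe.
      rewrite (@notsupp _ _ psi) ?mul0r; first by case: (b').
      by move=> h; move/negP: nA; apply; rewrite inE.
    by apply: complex_ext; [exact: (H true)|exact: (H false)].
  apply: (wsE (fun x => cpartial s phi (y - x)) La (seminorm setT m phi) La0).
  - move=> b' x; have sk := smooth_reflect y (smooth_cpartial s sp).
    by have [] := smooth_cpart b' sk [::] (x := x) I.
  - by move=> x; exact: cpartial_le_seminormT.
  - move=> x x'; apply: le_trans (testfun_lipschitz tp sm _ _) _.
    by rewrite opprB addrC addrA subrK distrC.
rewrite uQ; apply: (@le_trans _ _ (\sum_(wp <- ws) normc wp.1 * eta)).
  elim: ws wsP {wsS wsE tQ sQ dQ uQ tD sD uE Q} => [|wp ws IH] wsP.
    by rewrite !big_nil Normc.normc0.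
  rewrite !big_cons; apply: le_trans (normc_addle _ _) _; apply: lerD.
    rewrite Normc.normcM; apply: ler_wpM2l; first exact: normc_ge0.
    by apply: Teta; apply: psS; apply: wsP; rewrite mem_head.
  by apply: IH => wp' h; apply: wsP; rewrite inE h orbT.
by rewrite -mulr_suml; apply: ler_wpM2r.
Qed.

Lemma kernel_test_even N (r : nat -> R -> R) e (z : Rn) : kernel N r ->
  kernel_test (scaled_kernel r e) (- z) = kernel_test (scaled_kernel r e) z.
Proof.
move=> kr; rewrite /kernel_test /product_kernel; congr (_%:C).
by apply: eq_bigr => i _; rewrite mxE (scaled_even e kr).
Qed.

(** The value [u psi] is split into [u] of the difference to the convolution, small because the
    convolution approximates [psi] with all derivatives up to order [m], and [u] of the convolution,
    small by negligibility. Each is brought below half of [ep]. *)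
Lemma negligible_vanish psi : c_negligible Om (iota_c u) -> testfun Om psi -> u psi = 0.
Proof.
move=> neg tq; have [sq cq qO] := tq; have tqT := testfunT tq.
have [e0 [K [e00 cK KO KP]]] := compact_thickening oO cq qO.
have [M [m [M0 uM]]] := dist_estimate ud cK KO.
have [B B0 BP] := dist_convolution_le tq.
have /choice[d dP] : forall x0, exists d : R, Om x0 -> 0 < d /\ exists N0 : nat,
    forall N r, (N0 <= N)%N -> (0 < N)%N -> kernel N r -> forall eta : R, 0 < eta ->
    exists2 e1 : R, 0 < e1 & forall e x, 0 < e -> e < e1 -> `|x0 - x| <= d ->
      normc (iota_c u (@kernel_test R n (scaled_kernel r e)) x) <= eta.
  move=> x0; have [Ox0|nO] := pselect (Om x0); last by exists 0.
  by have [d d0 dP] := negligible_kernel oO ud neg Ox0; exists d.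
have [ps [psS psC]] := compact_ball_cover cq (fun x qx => (dP x (qO x qx)).1).
(* The sum of the thresholds over the finite cover dominates each of them, and the successor makes
   [N] positive. *)
have [N N0 NP] : exists2 N : nat, (0 < N)%N & forall p, p \in ps ->
    forall r, kernel N r -> forall eta : R, 0 < eta ->
    exists2 e1 : R, 0 < e1 & forall e x, 0 < e -> e < e1 -> `|p - x| <= d p ->
      normc (iota_c u (@kernel_test R n (scaled_kernel r e)) x) <= eta.
  have /choice[N0 NP] : forall p, exists N0 : nat, supp psi p ->
      forall N r, (N0 <= N)%N -> (0 < N)%N -> kernel N r -> forall eta : R, 0 < eta ->
      exists2 e1 : R, 0 < e1 & forall e x, 0 < e -> e < e1 -> `|p - x| <= d p ->
        normc (iota_c u (@kernel_test R n (scaled_kernel r e)) x) <= eta.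
    move=> p; have [qp|nq] := pselect (supp psi p); last by exists 0%N.
    by have [_ [N0 NP]] := dP p (qO p qp); exists N0.
  exists (\sum_(p <- ps) N0 p).+1 => // p pps r kr; apply: (NP p (psS p pps)) kr => //.
  by apply: leqW; rewrite (big_rem p)//= leq_addr.
have [r kr] := kernel_exists R N0.
have [D D1 rD] := chain_bounded_upto 0 kr.
have rD0 x : `|r 0%N x| <= D by exact: rD.
have D0 : 0 <= D by apply: le_trans D1.
pose Mq := seminorm setT (m + N) psi.
have Mq0 : 0 <= Mq by exact: seminorm_ge0.
have S0 := approx_constant_ge0 n rD0.
pose Z := 2 * (2 * Mq * D * approx_constant n D).
have Z0 : 0 <= Z by rewrite /Z !mulr_ge0.
apply: Normc.eq0_normc; apply/eqP; rewrite eq_le normc_ge0 andbT.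
apply/ler_addgt0Pl => ep ep0; rewrite addr0.
pose eta := ep / 2 / (B + 1).
have eta0 : 0 < eta by rewrite !divr_gt0// ltr_wpDl.
have [e1 e10 e1P] : exists2 e1 : R, 0 < e1 & forall e x, 0 < e -> e < e1 -> supp psi x ->
    normc (iota_c u (@kernel_test R n (scaled_kernel r e)) x) <= eta.
  suff [e1 e10 e1P] : exists2 e1 : R, 0 < e1 & forall p, p \in ps ->
      forall e x, 0 < e -> e < e1 -> `|p - x| <= d p ->
      normc (iota_c u (@kernel_test R n (scaled_kernel r e)) x) <= eta.
    exists e1 => // e x ee0 ee1 /psC [p pps px]; exact: (e1P p pps e x ee0 ee1 (ltW px)).
  elim: ps NP {psS psC} => [|p ps IH] NP; first by exists 1.
  have [q qs|e1 e10 e1P] := IH; first by apply: NP; rewrite inE qs orbT.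
  have [e2 e20 e2P] := NP p (mem_head _ _) r kr eta eta0.
  exists (Num.min e1 e2); first by rewrite lt_min e10.
  move=> q; rewrite inE => /orP[/eqP ->|qs] e x ee0; rewrite lt_min => /andP[h1 h2].
    exact: e2P.
  exact: e1P.
(* The bound [e0] keeps the supports in [K], half of [e1] gives a strict inequality, and the last
   entry makes the approximation error at most [ep / 2]. *)
pose e := Num.min (Num.min 1 e0) (Num.min (e1 / 2) (ep / 2 / (M * Z + 1))).
have MZ0 : 0 <= M * Z by rewrite mulr_ge0.
have ee0 : 0 < e.
  by rewrite !lt_min ltr01 e00 !divr_gt0// ltr_wpDl.
have [ee1 eeK eee1 eeZ] : [/\ e <= 1, e <= e0, e < e1 & e <= ep / 2 / (M * Z + 1)].
  split; rewrite ?ge_min ?gt_min ?lexx ?orbT//=.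
  by apply/orP; right; apply/orP; left; rewrite ltr_pdivrMr// ltr_pMr// ltr1n.
set phi := @kernel_test R n (scaled_kernel r e).
have [tp sp] : testfun setT phi /\ supp phi `<=` [set z | `|z| <= e].
  by apply: testfun_kernel => //; [exact: scaled_chain kr|exact: (scaled_support kr)].
have pe z : phi (- z) = phi z by exact: kernel_test_even kr.
have qK x y : supp psi x -> supp phi y -> K (x + y).
  by move=> qx /sp /= ye; apply: KP => //; exact: le_trans ye eeK.
have [tPsi sPsi] := convolution_testfun tq tp pe cK KO qK.
have H2 := BP phi K eta tp pe cK KO qK (ltW eta0) (fun x qx => e1P e x ee0 eee1 qx).
set Psi := iota_c (dist_of_fun psi) phi in tPsi sPsi H2 *.
have spK : supp psi `<=` K.
  by move=> x qx; rewrite -[x]addr0; apply: KP => //; rewrite normr0 ltW.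
have [tD sD] := testfun_lin (-1) tq tPsi spK sPsi cK KO.
have uE : u psi = - u (fun y => -1 * psi y + Psi y) + u Psi.
  by rewrite (dist_lin ud (-1) tq tPsi) mulN1r opprD opprK subrK.
rewrite uE; apply: le_trans (normc_addle _ _) _; rewrite normc_opp [leRHS](splitr ep).
apply: lerD; last first.
  exact: le_trans H2 (mul_div_le B0 (divr_ge0 (ltW ep0) (ler0n _ _))).
apply: (@le_trans _ _ (M * (Z * e))); last first.
  rewrite mulrA; apply: le_trans (ler_wpM2l MZ0 eeZ) _.
  exact: mul_div_le MZ0 (divr_ge0 (ltW ep0) (ler0n _ _)).
apply: uM => //; first by rewrite mulr_ge0// ltW.
move=> s y sm; have [s2 _ _] := tPsi.
rewrite (cpartial_lin (-1) s openT sq s2 I) mulN1r addrC.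
have UT x : Udom setT phi x by split.
(* In this form the derivatives fall on [psi], so the approximation estimate applies to
   [cpartial s psi]. *)
have -> : Psi = correlate phi psi.
  by apply/funext => x; exact: (iota_correlate openT sq tp (UT x)).
rewrite (correlate_cpartial openT tp s sq (UT y)).
apply: le_trans (kernel_approximation N0 kr ee0 rD0 Mq0 (smooth_cpartial s sq) _ _) _.
- by [].
- move=> i z _; rewrite -cpartial_cat; apply: cpartial_le_seminormT => //.
  by rewrite size_cat size_nseq addnC leq_add2r.
- have eN : e ^+ N <= e by have := expr_inv_le ee0 ee1 N0; rewrite expr0 mul1r.
  have -> : 2 * (2 * Mq * D * e ^+ N * approx_constant n D) = Z * e ^+ N by rewrite /Z; ring.
  exact: ler_wpM2l.
Qed.

End Vanishing.

Theorem theorem27 (R : realType) (n : nat) (Om : set 'rV[R]_n)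
    (u : ('rV[R]_n -> R[i]) -> R[i]) (f : 'rV[R]_n -> R[i])
    (Om_open : open Om) (u_dist : is_distribution Om u) (f_smooth : smooth Om f) :
  [/\ c_moderate Om (iota_c u),
      c_moderate Om (sigma_c f),
      c_negligible Om (iota_c (dist_of_fun f) - sigma_c f) &
      c_negligible Om (iota_c u) ->
        forall phi, testfun Om phi -> u phi = 0].
Proof.
split.
- exact: iota_moderate.
- exact: sigma_moderate.
- exact: iota_sub_sigma_negligible.
- by move=> neg phi tphi; exact: negligible_vanish neg tphi.
Qed.
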